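(* Let $r\ge 2$, let $p_1,\ldots,p_r>0$ with $\sum_{j=1}^r p_j=1$, and suppose that $\lambda$ is a positive integer or any real number greater than $5$. Then there is a constant $C(\lambda,p_1,\ldots,p_r)$, involving $\lambda$ and $p_1,\ldots,p_r$ but not $n$ and $r$, such that for every $h\in C_b^6(\mathbb{R}^+)$, $$|\mathbb{E}h(T_\lambda(\mathbf{W}))-\chi^2_{(r-1)}h|\le C(\lambda,p_1,\ldots,p_r)\,r^7n^{-1}(h_6+\tilde h_3),$$ where $T_\lambda(\mathbf{W})$ is the power divergence statistic with index $\lambda$ based on $n$ trials with classification probabilities $p_1,\ldots,p_r$, and $\chi^2_{(r-1)}h=\mathbb{E}h(Y)$ for $Y\sim\chi^2_{(r-1)}$.
   Context: Consider $n$ independent trials, each leading to a unique classification over $r$ classes, class $j$ having probability $p_j>0$. Let $U_j$ be the number of trials falling in class $j$ (so $(U_1,\ldots,U_r)$ is multinomial with parameters $n$ and $(p_1,\ldots,p_r)$), $W_j=\frac{U_j-np_j}{\sqrt{np_j}}$ and $\mathbf{W}=(W_1,\ldots,W_r)^T$. The power divergence statistic is $$T_\lambda(\mathbf{W})=\frac{2}{\lambda(\lambda+1)}\sum_{j=1}^rU_j\Big[\Big(\frac{U_j}{np_j}\Big)^\lambda-1\Big]=\frac{2}{\lambda(\lambda+1)}\Big[\sum_{j=1}^r np_j\Big(1+\frac{W_j}{\sqrt{np_j}}\Big)^{\lambda+1}-n\Big].$$ $C_b^k(I)$ denotes the class of real-valued functions on $I$ whose derivatives of order $k$ all exist and are bounded;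 $\mathbb{R}^+=[0,\infty)$. With $\|\cdot\|$ the supremum norm and ${m\brace j}=\frac{1}{j!}\sum_{i=0}^j(-1)^{j-i}\binom{j}{i}i^m$ the Stirling numbers of the second kind, $h_m=\sum_{j=1}^m{m\brace j}\|h^{(j)}\|$ and $\tilde h_m=\sum_{k=1}^m{m\brace k}\big(2^m\|h^{(k)}\|+\|h^{(k+1)}\|\big)$. *)

(* Defs.v *)
From HB Require Import structures.
From mathcomp Require Import all_boot all_order all_algebra.
From mathcomp Require Import all_classical all_reals all_analysis.
From mathcomp Require Import measurable_realfun.

Set Implicit Arguments.
Unset Strict Implicit.
Unset Printing Implicit Defensive.

Import Order.TTheory GRing.Theory Num.Theory.
Import numFieldNormedType.Exports.

Local Open Scope classical_set_scope.
Local Open Scope ring_scope.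

Section Functions.
Context {R : realType}.
Implicit Types (h : R -> R) (x : R).

(* A function on [0, +oo[ is represented by any h : R -> R extending it: every
   definition below, read at points x >= 0, uses only the values of h there.
   Derivatives are thus one-sided at 0. *)
Definition nneg_diffq h x (y : R) : R := (h y - h x) / (y - x).

Definition nneg_derivable h x : Prop :=
  cvg (nneg_diffq h x @ within `[0, +oo[%classic (dnbhs x)).

Definition nneg_deriv h x : R :=
  lim (nneg_diffq h x @ within `[0, +oo[%classic (dnbhs x)).

Definition nneg_derivn (k : nat) h : R -> R := iter k nneg_deriv h.

Definition Cb (k : nat) h : Prop :=
  (forall j, (j < k)%N ->
     forall x, 0 <= x -> nneg_derivable (nneg_derivn j h) x) /\
  (exists M, forall x, 0 <= x -> `|nneg_derivn k h x| <= M).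

(* Possibly +oo: membership in Cb k bounds only the derivative of order k. *)
Definition nneg_supnorm (f : R -> R) : \bar R :=
  ereal_sup [set `|f x|%:E | x in `[0, +oo[%classic].

Definition stirling2 (m j : nat) : R :=
  (j`!)%:R^-1 * \sum_(i < j.+1) (-1) ^+ (j - i) * 'C(j, i)%:R * i%:R ^+ m.

Definition hnorm (m : nat) h : \bar R :=
  (\sum_(1 <= j < m.+1)
     (stirling2 m j)%:E * nneg_supnorm (nneg_derivn j h))%E.

Definition htnorm (m : nat) h : \bar R :=
  (\sum_(1 <= k < m.+1)
     (stirling2 m k)%:E * ((2 ^+ m)%:E * nneg_supnorm (nneg_derivn k h)
                           + nneg_supnorm (nneg_derivn k.+1 h)))%E.

End Functions.

Section Trials.
Context {d : measure_display} {T : measurableType d} {R : realType}.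
Variable P : probability T R.

(* X i t is the class of trial i under the outcome t.  Taking A i = setT for
   some of the i gives the product rule for every subfamily. *)
Definition independent_trials (n r : nat) (p : 'I_r -> R)
    (X : 'I_n -> T -> 'I_r) : Prop :=
  [/\ forall i j, measurable (X i @^-1` [set j]),
      forall i j, P (X i @^-1` [set j]) = (p j)%:E &
      forall A : 'I_n -> set 'I_r,
        P (\bigcap_i (X i @^-1` A i)) =
        (\prod_(i < n) fine (P (X i @^-1` A i)))%:E].

End Trials.

Section PowerDivergence.
Context {R : realType}.

Definition counts (S : Type) (n r : nat) (X : 'I_n -> S -> 'I_r) (t : S)
    (j : 'I_r) : nat :=
  #|[set i | X i t == j]%SET|.

Definition standardize (n r : nat) (p : 'I_r -> R) (U : 'I_r -> nat)
    (j : 'I_r) : R :=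
  ((U j)%:R - n%:R * p j) / Num.sqrt (n%:R * p j).

Definition power_divergence (lambda : R) (n r : nat) (p W : 'I_r -> R) : R :=
  2 / (lambda * (lambda + 1)) *
  (\sum_(j < r)
     n%:R * p j * (1 + W j / Num.sqrt (n%:R * p j)) `^ (lambda + 1) - n%:R).

Lemma power_divergence_counts (lambda : R) (n r : nat) (p : 'I_r -> R)
    (U : 'I_r -> nat) :
  0 < lambda -> (0 < n)%N -> (forall j, 0 < p j) -> (\sum_j U j = n)%N ->
  power_divergence lambda n p (standardize n p U) =
  2 / (lambda * (lambda + 1)) *
  \sum_(j < r) (U j)%:R * (((U j)%:R / (n%:R * p j)) `^ lambda - 1).
Proof.
move=> l0 n0 p0 sU; rewrite /power_divergence; congr (_ * _).
rewrite -[in X in _ - X]sU natr_sum -sumrB; apply: eq_bigr => j _.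
have np0 : 0 < n%:R * p j by rewrite mulr_gt0// ltr0n.
have -> : 1 + standardize n p U j / Num.sqrt (n%:R * p j)
          = (U j)%:R / (n%:R * p j).
  rewrite /standardize -mulrA -invfM -expr2 sqr_sqrtr ?ltW//.
  by rewrite mulrBl divff ?gt_eqF// addrC subrK.
have x0 : 0 <= (U j)%:R / (n%:R * p j) by rewrite divr_ge0 ?ler0n ?ltW.
have -> : ((U j)%:R / (n%:R * p j)) `^ (lambda + 1)
          = ((U j)%:R / (n%:R * p j)) `^ lambda * ((U j)%:R / (n%:R * p j)).
  by rewrite powRD ?powRr1// gt_eqF// addr_gt0.
rewrite mulrBr mulr1; congr (_ - _).
by rewrite mulrCA [X in _ * X]mulrC divfK ?gt_eqF// mulrC.
Qed.

End PowerDivergence.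

Section ChiSquare.
Context {R : realType}.

Local Notation mR := (measurableTypeR R).

Definition sqr_add (z : mR * mR) : mR := z.1 ^+ 2 + z.2.

Lemma measurable_sqr_add : measurable_fun [set: mR * mR] sqr_add.
Proof. by apply: measurable_funD => //; apply: measurable_funX. Qed.

HB.instance Definition _ := isMeasurableFun.Build _ _ _ _ sqr_add
  measurable_sqr_add.

(* The law of Z_1 ^+ 2 + ... + Z_k ^+ 2 with Z_1, ..., Z_k independent standard
   normal variables. *)
Fixpoint chi_square (k : nat) : probability mR R :=
  if k is k'.+1 then
    distribution (normal_prob (0 : R) 1 \x chi_square k')%E sqr_add
  else \d_(0 : mR).

Definition chi_square_expectation (k : nat) (h : R -> R) : \bar R :=
  (\int[chi_square k]_(x in `[0%R, +oo[) (h x)%:E)%E.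

End ChiSquare.

(* Main.v *)
Require Import Defs.
From mathcomp Require Import all_boot all_order all_algebra.
From mathcomp Require Import all_classical all_reals all_analysis.
From mathcomp Require Import measurable_realfun.
From mathcomp Require Import ring lra zify.

(** Let k = r - 1. The vector q of the square roots of the p_j is a unit vector
    orthogonal to W, and in orthonormal coordinates of the hyperplane orthogonal
    to q the vector W becomes Y = n^(-1/2) (b_1 + ... + b_n), where the jumps b_i
    in R^k are independent, bounded, of mean 0 and of identity covariance, and
    |W|^2 = |Y|^2 ([hyperplane_jump_law], [hyperplane_jump_cov],
    [lift_hyperplane_isometry], [standardize_lift]). The expectation of F(Y) is the
    n-th iterate, at the origin, of the averaging of F over one jump ([convolve],
    [iter_convolve], [expectation_trials]).

    Expanding the powers at 1 gives T = |W|^2 + n^(-1/2) c(W) + O(1/n) with c a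
    cubic form, hence

      h(T) = h(|Y|^2) + n^(-1/2) h'(|Y|^2) c(Y) + O(1/n)

    up to a factor of exponential growth in Y ([power_divergence_expansion],
    [tame_power_divergence]), which is harmless because Y has bounded exponential
    moments ([walk_expw]).

    The rate 1/n, instead of the usual n^(-1/2), comes from symmetry. Write
    e = n^(-1/2). Two jump laws with the same moments of order less than m have
    averages that differ by O(e^m) on smooth functions
    ([convolve_moments_vanish]), and Lindeberg's argument exchanges n jumps of one
    law for n jumps of the other at n times this cost ([telescoping]).
    - On the odd function h'(|Y|^2) c(Y), the walk and its mirror image give
      opposite values, while they can be exchanged at the cost n e^3 = e. So the
      expectation is O(e), and the cubic term contributes O(1/n) ([walk_odd]).
    - On the even function h(|Y|^2), the odd part of the jump law is of order e^3
      and produces an odd function, which is in turn only seen through the odd part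
      of a second jump. The jumps can thus be symmetrized at the cost
      n^2 e^6 = 1/n ([walk_even]).
    - The symmetrized jump agrees to the third order with independent coin tosses
      along the k axes: they can be exchanged at the cost n e^4 ([walk_axes]).
    - Along an axis, a coin toss agrees to the third order with a Gaussian step of
      the same variance, again at the cost n e^4 ([coin_walk]), and the n Gaussian
      steps add up to a standard Gaussian ([iter_heat]). Replacing the axes one at
      a time turns |Y|^2 into a chi-square variable with k degrees of freedom
      ([axes_walk_chi_square]).

    All these estimates are uniform over the test functions whose derivatives of
    orders 1 to 6 on the half-line are bounded by 1 ([tame]); the half-line is never
    left, since T is nonnegative ([power_divergence_ge0]). As h_6 dominates the
    supremum norms of these derivatives ([hnorm_ge]), the function (h - h(0)) / M is
    such a test function for every M > h_6, and the theorem follows by letting M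
    decrease to h_6. *)

Set Implicit Arguments.
Unset Strict Implicit.
Unset Printing Implicit Defensive.
Import Order.TTheory GRing.Theory Num.Theory.
Import numFieldNormedType.Exports.
Local Open Scope classical_set_scope.
Local Open Scope ring_scope.

(** * Exponential weights *)

Section Weights.
Context {R : realType} {k : nat}.
Local Notation V := 'rV[R]_k.
Implicit Types (v a b : V) (q x : R) (f g : V -> R).

Definition l1norm v : R := \sum_j `|v 0 j|.

Definition expw q v : R := expR (q * l1norm v).

(** Dominates [expw], up to the rate, by [expw_expsum]. Taylor estimates
    use [expw], which is submultiplicative; iterating a jump uses
    [expsum], which is a sum over the coordinates and so only involves the
    one-dimensional marginals. *)
Definition expsum q v : R :=
  1 + \sum_j (expR (q * v 0 j) + expR (- q * v 0 j)).

Lemma l1norm_ge0 v : 0 <= l1norm v.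
Proof. exact: sumr_ge0. Qed.

Lemma l1normD v a : l1norm (v + a) <= l1norm v + l1norm a.
Proof.
by rewrite /l1norm -big_split/=; apply: ler_sum => j _; rewrite mxE ler_normD.
Qed.

Lemma l1normZ x v : l1norm (x *: v) = `|x| * l1norm v.
Proof.
by rewrite /l1norm mulr_sumr; apply: eq_bigr => j _; rewrite mxE normrM.
Qed.

Lemma expw_ge0 q v : 0 <= expw q v. Proof. exact: expR_ge0. Qed.

Lemma expwM q q' v : expw q v * expw q' v = expw (q + q') v.
Proof. by rewrite /expw -expRD mulrDl. Qed.

Lemma expw_le q q' v : q <= q' -> expw q v <= expw q' v.
Proof. by move=> qq'; rewrite ler_expR ler_wpM2r ?l1norm_ge0. Qed.

Lemma expwD q v a : 0 <= q -> expw q (v + a) <= expw q v * expw q a.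
Proof.
by move=> q0; rewrite /expw -expRD ler_expR -mulrDr ler_wpM2l ?l1normD.
Qed.

Lemma expwZ q x v : 0 <= q -> 0 <= x <= 1 -> expw q (x *: v) <= expw q v.
Proof.
move=> q0 /andP[x0 x1]; rewrite ler_expR ler_wpM2l// l1normZ ger0_norm//.
by rewrite ler_piMl ?l1norm_ge0.
Qed.

Lemma expsum_ge1 q v : 1 <= expsum q v.
Proof. by rewrite lerDl sumr_ge0// => j _; rewrite addr_ge0 ?expR_ge0. Qed.

Lemma expsum_ge0 q v : 0 <= expsum q v.
Proof. by rewrite (le_trans _ (expsum_ge1 q v)). Qed.

Lemma expR_normM q x : 0 <= q ->
  expR (q * `|x|) <= expR (q * x) + expR (- q * x).
Proof.
move=> q0; have [x0|x0] := ger0P x; first by rewrite lerDl expR_ge0.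
by rewrite mulrN mulNr lerDr expR_ge0.
Qed.

(** The exponential of a sum over coordinates is controlled by the largest
    coordinate, at the price of multiplying the rate by the dimension. *)
Lemma expw_expsum q v : 0 <= q -> expw q v <= expsum (k%:R * q) v.
Proof.
move=> q0; have [k0|k0] := posnP k.
  rewrite /expw /l1norm big1 ?mulr0 ?expR0 ?expsum_ge1// => j _.
  by case: j => j jk; exfalso; move: jk; rewrite k0.
pose j0 := [arg max_(j > Ordinal k0) `|v 0 j|]%O.
have vj j : `|v 0 j| <= `|v 0 j0|.
  by rewrite /j0; case: arg_maxP => // i _; exact.
have : l1norm v <= k%:R * `|v 0 j0|.
  rewrite /l1norm (le_trans (ler_sum _ (fun j _ => vj j)))//.
  by rewrite sumr_const card_ord mulr_natl.
move=> vk; apply: (@le_trans _ _ (expR (k%:R * q * `|v 0 j0|))).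
  by rewrite ler_expR mulrAC mulrC ler_wpM2r.
apply: le_trans (expR_normM _ _) _; first by rewrite mulr_ge0.
rewrite /expsum (bigD1 j0)//= addrCA lerDl addr_ge0// sumr_ge0// => j _;
  rewrite addr_ge0 ?expR_ge0.
Qed.

End Weights.

(** * Averaging over a random jump *)

Section Convolution.
Context {R : realType} {k : nat}.
Local Notation V := 'rV[R]_k.
Implicit Types (v a : V) (e : R) (f g : V -> R).

(** The expectation of [f] after a jump of size [e] from [v], when [c] is the
    law of the jump; with signed weights [c] of total mass 0 it is a
    difference operator. *)
Definition convolve (L : finType) (c : L -> R) (b : L -> V) e f v : R :=
  \sum_l c l * f (v + e *: b l).

Lemma convolveB (L : finType) (c : L -> R) b e f g v :
  convolve c b e (fun w => f w - g w) v = convolve c b e f v - convolve c b e g v.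
Proof. by rewrite /convolve -sumrB; apply: eq_bigr => l _; rewrite mulrBr. Qed.

Lemma convolveD (L : finType) (c : L -> R) b e f g v :
  convolve c b e (fun w => f w + g w) v = convolve c b e f v + convolve c b e g v.
Proof. by rewrite /convolve -big_split; apply: eq_bigr => l _; rewrite mulrDr. Qed.

Lemma convolveZ (L : finType) (c : L -> R) b e x f v :
  convolve c b e (fun w => x * f w) v = x * convolve c b e f v.
Proof. by rewrite /convolve mulr_sumr; apply: eq_bigr => l _; rewrite mulrCA. Qed.

Lemma convolveC (L L' : finType) (c : L -> R) (c' : L' -> R) b b' e e' f v :
  convolve c b e (convolve c' b' e' f) v = convolve c' b' e' (convolve c b e f) v.
Proof.
rewrite /convolve; under eq_bigr do rewrite mulr_sumr.
rewrite exchange_big/=; apply: eq_bigr => l' _.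
rewrite mulr_sumr; apply: eq_bigr => l _.
by rewrite mulrCA addrAC.
Qed.

Lemma norm_convolve_le (L : finType) (c : L -> R) b e f g v :
  (forall l, 0 <= c l) -> (forall w, `|f w| <= g w) ->
  `|convolve c b e f v| <= convolve c b e g v.
Proof.
move=> c0 fg; apply: le_trans (ler_norm_sum _ _ _) _; apply: ler_sum => l _.
by rewrite normrM ger0_norm// ler_wpM2l.
Qed.

End Convolution.

(** * Exchanging the steps of two walks *)

Section Telescoping.
Context {R : realType} {V : Type}.
Variables (W : V -> R) (rho : R) (A B : (V -> R) -> V -> R).
(* [ok] is the class of functions on which the steps behave linearly; it is
   nontrivial only when a step is an integral. *)
Variable ok : (V -> R) -> Prop.
Hypothesis W0 : forall v, 0 <= W v.
Hypothesis rho1 : 1 <= rho.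
Hypothesis okA : forall f, ok f -> ok (A f).
Hypothesis okB : forall f, ok f -> ok (B f).
Hypothesis okD : forall f g, ok f -> ok g -> ok (fun v => f v - g v).
Hypothesis AD : forall f g, ok f -> ok g ->
  A (fun v => f v - g v) = fun v => A f v - A g v.
Hypothesis BD : forall f g, ok f -> ok g ->
  B (fun v => f v - g v) = fun v => B f v - B g v.
Hypothesis AB : forall f, ok f -> A (B f) = B (A f).
Hypothesis Ale : forall f (C : R), ok f -> 0 <= C ->
  (forall v, `|f v| <= C * W v) -> forall v, `|A f v| <= C * rho * W v.
Hypothesis Ble : forall f (C : R), ok f -> 0 <= C ->
  (forall v, `|f v| <= C * W v) -> forall v, `|B f v| <= C * rho * W v.

Lemma iter_ok f n : ok f -> ok (iter n A f).
Proof. by move=> okf; elim: n => //= n IH; exact: okA. Qed.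

Lemma iter_opB f g n : ok f -> ok g ->
  iter n A (fun v => f v - g v) = fun v => iter n A f v - iter n A g v.
Proof.
by move=> okf okg; elim: n => //= n ->; rewrite AD//; exact: iter_ok.
Qed.

Lemma iter_growth f (C : R) n : ok f -> 0 <= C ->
  (forall v, `|f v| <= C * W v) ->
  forall v, `|iter n A f v| <= C * rho ^+ n * W v.
Proof.
move=> okf C0 fW; elim: n => [|n IH] v /=; first by rewrite expr0 mulr1.
rewrite exprSr mulrA; apply: Ale => //; first exact: iter_ok.
by rewrite mulr_ge0// exprn_ge0// (le_trans _ rho1).
Qed.

(** Lindeberg's argument: the [n] steps are exchanged one at a time. Since
    the two steps commute, each exchange costs the error of one step,
    multiplied by the growth of the weight over the other steps. *)
Lemma telescoping f (d : R) n : ok f -> 0 <= d ->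
  (forall v, `|A f v - B f v| <= d * W v) ->
  forall v, `|iter n A f v - iter n B f v| <= n%:R * d * rho ^+ n * W v.
Proof.
have rho0 : 0 <= rho by rewrite (le_trans _ rho1).
move=> okf d0; elim: n => [|n IH] fd v /=.
  by rewrite subrr normr0 !mul0r.
have itAB m : iter m A (B f) = B (iter m A f).
  by elim: m => //= m ->; rewrite AB//; exact: iter_ok.
have okBn m : ok (iter m B f) by elim: m => //= m; exact: okB.
have -> : A (iter n A f) v - B (iter n B f) v =
    iter n A (fun w => A f w - B f w) v
    + B (fun w => iter n A f w - iter n B f w) v.
  rewrite iter_opB//; [|exact: okA|exact: okB].
  rewrite BD//; last exact: iter_ok.
  by rewrite itAB addrA subrK -iterSr.
apply: le_trans (ler_normD _ _) _.
have h1 := @iter_growth _ _ n (okD (okA okf) (okB okf)) d0 fd v.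
have h2 : `|B (fun w => iter n A f w - iter n B f w) v|
    <= n%:R * d * rho ^+ n * rho * W v.
  apply: Ble; first by apply: okD => //; exact: iter_ok.
    by rewrite !mulr_ge0// exprn_ge0.
  exact: IH.
apply: le_trans (lerD h1 h2) _.
rewrite -mulrDl ler_wpM2r// exprSr -natr1.
have : 0 <= d * rho ^+ n by rewrite mulr_ge0// exprn_ge0.
by move=> y0; have := ler_peMr y0 rho1; lra.
Qed.

End Telescoping.

(** * Uniformly smooth families of functions *)

Lemma is_derive_affine {R : realType} (x y t : R) :
  is_derive t 1 (fun s : R => x + s * y) y.
Proof.
apply: (is_derive_eq (is_deriveD (is_derive_cst x t 1)
  (is_deriveM (is_derive_id t 1) (is_derive_cst y t 1)))).
by rewrite /cst /= scaler0 !add0r [_ *: _]mulr1.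
Qed.

Section Smooth.
Context {R : realType} {k : nat}.
Local Notation V := 'rV[R]_k.
Implicit Types (v a : V) (t : R).

(** The constants depend on the family but not on its index. The index will
    range over all normalized test functions, and this is where the
    uniformity of the final rate comes from. *)
Definition uniform_growth (I : Type) (F : I -> V -> R) : Prop :=
  exists C q : R, [/\ 0 <= C, 0 <= q &
    forall i v, `|F i v| <= C * expw q v].

(** Partial derivatives are characterized by the derivatives along all lines,
    so that only one-variable calculus is needed. *)
Definition gradient (I : Type) (F : I -> V -> R) (G : 'I_k -> I -> V -> R) :=
  forall i v a t, is_derive t 1 (fun s => F i (v + s *: a))
                            (\sum_j a 0 j * G j i (v + t *: a)).

Fixpoint smooth (m : nat) (I : Type) (F : I -> V -> R) : Prop :=
  uniform_growth F /\
  if m is m'.+1 then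
    exists2 G : 'I_k -> I -> V -> R, (forall j, smooth m' (G j)) & gradient F G
  else True.

Lemma smooth_growth m I (F : I -> V -> R) : smooth m F -> uniform_growth F.
Proof. by case: m => [|m] []. Qed.

Lemma smoothW m n I (F : I -> V -> R) : (m <= n)%N -> smooth n F -> smooth m F.
Proof.
elim: m n F => [|m IH] [|n] F //=; first by move=> _ [].
rewrite ltnS => mn [gF [G sG dG]]; split => //; exists G => // j.
exact: IH (sG j).
Qed.

Lemma smooth_reindex m I J (phi : J -> I) (F : I -> V -> R) :
  smooth m F -> smooth m (fun i => F (phi i)).
Proof.
have gr I' J' (ph : J' -> I') (F' : I' -> V -> R) : uniform_growth F' ->
    uniform_growth (fun i => F' (ph i)).
  by move=> [C [q [C0 q0 FC]]]; exists C, q; split.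
elim: m F => [|m IH] F /= [gF]; first by move=> _; split => //; exact: gr.
move=> [G sG dG]; split; first exact: gr.
by exists (fun j i => G j (phi i)) => [j|i v a t]; [exact: IH|exact: dG].
Qed.

Lemma growthD I (F G : I -> V -> R) :
  uniform_growth F -> uniform_growth G ->
  uniform_growth (fun i v => F i v + G i v).
Proof.
move=> [C [q [C0 q0 FC]]] [D [p [D0 p0 GD]]].
exists (C + D), (q + p); split; rewrite ?addr_ge0// => i v.
rewrite mulrDl (le_trans (ler_normD _ _))// lerD//.
  by rewrite (le_trans (FC i v))// ler_wpM2l// expw_le// lerDl.
by rewrite (le_trans (GD i v))// ler_wpM2l// expw_le// lerDr.
Qed.

Lemma growthM I (F G : I -> V -> R) :
  uniform_growth F -> uniform_growth G ->
  uniform_growth (fun i v => F i v * G i v).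
Proof.
move=> [C [q [C0 q0 FC]]] [D [p [D0 p0 GD]]].
exists (C * D), (q + p); split; rewrite ?addr_ge0 ?mulr_ge0// => i v.
by rewrite normrM -expwM mulrACA ler_pM.
Qed.

Lemma growth_scalar I (c : I -> R) (B : R) :
  (forall i, `|c i| <= B) -> uniform_growth (fun i (_ : V) => c i).
Proof.
move=> cB; exists `|B|, 0; split => // i v.
by rewrite /expw mul0r expR0 mulr1 (le_trans (cB i))// ler_norm.
Qed.

Lemma smoothD m I (F G : I -> V -> R) : smooth m F -> smooth m G ->
  smooth m (fun i v => F i v + G i v).
Proof.
elim: m F G => [|m IH] F G /= [gF].
  by move=> _ [gG _]; split => //; exact: growthD.
move=> [F' sF' dF] [gG [G' sG' dG]]; split; first exact: growthD.
exists (fun j i v => F' j i v + G' j i v) => [j|i v a t]; first exact: IH.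
rewrite (eq_bigr (fun j => a 0 j * F' j i (v + t *: a)
                           + a 0 j * G' j i (v + t *: a))).
  by rewrite big_split/=; exact: (is_deriveD (dF i v a t) (dG i v a t)).
by move=> j _; rewrite mulrDr.
Qed.

Lemma smooth_scalar m I (c : I -> R) (B : R) :
  (forall i, `|c i| <= B) -> smooth m (fun i _ => c i).
Proof.
move=> cB; have sc I' (c' : I' -> R) (B' : R) n : (forall i, `|c' i| <= B') ->
    smooth n (fun i _ => c' i).
  elim: n I' c' B' => [|n IH] I' c' B' c'B; split => //; try exact: growth_scalar c'B.
  exists (fun _ _ _ => 0) => [j|i v a t].
    by apply: (IH I' (fun=> 0) 0) => i; rewrite normr0.
  by rewrite big1 => [|j _]; [exact: is_derive_cst|rewrite mulr0].
exact: sc cB.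
Qed.

Lemma smoothM m I (F G : I -> V -> R) : smooth m F -> smooth m G ->
  smooth m (fun i v => F i v * G i v).
Proof.
elim: m F G => [|m IH] F G /=.
  by move=> [gF _] [gG _]; split => //; exact: growthM.
move=> sF sG; have [gF [F' sF' dF]] := sF; have [gG [G' sG' dG]] := sG.
split; first exact: growthM.
have sFm : smooth m F by apply: (@smoothW m m.+1).
have sGm : smooth m G by apply: (@smoothW m m.+1).
exists (fun j i v => F i v * G' j i v + G i v * F' j i v) => [j|i v a t].
  by apply: smoothD; exact: IH.
rewrite (eq_bigr (fun j => F i (v + t *: a) * (a 0 j * G' j i (v + t *: a))
                       + G i (v + t *: a) * (a 0 j * F' j i (v + t *: a)))).
  rewrite big_split/= -!mulr_sumr.
  exact: (is_deriveM (dF i v a t) (dG i v a t)).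
by move=> j _; rewrite mulrDr ![a 0 j * (_ * _)]mulrCA.
Qed.

Lemma smoothZ m I (x : R) (F : I -> V -> R) : smooth m F ->
  smooth m (fun i v => x * F i v).
Proof. by move=> sF; apply: smoothM => //; apply: (@smooth_scalar _ _ _ `|x|). Qed.

Lemma smooth_sum m I (J : Type) (s : seq J) (F : J -> I -> V -> R) :
  (forall j, smooth m (F j)) -> smooth m (fun i v => \sum_(j <- s) F j i v).
Proof.
move=> sF; elim: s => [|j s IH].
  suff -> : (fun i v => \sum_(j <- [::]) F j i v) = (fun _ _ => 0).
    by apply: (@smooth_scalar _ _ _ 0) => i; rewrite normr0.
  by apply/funext => i; apply/funext => v; rewrite big_nil.
suff -> : (fun i v => \sum_(j0 <- j :: s) F j0 i v) =
    (fun i v => F j i v + \sum_(j0 <- s) F j0 i v) by exact: smoothD.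
by apply/funext => i; apply/funext => v; rewrite big_cons.
Qed.

Lemma smoothX m I n (F : I -> V -> R) : smooth m F ->
  smooth m (fun i v => F i v ^+ n).
Proof.
move=> sF; elim: n => [|n IH].
  suff -> : (fun i v => F i v ^+ 0) = (fun _ _ => 1).
    by apply: (@smooth_scalar _ _ _ 1) => i; rewrite normr1.
  by apply/funext => i; apply/funext => v; rewrite expr0.
suff -> : (fun i v => F i v ^+ n.+1) = (fun i v => F i v * F i v ^+ n).
  exact: smoothM.
by apply/funext => i; apply/funext => v; rewrite exprS.
Qed.

Lemma smooth_coord m I (j : 'I_k) : smooth m (fun (_ : I) v => v 0 j).
Proof.
have g : uniform_growth (fun (_ : I) v => v 0 j).
  exists 1, 1; split => // i v; rewrite mul1r /expw mul1r.
  apply: (@le_trans _ _ (1 + l1norm v)); last exact: expR_ge1Dx.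
  rewrite /l1norm (bigD1 j)//= addrCA lerDl addr_ge0// sumr_ge0//.
case: m => [|m]; split => //.
exists (fun l _ _ => (l == j)%:R) => [l|i v a t].
  by apply: (@smooth_scalar _ _ _ 1) => i; case: eqP; rewrite ?normr1 ?normr0.
rewrite (bigD1 j)//= eqxx mulr1 big1 => [|l /negbTE ->]; last by rewrite mulr0.
rewrite addr0.
have -> : (fun s : R => (v + s *: a) 0 j) = (fun s => v 0 j + s * a 0 j).
  by apply/funext => s; rewrite !mxE.
exact: is_derive_affine.
Qed.

Definition sqnorm v : R := \sum_j v 0 j ^+ 2.

Lemma sqnorm_ge0 v : 0 <= sqnorm v.
Proof. by apply: sumr_ge0 => j _; exact: sqr_ge0. Qed.

Lemma smooth_sqnorm m I : smooth m (fun (_ : I) v => sqnorm v).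
Proof. by apply: smooth_sum => j; apply: smoothX; exact: smooth_coord. Qed.

(** [H j] is the derivative of order [j] on the half-line of a test function
    normalized by the size of its derivatives; off the half-line [H] matters
    only through the two-sided differentiability at 0. *)
Definition tame (H : nat -> R -> R) : Prop :=
  [/\ H 0 0 = 0,
      forall j (x : R), (j < 6)%N -> 0 <= x -> is_derive x 1 (H j) (H j.+1 x) &
      forall j (x : R), (0 < j <= 6)%N -> 0 <= x -> `|H j x| <= 1].

Lemma is_derive_sqnorm v a t :
  is_derive t 1 (fun s => sqnorm (v + s *: a))
            (\sum_j a 0 j * (2 * (v + t *: a) 0 j)).
Proof.
have -> : (fun s : R => sqnorm (v + s *: a)) =
    \sum_j (fun s : R => (v + s *: a) 0 j) ^+ 2.
  by apply/funext => s; rewrite fct_sumE.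
apply: is_derive_sum => j.
have -> : (fun s : R => (v + s *: a) 0 j) = (fun s => v 0 j + s * a 0 j).
  by apply/funext => s; rewrite !mxE.
apply: (is_derive_eq (is_deriveX 2 (is_derive_affine _ _ _))).
by rewrite [_ *: _]mulrC !mxE.
Qed.

End Smooth.

(** * Normalized test functions of the squared norm *)

Section Mvt.
Context {R : realType}.

Lemma is_derive_within_continuous (f df : R -> R) (a b : R) :
  (forall x, x \in `[a, b] -> is_derive x 1 f (df x)) ->
  {within `[a, b], continuous f}.
Proof.
move=> fdf; apply: derivable_within_continuous => x xab.
by have := fdf _ xab => -[].
Qed.

Lemma mvt_bound (f df : R -> R) (a b M : R) : a <= b ->
  (forall x, x \in `[a, b] -> is_derive x 1 f (df x)) ->
  (forall x, x \in `[a, b] -> `|df x| <= M) ->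
  `|f b - f a| <= M * (b - a).
Proof.
move=> ab fdf dfM.
have fdfo x : x \in `]a, b[ -> is_derive x 1 f (df x).
  by move=> xab; apply: fdf; exact: subset_itv_oo_cc.
have [c cab ->] := MVT_segment ab fdfo (is_derive_within_continuous fdf).
by rewrite normrM [`|b - a|]ger0_norm ?subr_ge0// ler_wpM2r ?subr_ge0// dfM.
Qed.

End Mvt.

Section SmoothTame.
Context {R : realType} {k : nat}.

Lemma tame_derive0_bound (H : nat -> R -> R) (x : R) : tame H -> 0 <= x ->
  `|H 0%N x| <= x.
Proof.
move=> [H0 dH bH] x0; rewrite -[H 0%N x]subr0 -{1}H0 -[leRHS]mul1r -[X in 1 * X]subr0.
apply: (@mvt_bound _ (H 0%N) (H 1%N)) => // y /[!in_itv]/= /andP[y0 _].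
  exact: dH.
exact: bH.
Qed.

(** Along the squared norm the argument of the test function never leaves the
    half-line, so derivatives there are all that is used. *)
Lemma smooth_tame m j : (j + m <= 6)%N ->
  smooth m (fun (H : {H : nat -> R -> R | tame H}) (v : 'rV[R]_k) =>
              sval H j (sqnorm v)).
Proof.
have gr l : (l <= 6)%N -> uniform_growth
    (fun (H : {H : nat -> R -> R | tame H}) (v : 'rV[R]_k) =>
       sval H l (sqnorm v)).
  case: l => [_|l l6].
    have [C [q [C0 q0 sC]]] := smooth_growth (@smooth_sqnorm R k 0 unit).
    exists C, q; split => // -[H tH] v /=.
    apply: le_trans (tame_derive0_bound tH (sqnorm_ge0 v)) _.
    by apply: le_trans (sC tt v); rewrite ler_norm.
  exists 1, 0; split => // -[H [_ _ bH]] v /=.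
  by rewrite /expw mul0r expR0 mulr1 bH// sqnorm_ge0.
elim: m j => [|m IH] j; rewrite ?addn0.
  by move=> j6; split => //; exact: gr.
rewrite addnS => jm; split; first by apply: gr; lia.
exists (fun l (H : {H : nat -> R -> R | tame H}) (v : 'rV[R]_k) =>
    2 * v 0 l * sval H j.+1 (sqnorm v)) => [l|[H tH] v a t] /=.
  apply: smoothM; last by apply: IH; lia.
  by apply: smoothZ; exact: smooth_coord.
have [_ dH _] := tH.
rewrite (eq_bigr (fun l => H j.+1 (sqnorm (v + t *: a)) *
    (a 0 l * (2 * (v + t *: a) 0 l)))); last by move=> l _; ring.
rewrite -mulr_sumr; apply: is_derive1_comp; last exact: is_derive_sqnorm.
by apply: dH; [lia|exact: sqnorm_ge0].
Qed.

End SmoothTame.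

(** * Difference operators with vanishing moments *)

Lemma is_derive_big {R : realType} (L : finType) (f : L -> R -> R) (df : L -> R)
    (t : R) :
  (forall l, is_derive t 1 (f l) (df l)) ->
  is_derive t 1 (fun s => \sum_l f l s) (\sum_l df l).
Proof.
move=> fdf; elim: (index_enum L) => [|l s IH].
  rewrite big_nil (_ : (fun _ => _) = cst 0) ?is_derive_cst//.
    exact: is_derive_cst.
  by apply/funext => s; rewrite big_nil.
rewrite big_cons (_ : (fun _ => _) = f l + (fun x => \sum_(l <- s) f l x)).
  exact: (is_deriveD (fdf l) IH).
by apply/funext => x; rewrite big_cons.
Qed.

Lemma is_derive_scale {R : realType} (x : R) (f : R -> R) (df t : R) :
  is_derive t 1 f df -> is_derive t 1 (fun s => x * f s) (x * df).
Proof. exact: (@is_deriveZ R R R f x t 1 df). Qed.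

Section DeriveLambda.
Context {R : realType}.
Implicit Types (f g : R -> R) (t df dg : R).

Lemma is_derive_add f g t df dg :
  is_derive t 1 f df -> is_derive t 1 g dg ->
  is_derive t 1 (fun s => f s + g s) (df + dg).
Proof. exact: (@is_deriveD R R R f g t 1 df dg). Qed.

Lemma is_derive_sub f g t df dg :
  is_derive t 1 f df -> is_derive t 1 g dg ->
  is_derive t 1 (fun s => f s - g s) (df - dg).
Proof. exact: (@is_deriveB R R R f g t 1 df dg). Qed.

Lemma is_derive_mul f g t df dg :
  is_derive t 1 f df -> is_derive t 1 g dg ->
  is_derive t 1 (fun s => f s * g s) (f t * dg + g t * df).
Proof. exact: (@is_deriveM R R f g t 1 df dg). Qed.

Lemma is_derive_sqr t : is_derive t 1 (fun s : R => s ^+ 2) (2 * t).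
Proof.
have := is_derive_mul (is_derive_id t 1) (is_derive_id t 1).
by rewrite !mulr1 mulr_natl.
Qed.

Lemma is_derive_cube t : is_derive t 1 (fun s : R => s ^+ 3) (3 * t ^+ 2).
Proof.
have -> : (fun s : R => s ^+ 3) = (fun s => s * s ^+ 2).
  by apply/funext => s; rewrite exprS.
by apply: (is_derive_eq (is_derive_mul (is_derive_id t 1) (is_derive_sqr t))); ring.
Qed.

End DeriveLambda.

Section Expansion.
Context {R : realType} {k : nat}.
Local Notation V := 'rV[R]_k.
Implicit Types (v a : V) (e t : R).

Lemma gradient_scaled I (F : I -> V -> R) G i v a e t : gradient F G ->
  is_derive t 1 (fun s => F i (v + (s * e) *: a))
    (e * \sum_j a 0 j * G j i (v + (t * e) *: a)).
Proof.
move=> dG.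
have sc (s : R) : (s * e) *: a = s *: (e *: a) by rewrite scalerA.
rewrite (_ : (fun s => _) = (fun s => F i (v + s *: (e *: a)))); last first.
  by apply/funext => s; rewrite sc.
apply: (is_derive_eq (dG i v (e *: a) t)).
rewrite mulr_sumr; apply: eq_bigr => j _.
by rewrite !mxE sc mulrA.
Qed.

(** Moments of order [m'.+1] of [c] are moments of order [m'] of the weights
    [c l * b l 0 j]; this is the form in which differentiation produces them. *)
Fixpoint moments_vanish (m : nat) (L : finType) (c : L -> R) (b : L -> V) :
    Prop :=
  if m is m'.+1 then
    \sum_l c l = 0 /\ forall j, moments_vanish m' (fun l => c l * b l 0 j) b
  else True.

(** Taylor's formula without coefficients: differentiating in the step [e]
    replaces [c] by the weights [c l * b l 0 j] and so uses up one vanishing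
    moment, while the value at [e = 0] is killed by the total mass. *)
Lemma convolve_moments_vanish m (L : finType) (c : L -> R) (b : L -> V) I
    (F : I -> V -> R) :
  moments_vanish m c b -> smooth m F ->
  exists C q : R, [/\ 0 <= C, 0 <= q & forall i e v, 0 <= e <= 1 ->
    `|convolve c b e (F i) v| <= C * e ^+ m * expw q v].
Proof.
elim: m c F => [|m IH] c F /=.
  move=> _ [[C [q [C0 q0 FC]]] _].
  exists (\sum_l `|c l| * (C * expw q (b l))), q; split => //.
    by apply: sumr_ge0 => l _; rewrite !mulr_ge0 ?expw_ge0.
  move=> i e v e01; rewrite expr0 mulr1 /convolve mulr_suml.
  apply: le_trans (ler_norm_sum _ _ _) _; apply: ler_sum => l _.
  rewrite normrM -!mulrA ler_wpM2l//; apply: le_trans (FC _ _) _.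
  rewrite ler_wpM2l//; apply: le_trans (expwD _ _ q0) _.
  by rewrite mulrC ler_wpM2r ?expw_ge0 ?expwZ.
move=> [c0 cb] [_ [G sG dG]].
have /choice[Cq CqP] : forall j, exists Cq : R * R, [/\ 0 <= Cq.1, 0 <= Cq.2 &
    forall i e v, 0 <= e <= 1 ->
    `|convolve (fun l => c l * b l 0 j) b e (G j i) v|
      <= Cq.1 * e ^+ m * expw Cq.2 v].
  by move=> j; have [C [q [? ? ?]]] := IH _ _ (cb j) (sG j); exists (C, q).
have C0 j : 0 <= (Cq j).1 by case: (CqP j).
have q0 j : 0 <= (Cq j).2 by case: (CqP j).
exists (\sum_j (Cq j).1), (\sum_j (Cq j).2); split; try exact: sumr_ge0.
move=> i e v /andP[e0 e1].
pose phi t := convolve c b (t * e) (F i) v.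
pose dphi t := e * \sum_j convolve (fun l => c l * b l 0 j) b (t * e) (G j i) v.
have dp t : is_derive t 1 phi (dphi t).
  have -> : dphi t = \sum_l c l * (e * \sum_j b l 0 j * G j i (v + (t * e) *: b l)).
    rewrite /dphi exchange_big/= mulr_sumr; apply: eq_bigr => l _.
    rewrite mulrCA; congr (_ * _); rewrite mulr_sumr.
    by apply: eq_bigr => j _; rewrite mulrA.
  apply: is_derive_big => l; apply: is_derive_scale.
  exact: gradient_scaled.
have phi0 : phi 0 = 0.
  rewrite /phi /convolve mul0r.
  under eq_bigr do rewrite scale0r addr0.
  by rewrite -mulr_suml c0 mul0r.
have -> : convolve c b e (F i) v = phi 1 - phi 0 by rewrite phi0 subr0 /phi mul1r.
rewrite -[leRHS]mulr1 -[X in _ <= _ * X]subr0.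
apply: (@mvt_bound _ phi dphi) => // t /[!in_itv]/= /andP[t0 t1].
rewrite /dphi normrM ger0_norm// exprS mulrCA -!mulrA ler_wpM2l//.
apply: le_trans (ler_norm_sum _ _ _) _.
rewrite mulr_suml; apply: ler_sum => j _.
have te : 0 <= t * e <= 1 by rewrite mulr_ge0//= mulr_ile1.
have [_ _ /(_ i _ v te)] := CqP j => /le_trans; apply.
rewrite -mulrA ler_wpM2l// ler_pM ?expw_ge0 ?exprn_ge0//; first by case/andP: te.
  by rewrite lerXn2r ?nnegrE ?mulr_ge0// ler_piMl.
apply: expw_le; rewrite (bigD1 j)//= lerDl sumr_ge0//.
Qed.

Definition unit_step := {e : R | 0 < e <= 1}.

(** Divided by [e ^+ m], the difference operator maps smooth families to
    smooth families, the step becoming part of the index; this is what lets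
    differences be iterated. *)
Lemma smooth_convolve m n (L : finType) (c : L -> R) (b : L -> V) I
    (F : I -> V -> R) :
  moments_vanish m c b -> smooth (m + n) F ->
  smooth n (fun (ie : I * unit_step) v =>
              (sval ie.2) ^- m * convolve c b (sval ie.2) (F ie.1) v).
Proof.
move=> cb; have gr J (F' : J -> V -> R) : smooth m F' ->
    uniform_growth (fun (ie : J * unit_step) v =>
      (sval ie.2) ^- m * convolve c b (sval ie.2) (F' ie.1) v).
  move=> /(convolve_moments_vanish cb)[C [q [C0 q0 FC]]].
  exists C, q; split => // -[i [e /= /andP[e0 e1]]] v /=.
  rewrite normrM ger0_norm ?invr_ge0 ?exprn_ge0 ?(ltW e0)//.
  by rewrite ler_pdivrMl ?exprn_gt0// mulrCA mulrA FC// ltW.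
elim: n F => [|n IH] F; first by rewrite addn0 => sF; split => //; exact: gr.
move=> sF; split; first by apply: gr; apply: smoothW sF; lia.
move: sF; rewrite addnS => -[_ [G sG dG]].
exists (fun j (ie : I * unit_step) v =>
    (sval ie.2) ^- m * convolve c b (sval ie.2) (G j ie.1) v) => [j|];
      first exact: IH (sG j).
move=> [i [e e01]] v a t /=.
under eq_bigr do rewrite mulrCA.
rewrite -mulr_sumr; apply: is_derive_scale.
have -> : \sum_j a 0 j * convolve c b e (G j i) (v + t *: a) =
    \sum_l c l * \sum_j a 0 j * G j i (v + e *: b l + t *: a).
  under eq_bigr do rewrite mulr_sumr.
  rewrite exchange_big/=; apply: eq_bigr => l _.
  rewrite mulr_sumr; apply: eq_bigr => j _.
  by rewrite mulrCA addrAC.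
apply: is_derive_big => l; apply: is_derive_scale.
rewrite (_ : (fun s => _) = (fun s => F i (v + e *: b l + s *: a))).
  exact: dG.
by apply/funext => s; rewrite addrAC.
Qed.

Definition of_order (m : nat) I (G : I -> R -> V -> R) : Prop :=
  exists C q : R, [/\ 0 <= C, 0 <= q & forall i e v, 0 < e <= 1 ->
    `|G i e v| <= C * e ^+ m * expw q v].

Lemma of_order_convolve m (L : finType) (c : L -> R) (b : L -> V) I
    (F : I -> V -> R) :
  moments_vanish m c b -> smooth m F ->
  of_order m (fun i e => convolve c b e (F i)).
Proof.
move=> cb sF; have [C [q [C0 q0 FC]]] := convolve_moments_vanish cb sF.
by exists C, q; split => // i e v /andP[e0 e1]; rewrite FC// ltW.
Qed.

Lemma of_order_convolve2 m n (L L' : finType) (c : L -> R) (b : L -> V)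
    (c' : L' -> R) (b' : L' -> V) I (F : I -> V -> R) :
  moments_vanish m c b -> moments_vanish n c' b' -> smooth (m + n) F ->
  of_order (m + n) (fun i e => convolve c' b' e (convolve c b e (F i))).
Proof.
move=> cb cb' sF.
have [C [q [C0 q0 FC]]] := convolve_moments_vanish cb' (smooth_convolve cb sF).
exists C, q; split => // i e v e01; have /andP[e0 e1] := e01.
have := FC (i, exist _ e e01) e v; rewrite (ltW e0) e1 => /(_ isT).
rewrite /= convolveZ normrM ger0_norm ?invr_ge0 ?exprn_ge0 ?(ltW e0)//.
rewrite ler_pdivrMl ?exprn_gt0// => /le_trans; apply.
by rewrite le_eqVlt; apply/orP; left; apply/eqP; rewrite exprD; ring.
Qed.

Lemma of_orderD m I (F G : I -> R -> V -> R) : of_order m F -> of_order m G ->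
  of_order m (fun i e v => F i e v + G i e v).
Proof.
move=> [C [q [C0 q0 FC]]] [D [p [D0 p0 GD]]].
exists (C + D), (q + p); split; rewrite ?addr_ge0// => i e v e01.
have /andP[e0 _] := e01.
rewrite !mulrDl (le_trans (ler_normD _ _))// lerD//.
  rewrite (le_trans (FC _ _ _ e01))// ler_wpM2l ?expw_le ?lerDl//.
  by rewrite mulr_ge0// exprn_ge0// ltW.
rewrite (le_trans (GD _ _ _ e01))// ler_wpM2l ?expw_le ?lerDr//.
by rewrite mulr_ge0// exprn_ge0// ltW.
Qed.

Lemma of_orderN m I (F : I -> R -> V -> R) : of_order m F ->
  of_order m (fun i e v => - F i e v).
Proof. by move=> [C [q [C0 q0 FC]]]; exists C, q; split => // *; rewrite normrN FC. Qed.

Lemma of_order0 m I : of_order m (fun (_ : I) _ _ => 0).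
Proof. by exists 0, 0; split => // i e v _; rewrite normr0 !mul0r. Qed.

Lemma of_order_sum m I (J : Type) (s : seq J) (F : J -> I -> R -> V -> R) :
  (forall j, of_order m (F j)) ->
  of_order m (fun i e v => \sum_(j <- s) F j i e v).
Proof.
move=> oF; elim: s => [|j s [C [q [C0 q0 FC]]]].
  by have [C [q [? ? ?]]] := of_order0 m I; exists C, q; split => // *;
    rewrite big_nil; auto.
have [D [p [D0 p0 GD]]] := of_orderD (oF j) (ex_intro _ C (ex_intro _ q (And3
  C0 q0 FC))).
by exists D, p; split => // *; rewrite big_cons; auto.
Qed.

Lemma of_order_averaged m (L : finType) (c : L -> R) (b : L -> V) I
    (F : I -> R -> V -> R) :
  of_order m F -> of_order m (fun i e => convolve c b e (F i e)).
Proof.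
move=> [C [q [C0 q0 FC]]].
exists (\sum_l `|c l| * (C * expw q (b l))), q; split => //.
  by apply: sumr_ge0 => l _; rewrite !mulr_ge0 ?expw_ge0.
move=> i e v e01; have /andP[e0 e1] := e01.
rewrite /convolve !mulr_suml.
apply: le_trans (ler_norm_sum _ _ _) _; apply: ler_sum => l _.
rewrite normrM -!mulrA ler_wpM2l//; apply: le_trans (FC _ _ _ e01) _.
rewrite -mulrA ler_wpM2l// mulrCA ler_wpM2l ?exprn_ge0 ?(ltW e0)//.
apply: le_trans (expwD _ _ q0) _.
by rewrite mulrC ler_wpM2r ?expw_ge0 ?expwZ// (ltW e0).
Qed.

End Expansion.

(** * Centered laws and their symmetrization *)

Section ExpBound.
Context {R : realType}.

Lemma expR_taylor1 (x : R) : expR x <= 1 + x + x ^+ 2 * expR `|x|.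
Proof.
have d1 (t : R) : is_derive t 1 (fun s => expR (s * x)) (x * expR (t * x)).
  rewrite mulrC; apply: is_derive1_comp.
  by have := is_derive_affine 0 x t; under eq_fun do rewrite add0r.
have b1 (t : R) : t \in `[0, 1] -> `|x * expR (t * x)| <= `|x| * expR `|x|.
  rewrite in_itv/= => /andP[t0 t1].
  rewrite normrM ler_wpM2l// ger0_norm ?expR_ge0// ler_expR.
  by rewrite (le_trans (ler_norm _))// normrM ger0_norm// ler_piMl.
pose f s := expR (s * x) - s * x.
have d2 (t : R) : is_derive t 1 f (x * expR (t * x) - x).
  apply: is_deriveB => //.
  by have := is_derive_affine 0 x t; under eq_fun do rewrite add0r.
have -> : expR x = f 1 - f 0 + 1 + x by rewrite /f !mul1r !mul0r expR0; ring.
suff : f 1 - f 0 <= x ^+ 2 * expR `|x| by lra.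
apply: le_trans (ler_norm _) _.
rewrite -[leRHS]mulr1 -[X in _ <= _ * X]subr0.
apply: (@mvt_bound _ f (fun t => x * expR (t * x) - x)) => // t.
rewrite in_itv/= => /andP[t0 t1].
rewrite -[X in _ - X]mulr1 -mulrBr normrM -real_normK ?num_real// expr2 -mulrA.
rewrite ler_wpM2l//.
have -> : expR (t * x) - 1 = expR (t * x) - expR (0 * x) by rewrite mul0r expR0.
apply: (@le_trans _ _ (`|x| * expR `|x| * (t - 0))).
  apply: (@mvt_bound _ (fun s => expR (s * x)) (fun s => x * expR (s * x))) => //.
  move=> s /[!in_itv]/= /andP[s0 st]; apply: b1.
  by rewrite in_itv/= s0 (le_trans st).
by rewrite subr0 ler_piMr// mulr_ge0// expR_ge0.
Qed.

End ExpBound.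

Section Laws.
Context {R : realType} {k : nat}.
Local Notation V := 'rV[R]_k.
Implicit Types (v a : V) (e t q B : R).

Definition centered_law (L : finType) (p : L -> R) (b : L -> V) B : Prop :=
  [/\ forall l, 0 <= p l, \sum_l p l = 1,
      forall j, \sum_l p l * b l 0 j = 0 & forall l j, `|b l 0 j| <= B].

(** A centered step of size [e] multiplies exponentials by [1 + O(e ^+ 2)],
    so that [e ^- 2] such steps keep them bounded. *)
Lemma centered_expR (L : finType) (p : L -> R) (b : L -> V) B j e q :
  centered_law p b B -> 0 <= e <= 1 ->
  \sum_l p l * expR (q * (e * b l 0 j))
    <= 1 + q ^+ 2 * B ^+ 2 * expR (`|q| * B) * e ^+ 2.
Proof.
move=> [p0 p1 pb bB] /andP[e0 e1].
have key l : expR (q * (e * b l 0 j)) <=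
    1 + q * e * b l 0 j + q ^+ 2 * B ^+ 2 * expR (`|q| * B) * e ^+ 2.
  apply: le_trans (expR_taylor1 _) _.
  rewrite [q * (e * _)]mulrA lerD2l.
  have -> : (q * e * b l 0 j) ^+ 2 = q ^+ 2 * e ^+ 2 * `|b l 0 j| ^+ 2.
    by rewrite real_normK ?num_real// !exprMn.
  have -> : q ^+ 2 * B ^+ 2 * expR (`|q| * B) * e ^+ 2 =
     q ^+ 2 * e ^+ 2 * B ^+ 2 * expR (`|q| * B) by ring.
  have qe0 : 0 <= q ^+ 2 * e ^+ 2 by apply: mulr_ge0; exact: sqr_ge0.
  apply: ler_pM; rewrite ?expR_ge0//.
  - by apply: mulr_ge0 => //; exact: exprn_ge0.
  - rewrite ler_wpM2l// lerXn2r ?nnegrE//.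
    by rewrite (le_trans _ (bB l j)).
  rewrite ler_expR !normrM -mulrA ler_wpM2l// [`|e|]ger0_norm//.
  by apply: le_trans (bB l j); rewrite ler_piMl.
apply: le_trans (ler_sum _ (fun l _ => ler_wpM2l (p0 l) (key l))) _.
under eq_bigr do rewrite !mulrDr mulr1.
rewrite !big_split/= p1 -mulr_suml p1 mul1r.
under eq_bigr do rewrite mulrCA.
by rewrite -mulr_sumr pb mulr0 addr0.
Qed.

Definition growth_rate q B : R := q ^+ 2 * B ^+ 2 * expR (`|q| * B).

Lemma growth_rate_ge0 q B : 0 <= growth_rate q B.
Proof. by apply: mulr_ge0; rewrite ?expR_ge0// -exprMn sqr_ge0. Qed.

Lemma convolve_expsum (L : finType) (p : L -> R) (b : L -> V) B e q v :
  centered_law p b B -> 0 <= e <= 1 ->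
  convolve p b e (expsum q) v <= expR (growth_rate q B * e ^+ 2) * expsum q v.
Proof.
move=> pb e01; have [p0 p1 _ _] := pb.
apply: (@le_trans _ _ ((1 + growth_rate q B * e ^+ 2) * expsum q v)); last first.
  by rewrite ler_wpM2r ?expsum_ge0 ?expR_ge1Dx.
have g0 : 0 <= growth_rate q B * e ^+ 2.
  by apply: mulr_ge0; rewrite ?growth_rate_ge0 ?sqr_ge0.
rewrite /convolve /expsum; under eq_bigr do rewrite mulrDr mulr1.
rewrite big_split/= p1 mulrDr mulr1 lerD ?lerDl//.
under eq_bigr do rewrite mulr_sumr.
rewrite exchange_big/= mulr_sumr; apply: ler_sum => j _.
have h q' : \sum_l p l * expR (q' * (v + e *: b l) 0 j) =
    (\sum_l p l * expR (q' * (e * b l 0 j))) * expR (q' * v 0 j).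
  rewrite mulr_suml; apply: eq_bigr => l _.
  by rewrite !mxE mulrDr expRD -mulrA [X in _ * X]mulrC.
under eq_bigr do rewrite mulrDr.
rewrite big_split/= (h q) (h (- q)) mulrDr lerD// ler_wpM2r ?expR_ge0//.
  exact: centered_expR.
have := centered_expR j (- q) pb e01.
by rewrite sqrrN normrN.
Qed.

Lemma norm_convolve_expsum (L : finType) (p : L -> R) (b : L -> V) B e q
    (f : V -> R) (C : R) : centered_law p b B -> 0 <= e <= 1 -> 0 <= C ->
  (forall v, `|f v| <= C * expsum q v) ->
  forall v, `|convolve p b e f v|
            <= C * expR (growth_rate q B * e ^+ 2) * expsum q v.
Proof.
move=> pb e01 C0 fC v; have [p0 _ _ _] := pb.
apply: le_trans (norm_convolve_le _ _ _ p0 fC) _.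
by rewrite convolveZ -mulrA ler_wpM2l// (convolve_expsum _ _ pb e01).
Qed.

(** The law [c] of a jump is the sum of its even part, of weights [symw], and
    of its odd part, of weights [antiw], both carried by the jumps and their
    opposites, [symb]. *)
Definition symw (L : finType) (c : L -> R) (ls : L * bool) : R := 2^-1 * c ls.1.
Definition antiw (L : finType) (c : L -> R) (ls : L * bool) : R :=
  (if ls.2 then 1 else -1) * (2^-1 * c ls.1).
Definition symb (L : finType) (b : L -> V) (ls : L * bool) : V :=
  if ls.2 then b ls.1 else - b ls.1.
Definition oppb (L : finType) (b : L -> V) (l : L) : V := - b l.

Lemma big_sign (L : finType) (F : L * bool -> R) :
  \sum_ls F ls = \sum_l (F (l, true) + F (l, false)).
Proof.
transitivity (\sum_l \sum_s F (l, s)); last first.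
  by apply: eq_bigr => l _; rewrite big_bool.
by rewrite pair_bigA /=; apply: eq_bigr => -[].
Qed.

Lemma convolve_sym (L : finType) (c : L -> R) (b : L -> V) e f v :
  convolve (symw c) (symb b) e f v
  = 2^-1 * (convolve c b e f v + convolve c (oppb b) e f v).
Proof.
rewrite /convolve big_sign -big_split mulr_sumr; apply: eq_bigr => l _.
by rewrite /symw /symb /oppb/= -!mulrA -mulrDr.
Qed.

Lemma convolve_anti (L : finType) (c : L -> R) (b : L -> V) e f v :
  convolve (antiw c) (symb b) e f v
  = 2^-1 * (convolve c b e f v - convolve c (oppb b) e f v).
Proof.
rewrite /convolve big_sign -sumrB mulr_sumr; apply: eq_bigr => l _.
by rewrite /antiw /symb /oppb/=; ring.
Qed.

Lemma centered_opp (L : finType) (p : L -> R) (b : L -> V) B :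
  centered_law p b B -> centered_law p (oppb b) B.
Proof.
move=> [p0 p1 pb bB]; split => // [j|l j].
  by under eq_bigr do rewrite mxE mulrN; rewrite sumrN pb oppr0.
by rewrite mxE normrN.
Qed.

Lemma centered_sym (L : finType) (p : L -> R) (b : L -> V) B :
  (forall l, 0 <= p l) -> \sum_l p l = 1 -> (forall l j, `|b l 0 j| <= B) ->
  centered_law (symw p) (symb b) B.
Proof.
move=> p0 p1 bB; split.
- by move=> l; rewrite mulr_ge0// invr_ge0.
- rewrite big_sign; under eq_bigr do rewrite /symw/= -mulrDl -[2^-1]mul1r -splitr mul1r.
  exact: p1.
- move=> j; rewrite big_sign big1// => l _.
  by rewrite /symw /symb/= mxE mulrN subrr.
- by move=> [l []] j; rewrite /symb/= ?mxE ?normrN.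
Qed.

(** The odd moments cancel between a jump and its opposite: the first and the
    third vanish for free. *)
Lemma moments_sym (L : finType) (c : L -> R) (b : L -> V) :
  \sum_l c l = 0 -> (forall i j, \sum_l c l * b l 0 i * b l 0 j = 0) ->
  moments_vanish 4 (symw c) (symb b).
Proof.
move=> c0 cb.
split; first by rewrite big_sign /symw/= big_split/= -mulr_sumr c0 !mulr0 addr0.
move=> i; split; first by rewrite big_sign big1// => l _;
  rewrite /symw /symb/= mxE mulrN subrr.
move=> j; split.
  rewrite big_sign -[RHS](cb i j); apply: eq_bigr => l _.
  by rewrite /symw /symb/= !mxE; field.
move=> h; split => //.
by rewrite big_sign big1// => l _; rewrite /symw /symb/= !mxE; ring.
Qed.

Lemma moments_sym2 (L : finType) (c : L -> R) (b : L -> V) :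
  \sum_l c l = 0 -> moments_vanish 2 (symw c) (symb b).
Proof.
move=> c0.
split; first by rewrite big_sign /symw/= big_split/= -mulr_sumr c0 !mulr0 addr0.
move=> i; split => //.
by rewrite big_sign big1// => l _; rewrite /symw /symb/= mxE mulrN subrr.
Qed.

(** The even moments cancel between a jump and its opposite: a centered law
    and its mirror image agree up to the second order. *)
Lemma moments_anti (L : finType) (c : L -> R) (b : L -> V) :
  (forall j, \sum_l c l * b l 0 j = 0) ->
  moments_vanish 3 (antiw c) (symb b).
Proof.
move=> cb.
split; first by rewrite big_sign big1// => l _; rewrite /antiw/=; ring.
move=> i; split.
  rewrite big_sign -[RHS](cb i); apply: eq_bigr => l _.
  by rewrite /antiw /symb/= !mxE; field.
move=> j; split => //.
by rewrite big_sign big1// => l _; rewrite /antiw /symb/= !mxE; ring.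
Qed.

End Laws.

(** * A walk and its mirror image *)

Section Step.
Context {R : realType}.

Definition step (n : nat) : R := (Num.sqrt n%:R)^-1.

Lemma step_gt0 n : (0 < n)%N -> 0 < step n.
Proof. by move=> n0; rewrite invr_gt0 sqrtr_gt0 ltr0n. Qed.

Lemma sqr_step n : step n ^+ 2 = n%:R^-1.
Proof. by rewrite /step exprVn sqr_sqrtr. Qed.

Lemma step_le1 n : (0 < n)%N -> step n <= 1.
Proof.
move=> n0; rewrite invf_le1 ?sqrtr_gt0 ?ltr0n//.
by rewrite -[leLHS]sqrtr1 ler_sqrt// ?ler1n// ltr0n.
Qed.

Lemma step_in n : (0 < n)%N -> 0 < step n <= 1.
Proof. by move=> n0; rewrite step_gt0 ?step_le1. Qed.

Lemma step_ge0_in n : (0 < n)%N -> 0 <= step n <= 1.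
Proof. by move=> n0; rewrite (ltW (step_gt0 n0)) step_le1. Qed.

Lemma mul_sqr_step n : (0 < n)%N -> n%:R * step n ^+ 2 = 1.
Proof. by move=> n0; rewrite sqr_step divff// pnatr_eq0 -lt0n. Qed.

End Step.

Section Walks.
Context {R : realType} {k : nat}.
Local Notation V := 'rV[R]_k.
Implicit Types (v a : V) (e t q B : R) (f : V -> R).

Lemma iter_growth_law (L : finType) (p : L -> R) (b : L -> V) B e q f (C : R) n :
  centered_law p b B -> 0 <= e <= 1 -> 0 <= C ->
  (forall v, `|f v| <= C * expsum q v) ->
  forall v, `|iter n (convolve p b e) f v|
            <= C * expR (growth_rate q B * e ^+ 2) ^+ n * expsum q v.
Proof.
move=> pb e01 C0 fC.
apply: (@iter_growth R V (expsum q) (expR (growth_rate q B * e ^+ 2))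
  (convolve p b e) (fun=> True)) => //.
- by rewrite -expR0 ler_expR mulr_ge0 ?growth_rate_ge0 ?sqr_ge0.
- by move=> g D _; exact: norm_convolve_expsum.
Qed.

Section TwoLaws.
Variables (L L' : finType) (p : L -> R) (b : L -> V) (p' : L' -> R) (b' : L' -> V).
Variable B : R.
Hypotheses (pb : centered_law p b B) (pb' : centered_law p' b' B).

Lemma telescoping_laws e q f (d : R) n : 0 <= e <= 1 -> 0 <= d ->
  (forall v, `|convolve p b e f v - convolve p' b' e f v| <= d * expsum q v) ->
  forall v, `|iter n (convolve p b e) f v - iter n (convolve p' b' e) f v|
    <= n%:R * d * expR (growth_rate q B * e ^+ 2) ^+ n * expsum q v.
Proof.
move=> e01 d0 fd.
apply: (@telescoping R V (expsum q) (expR (growth_rate q B * e ^+ 2))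
  (convolve p b e) (convolve p' b' e) (fun=> True)) => //.
- by move=> v; exact: expsum_ge0.
- by rewrite -expR0 ler_expR mulr_ge0 ?growth_rate_ge0 ?sqr_ge0.
- by move=> g h _ _; apply/funext => v; rewrite convolveB.
- by move=> g h _ _; apply/funext => v; rewrite convolveB.
- by move=> g _; apply/funext => v; rewrite convolveC.
- by move=> g D _; exact: norm_convolve_expsum.
- by move=> g D _; exact: norm_convolve_expsum.
Qed.

End TwoLaws.

Section SymmetrizedWalk.
Variables (L : finType) (p : L -> R) (b : L -> V) (B : R).
Hypothesis pb : centered_law p b B.

Local Notation Ap := (convolve p b).
Local Notation Am := (convolve p (oppb b)).
Local Notation Sy := (convolve (symw p) (symb b)).
Local Notation De := (convolve (antiw p) (symb b)).

Let pbS : centered_law (symw p) (symb b) B.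
Proof. by case: pb => *; exact: centered_sym. Qed.

Lemma convolve_split e f v : Ap e f v = Sy e f v + De e f v.
Proof. by rewrite convolve_sym convolve_anti; field. Qed.

Lemma convolve_mirrorB e f v : Ap e f v - Am e f v = 2 * De e f v.
Proof. by rewrite convolve_anti mulrA divff ?mul1r// pnatr_eq0. Qed.

Lemma convolve_oppb e f v : Am e f v = Ap e (fun w => f (- w)) (- v).
Proof.
by apply: eq_bigr => l _; rewrite opprD opprK /oppb scalerN.
Qed.

(** The walk with opposite jumps is the walk seen in a mirror. *)
Lemma iter_oppb e f n v :
  iter n (Am e) f v = iter n (Ap e) (fun w => f (- w)) (- v).
Proof.
elim: n f v => [|n IH] f v; first by rewrite /= opprK.
rewrite !iterSr IH; congr (iter n _ _ _); apply/funext => w.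
by rewrite convolve_oppb opprK.
Qed.

Lemma iterN e f n v : iter n (Ap e) (fun w => - f w) v = - iter n (Ap e) f v.
Proof.
elim: n v => //= n IH v; rewrite [X in Ap e X](_ : _ = fun w => - iter n (Ap e) f w).
  by rewrite /convolve -sumrN; apply: eq_bigr => l _; rewrite mulrN.
by apply/funext => w; rewrite IH.
Qed.

Lemma iterD e f g n v :
  iter n (Ap e) (fun w => f w + g w) v = iter n (Ap e) f v + iter n (Ap e) g v.
Proof.
elim: n v => //= n IH v; rewrite -convolveD; congr (convolve _ _ _ _ _).
by apply/funext => w; rewrite IH.
Qed.

(** For an odd function the walk and its mirror image give opposite values,
    so the cost of exchanging them bounds the value itself. *)
Lemma odd_walk e q f (d : R) n : 0 <= e <= 1 -> 0 <= d ->
  (forall v, f (- v) = - f v) ->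
  (forall v, `|De e f v| <= d * expsum q v) ->
  `|iter n (Ap e) f 0|
    <= n%:R * d * expR (growth_rate q B * e ^+ 2) ^+ n * expsum q (0 : V).
Proof.
move=> e01 d0 fo fd.
have h : `|iter n (Ap e) f 0 - iter n (Am e) f 0| <= n%:R * (2 * d) *
    expR (growth_rate q B * e ^+ 2) ^+ n * expsum q (0 : V).
  apply: (telescoping_laws pb (centered_opp pb)) => //; first by rewrite mulr_ge0.
  by move=> v; rewrite convolve_mirrorB normrM ger0_norm// -mulrA ler_wpM2l.
move: h; rewrite iter_oppb oppr0 (_ : (fun w => f (- w)) = fun w => - f w).
  rewrite iterN opprK -[X in `|X|]mulr2n -[X in `|X|]mulr_natl normrM ger0_norm// => h.
  by rewrite -(ler_pM2l (ltr0Sn R 1)) (le_trans h)// le_eqVlt; apply/orP; left;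
    apply/eqP; ring.
by apply/funext => w; rewrite fo.
Qed.

Lemma even_convolve_sym e f : (forall v, f (- v) = f v) ->
  forall v, Sy e f (- v) = Sy e f v.
Proof.
move=> fe v; rewrite !convolve_sym !convolve_oppb opprK.
have fE : (fun w => f (- w)) = f by apply/funext => w.
by rewrite fE addrC.
Qed.

Lemma odd_convolve_anti e f : (forall v, f (- v) = f v) ->
  forall v, De e f (- v) = - De e f v.
Proof.
move=> fe v; rewrite !convolve_anti !convolve_oppb opprK.
have fE : (fun w => f (- w)) = f by apply/funext => w.
by rewrite fE -mulrN opprB.
Qed.

(** Exchange a step for its even part, starting from the innermost one. The
    odd part of the step maps the even function [f] to an odd function, whose
    expectation is, by [odd_walk], controlled by the odd part applied once
    more. Hence each exchange costs [n] times the size of two odd parts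
    instead of the size of one. *)
Lemma even_walk e q f (d : R) n : 0 <= e <= 1 -> 0 <= d ->
  (forall v, f (- v) = f v) ->
  (forall v, `|De e (De e f) v| <= d * expsum q v) ->
  `|iter n (Ap e) f 0 - iter n (Sy e) f 0|
    <= n%:R ^+ 2 * d * expR (growth_rate q B * e ^+ 2) ^+ n * expsum q (0 : V).
Proof.
move=> e01; set rho := expR _; have rho1 : 1 <= rho.
  by rewrite -expR0 ler_expR mulr_ge0 ?growth_rate_ge0 ?sqr_ge0.
have rho0 : 0 <= rho by exact: le_trans rho1.
elim: n f d => [|n IH] f d d0 fe fd.
  by rewrite subrr normr0 expr0n !mul0r.
rewrite !iterSr.
have -> : iter n (Ap e) (Ap e f) 0 - iter n (Sy e) (Sy e f) 0 =
    iter n (Ap e) (De e f) 0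
    + (iter n (Ap e) (Sy e f) 0 - iter n (Sy e) (Sy e f) 0).
  rewrite (_ : Ap e f = fun w => Sy e f w + De e f w).
    by rewrite iterD; ring.
  by apply/funext => w; rewrite convolve_split.
apply: le_trans (ler_normD _ _) _.
have h1 := odd_walk n e01 d0 (odd_convolve_anti e fe) fd.
have h2 : `|iter n (Ap e) (Sy e f) 0 - iter n (Sy e) (Sy e f) 0|
    <= n%:R ^+ 2 * (d * rho) * rho ^+ n * expsum q (0 : V).
  apply: IH; first by rewrite mulr_ge0.
    exact: even_convolve_sym.
  move=> v.
  have -> : De e (De e (Sy e f)) v = Sy e (De e (De e f)) v.
    rewrite [RHS]convolveC; congr (convolve _ _ _ _ _); apply/funext => w.
    exact: convolveC.
  exact: (norm_convolve_expsum pbS).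
apply: le_trans (lerD h1 h2) _; rewrite -mulrDl ler_wpM2r ?expsum_ge0//.
have y0 : 0 <= d * rho ^+ n by rewrite mulr_ge0// exprn_ge0.
have h3 : d * rho ^+ n <= d * rho ^+ n * rho by exact: ler_peMr.
have h4 : n%:R * (d * rho ^+ n) <= n%:R * (d * rho ^+ n * rho) :> R.
  by rewrite ler_wpM2l.
have h5 : 0 <= n%:R * (d * rho ^+ n * rho) :> R by rewrite mulr_ge0// mulr_ge0.
have h6 : 0 <= d * rho ^+ n * rho by rewrite mulr_ge0.
rewrite (exprSr rho) -natr1; move: h3 h4 h5 h6 => {IH h1 h2 fd}.
by move: (rho ^+ n) (n%:R : R) => X N; lra.
Qed.

End SymmetrizedWalk.

(** * Coin tosses along the axes *)

Section Rademacher.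

Lemma sum_unit (F : unit -> R) : \sum_u F u = F tt.
Proof. by rewrite (bigD1 tt)//= big1 ?addr0// => -[]. Qed.

Definition axis_weight (_ : unit) : R := 1.
Definition axis_jump (j : 'I_k) (_ : unit) : V := delta_mx 0 j.

Definition axis_step (j : 'I_k) (e : R) (f : V -> R) (v : V) : R :=
  2^-1 * (f (v + e *: delta_mx 0 j) + f (v - e *: delta_mx 0 j)).

Lemma axis_stepE j e f v : axis_step j e f v =
  convolve (symw axis_weight) (symb (axis_jump j)) e f v.
Proof.
by rewrite convolve_sym /convolve !sum_unit !mul1r /oppb /axis_jump scalerN.
Qed.

Lemma axis_step_convolve j e : axis_step j e =
  convolve (symw axis_weight) (symb (axis_jump j)) e.
Proof. by apply/funext => f; apply/funext => v; exact: axis_stepE. Qed.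

Lemma centered_axis j :
  centered_law (symw axis_weight) (symb (axis_jump j)) 1.
Proof.
apply: centered_sym => //; first by rewrite sum_unit.
by move=> l i; rewrite mxE eqxx/=; case: eqP => _; rewrite ?normr1 ?normr0.
Qed.

Lemma axis_stepB j e f g v :
  axis_step j e (fun w => f w - g w) v = axis_step j e f v - axis_step j e g v.
Proof. by rewrite /axis_step; ring. Qed.

Lemma axis_step_sum j e (J : Type) (s : seq J) (G : J -> V -> R) v :
  axis_step j e (fun w => \sum_(l <- s) G l w) v
  = \sum_(l <- s) axis_step j e (G l) v.
Proof. by rewrite /axis_step -mulr_sumr big_split. Qed.

Definition axis_diff (j : 'I_k) (e : R) (f : V -> R) (v : V) : R :=
  axis_step j e f v - f v.

(* The mass at the origin is subtracted from a jump along the axis;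
   symmetrizing gives the difference operator of a coin toss. *)
Let cE (s : bool) : R := if s then 1 else -1.
Let bE (j : 'I_k) (s : bool) : V := if s then delta_mx 0 j else 0.

Lemma axis_diffE j e f v :
  axis_diff j e f v = convolve (symw cE) (symb (bE j)) e f v.
Proof.
rewrite convolve_sym /convolve !big_bool /cE /bE /oppb /= oppr0 !scaler0 !addr0.
by rewrite /axis_diff /axis_step scalerN; field.
Qed.

Lemma axis_diff_convolve j e :
  axis_diff j e = convolve (symw cE) (symb (bE j)) e.
Proof. by apply/funext => f; apply/funext => v; exact: axis_diffE. Qed.

Lemma moments_axis j : moments_vanish 2 (symw cE) (symb (bE j)).
Proof. by apply: moments_sym2; rewrite big_bool /cE/= subrr. Qed.

Definition axes_step (s : seq 'I_k) (e : R) (f : V -> R) : V -> R :=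
  foldr (fun j => axis_step j e) f s.

(** In the expansion of the product of the steps [1 + axis_diff j e], a term
    with two or more factors is of order 4, since each [axis_diff] is of
    order 2. *)
Lemma axes_step_expansion I (F : I -> V -> R) (s : seq 'I_k) :
  smooth 4 F ->
  of_order 4 (fun i e v => axes_step s e (F i) v - F i v
                           - \sum_(j <- s) axis_diff j e (F i) v).
Proof.
move=> sF; elim: s => [|j s IH].
  have [C [q [? ? h]]] := @of_order0 R k 4 I.
  exists C, q; split => // i e v e01; rewrite big_nil /= subrr subr0.
  exact: h.
have h1 := of_order_averaged (symw axis_weight) (symb (axis_jump j)) IH.
have h2 : of_order 4 (fun i e v =>
    \sum_(l <- s) axis_diff j e (axis_diff l e (F i)) v).
  apply: of_order_sum => l; have [C [q [? ? h]]] :=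
    of_order_convolve2 (moments_axis l) (moments_axis j) (sF : smooth (2 + 2) F).
  by exists C, q; split => // i e v e01; rewrite !axis_diff_convolve h.
have [C [q [? ? h]]] := of_orderD h1 h2.
exists C, q; split => // i e v e01; apply: le_trans (h i e v e01).
rewrite le_eqVlt; apply/orP; left; apply/eqP; congr (`| _ |).
rewrite big_cons /= -axis_step_convolve /axis_diff sumrB.
rewrite axis_stepB axis_stepB axis_step_sum.
by rewrite -/(axes_step s e (F i)) !sumrB; ring.
Qed.

End Rademacher.
End Walks.

(** * Rates for walks with identity covariance *)

Section WalkBounds.
Context {R : realType} {k : nat}.
Local Notation V := 'rV[R]_k.
Implicit Types (v a : V) (e t q B : R) (f : V -> R).

Lemma of_order_expsum m I (G : I -> R -> V -> R) : of_order m G ->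
  exists C q : R, [/\ 0 <= C, 0 <= q & forall i e v, 0 < e <= 1 ->
    `|G i e v| <= C * e ^+ m * expsum q v].
Proof.
move=> [C [q [C0 q0 GC]]]; exists C, (k%:R * q); split => //.
  by rewrite mulr_ge0.
move=> i e v e01; have /andP[e0 _] := e01; apply: le_trans (GC i e v e01) _.
by rewrite ler_wpM2l ?expw_expsum// mulr_ge0// exprn_ge0// ltW.
Qed.

Lemma expR_step (K : R) n : (0 < n)%N -> expR (K * step n ^+ 2) ^+ n = expR K.
Proof.
move=> n0; rewrite -expRM_natl; congr expR.
by rewrite mulrCA (mul_sqr_step n0) mulr1.
Qed.

(** What the exchange argument asks of a step, for [axes_step]. *)
Lemma axes_step_properties (s : seq 'I_k) e :
  [/\ forall f g, axes_step s e (fun w => f w - g w)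
        = fun v => axes_step s e f v - axes_step s e g v,
      forall (L : finType) (p : L -> R) (b : L -> V) f,
        axes_step s e (convolve p b e f) = convolve p b e (axes_step s e f) &
      forall q f (C : R), 0 <= e <= 1 -> 0 <= C ->
        (forall v, `|f v| <= C * expsum q v) ->
        forall v, `|axes_step s e f v|
          <= C * expR (growth_rate q 1 * e ^+ 2) ^+ size s * expsum q v].
Proof.
elim: s => [|j s [IHB IHC IHg]] /=.
  by split => // q f C _ C0 fC v; rewrite expr0 mulr1.
split=> [f g|L p b f|q f C e01 C0 fC v].
- by rewrite IHB; apply/funext => v; rewrite axis_stepB.
- by rewrite IHC axis_step_convolve; apply/funext => v; rewrite convolveC.
rewrite exprSr mulrA axis_step_convolve.
apply: (norm_convolve_expsum (centered_axis j)) => //.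
  by rewrite mulr_ge0// exprn_ge0// expR_ge0.
exact: IHg.
Qed.

Section OneLaw.
Variables (L : finType) (p : L -> R) (b : L -> V) (B : R).
Hypothesis pb : centered_law p b B.
Hypothesis cov : forall i j, \sum_l p l * b l 0 i * b l 0 j = (i == j)%:R.

Let p1 : \sum_l p l = 1. Proof. by case: pb. Qed.
Let bmean j : \sum_l p l * b l 0 j = 0. Proof. by case: pb. Qed.
Let pbS : centered_law (symw p) (symb b) B.
Proof. by case: pb => *; exact: centered_sym. Qed.

(** Exponential moments grow by a factor [1 + O(n^-1)] at each of the [n]
    steps, so they stay bounded. *)
Lemma walk_expw q : 0 <= q -> exists2 C : R, 0 <= C &
  forall n, (0 < n)%N -> iter n (convolve p b (step n)) (expw q) 0 <= C.
Proof.
move=> q0; exists (expR (growth_rate (k%:R * q) B) * expsum (k%:R * q) (0 : V)).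
  by rewrite mulr_ge0 ?expR_ge0 ?expsum_ge0.
move=> n n0; apply: le_trans (ler_norm _) _.
rewrite -[X in X * _]mul1r -(expR_step _ n0).
apply: (iter_growth_law n pb (step_ge0_in n0) ler01) => v.
by rewrite mul1r ger0_norm ?expw_ge0 ?expw_expsum.
Qed.

(** A centered law agrees with its mirror image up to order 2, so the [n]
    exchanges cost [n * step n ^+ 3 = step n]. *)
Lemma walk_odd I (F : I -> V -> R) : smooth 3 F ->
  (forall i v, F i (- v) = - F i v) ->
  exists2 C : R, 0 <= C & forall i n, (0 < n)%N ->
    `|iter n (convolve p b (step n)) (F i) 0| <= C * step n.
Proof.
move=> sF oF.
have [C [q [C0 q0 FC]]] :=
  of_order_expsum (of_order_convolve (moments_anti bmean) sF).
exists (C * expR (growth_rate q B) * expsum q (0 : V)).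
  by rewrite !mulr_ge0 ?expR_ge0 ?expsum_ge0.
move=> i n n0.
have d0 : 0 <= C * step n ^+ 3 by rewrite mulr_ge0// exprn_ge0// ltW// step_gt0.
apply: le_trans (odd_walk pb n (step_ge0_in n0) d0 (oF i) _) _.
  by move=> v; apply: FC; exact: step_in.
rewrite (expR_step _ n0) le_eqVlt; apply/orP; left; apply/eqP.
have -> : n%:R * (C * step n ^+ 3) = C * step n * (n%:R * step n ^+ 2) by ring.
by rewrite mul_sqr_step//; ring.
Qed.

(** Each of the odd parts in [even_walk] is of order 3, and the total cost is
    [n ^ 2 * step n ^+ 6]. *)
Lemma walk_even I (F : I -> V -> R) : smooth 6 F ->
  (forall i v, F i (- v) = F i v) ->
  exists2 C : R, 0 <= C & forall i n, (0 < n)%N ->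
    `|iter n (convolve p b (step n)) (F i) 0
      - iter n (convolve (symw p) (symb b) (step n)) (F i) 0| <= C / n%:R.
Proof.
move=> sF eF; have mv := moments_anti bmean.
have [C [q [C0 q0 FC]]] :=
  of_order_expsum (of_order_convolve2 mv mv (sF : smooth (3 + 3) F)).
exists (C * expR (growth_rate q B) * expsum q (0 : V)).
  by rewrite !mulr_ge0 ?expR_ge0 ?expsum_ge0.
move=> i n n0.
have d0 : 0 <= C * step n ^+ 6 by rewrite mulr_ge0// exprn_ge0// ltW// step_gt0.
apply: le_trans (even_walk pb n (step_ge0_in n0) d0 (eF i) _) _.
  by move=> v; apply: FC; exact: step_in.
rewrite (expR_step _ n0) -sqr_step le_eqVlt; apply/orP; left; apply/eqP.
have -> : n%:R ^+ 2 * (C * step n ^+ 6) =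
  C * step n ^+ 2 * (n%:R * step n ^+ 2) ^+ 2 by ring.
by rewrite mul_sqr_step//; ring.
Qed.

(* The jump law minus a unit mass at each basis vector, with the mass at the
   origin that makes the total zero. *)
Let cD (l : L + ('I_k + unit)) : R :=
  match l with inl l => p l | inr (inl _) => -1 | inr (inr _) => k%:R - 1 end.
Let bD (l : L + ('I_k + unit)) : V :=
  match l with inl l => b l | inr (inl j) => delta_mx 0 j | inr (inr _) => 0 end.

(** The symmetrized jump and the coin tosses along the axes are both
    symmetric and both have the identity covariance, so they agree up to the
    third order. *)
Lemma sym_step_expansion I (F : I -> V -> R) : smooth 4 F ->
  of_order 4 (fun i e v => convolve (symw p) (symb b) e (F i) v - F i v
                           - \sum_j axis_diff j e (F i) v).
Proof.
move=> sF; have mv : moments_vanish 4 (symw cD) (symb bD).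
  apply: moments_sym => [|i j]; rewrite !big_sumType/= sum_unit.
    by rewrite p1 sumr_const card_ord mulNrn; ring.
  rewrite cov mxE mulr0 mul0r addr0 (bigD1 i)//= big1 => [|l li].
    by rewrite !mxE !eqxx/= addr0 mulr1 mulN1r eq_sym subrr.
  by rewrite !mxE eqxx/= [i == l]eq_sym (negbTE li) mulr0 mul0r.
have [C [q [C0 q0 FC]]] := of_order_convolve mv sF.
exists C, q; split => // i e v e01; apply: le_trans (FC i e v e01).
rewrite le_eqVlt; apply/orP; left; apply/eqP; congr (`| _ |).
have cE f : convolve cD bD e f v = convolve p b e f v
    - \sum_j f (v + e *: delta_mx 0 j) + (k%:R - 1) * f v.
  rewrite /convolve !big_sumType/= sum_unit scaler0 addr0 -sumrN addrA.
  by congr (_ + _ + _); apply: eq_bigr => j _; rewrite mulN1r.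
have cEo f : convolve cD (oppb bD) e f v = convolve p (oppb b) e f v
    - \sum_j f (v - e *: delta_mx 0 j) + (k%:R - 1) * f v.
  rewrite /convolve !big_sumType/= sum_unit /oppb/= oppr0 scaler0 addr0 -sumrN.
  rewrite addrA; congr (_ + _ + _); apply: eq_bigr => j _.
  by rewrite mulN1r scalerN.
rewrite !convolve_sym cE cEo /axis_diff sumrB sumr_const card_ord -mulr_natl.
by rewrite /axis_step -mulr_sumr big_split/=; field.
Qed.

(** [n] exchanges of order 4 cost [n * step n ^+ 4]. *)
Lemma walk_axes I (F : I -> V -> R) : smooth 4 F ->
  exists2 C : R, 0 <= C & forall i n, (0 < n)%N ->
    `|iter n (convolve (symw p) (symb b) (step n)) (F i) 0
      - iter n (axes_step (enum 'I_k) (step n)) (F i) 0| <= C / n%:R.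
Proof.
move=> sF.
have [C [q [C0 q0 FC]]] := of_order_expsum (of_orderD (sym_step_expansion sF)
  (of_orderN (axes_step_expansion (enum 'I_k) sF))).
pose K : R := growth_rate q B + k%:R * growth_rate q 1.
exists (C * expR K * expsum q (0 : V)).
  by rewrite !mulr_ge0 ?expR_ge0 ?expsum_ge0.
move=> i n n0; have e01 := @step_ge0_in R n n0.
have [axB axC axg] := axes_step_properties (enum 'I_k) (step n).
have s0 : 0 <= step n ^+ 2 :> R by exact: sqr_ge0.
have d0 : 0 <= C * step n ^+ 4 by rewrite mulr_ge0// exprn_ge0// ltW// step_gt0.
have h : `|iter n (convolve (symw p) (symb b) (step n)) (F i) 0
      - iter n (axes_step (enum 'I_k) (step n)) (F i) 0| <=
    n%:R * (C * step n ^+ 4) * expR (K * step n ^+ 2) ^+ n * expsum q (0 : V).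
  apply: (@telescoping R V (expsum q) (expR (K * step n ^+ 2)) 
    (convolve (symw p) (symb b) (step n)) (axes_step (enum 'I_k) (step n))
    (fun=> True)) => //.
- by move=> v; exact: expsum_ge0.
- by rewrite -expR0 ler_expR mulr_ge0// /K addr_ge0 ?growth_rate_ge0//
    mulr_ge0 ?growth_rate_ge0.
- by move=> f g _ _; apply/funext => v; rewrite convolveB.
- move=> f D _ D0 fD v.
  apply: le_trans (norm_convolve_expsum pbS e01 D0 fD v) _.
  rewrite ler_wpM2r ?expsum_ge0// ler_wpM2l// ler_expR ler_wpM2r//.
  by rewrite lerDl mulr_ge0 ?growth_rate_ge0.
- move=> f D _ D0 fD v.
  apply: le_trans (axg q f D e01 D0 fD v) _.
  rewrite ler_wpM2r ?expsum_ge0// ler_wpM2l// -expRM_natl ler_expR size_enum_ord.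
  by rewrite mulrA ler_wpM2r// lerDr growth_rate_ge0.
- move=> v; apply: le_trans (FC i _ v (step_in n0)).
  rewrite le_eqVlt; apply/orP; left; apply/eqP; congr (`| _ |).
  by rewrite big_enum/=; ring.
move: h; rewrite (expR_step _ n0) => /le_trans; apply.
rewrite -sqr_step le_eqVlt; apply/orP; left; apply/eqP.
have -> : n%:R * (C * step n ^+ 4) = C * step n ^+ 2 * (n%:R * step n ^+ 2) by ring.
by rewrite mul_sqr_step//; ring.
Qed.

End OneLaw.
End WalkBounds.

(** * Integrals against the Gaussian density *)

Section GaussianDensity.
Context {R : realType}.
Local Notation mu := (@lebesgue_measure R).
Local Notation nu := (normal_prob (0 : R) 1).
Local Notation phi := (normal_pdf (0 : R) 1).

Lemma measurable_phi : measurable_fun setT phi.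
Proof. exact: measurable_normal_pdf. Qed.

Import HBNNSimple.

Let integral_nnsfun_density (f : {nnsfun (measurableTypeR R) >-> R}) :
  (\int[nu]_x (f x)%:E = \int[mu]_x ((f x)%:E * (phi x)%:E))%E.
Proof.
under [LHS]eq_integral do rewrite fimfunE -fsumEFin//.
rewrite [LHS]ge0_integral_fsum//; last 2 first.
  - by move=> r; exact/measurable_EFinP/measurableT_comp.
  - by move=> n x _; rewrite EFinM nnfun_muleindic_ge0.
under [RHS]eq_integral.
  move=> x xD; rewrite fimfunE -fsumEFin// ge0_mule_fsuml; last first.
    by move=> r; rewrite EFinM nnfun_muleindic_ge0.
  over.
rewrite [RHS]ge0_integral_fsum//; last 2 first.
  - move=> r; apply: emeasurable_funM.
      by apply/measurable_EFinP/measurableT_comp.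
    by apply/measurable_EFinP; exact: measurable_phi.
  - move=> n x _; apply: mule_ge0; last by rewrite lee_fin normal_pdf_ge0.
    by rewrite EFinM nnfun_muleindic_ge0.
apply: eq_fsbigr => r _.
rewrite integralZl_indic_nnsfun// integral_indic// setIT.
have [r0|r0] := leP 0 r; last first.
  rewrite preimage_nnfun0// measure0 mule0 integral0_eq// => x _.
  by rewrite indic0 mulr0 mul0e.
under eq_integral do rewrite EFinM -muleA.
rewrite ge0_integralZl//; last 2 first.
  - apply: emeasurable_funM; first exact/measurable_EFinP/measurable_indic.
    by apply/measurable_EFinP; exact: measurable_phi.
  - by move=> x _; rewrite -EFinM lee_fin mulr_ge0// normal_pdf_ge0.
congr (_ * _)%E; rewrite /normal_prob [LHS]integral_mkcond.
apply: eq_integral => x _; rewrite patchE indicE.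
by case: ifPn => _; rewrite ?mul1e ?mul0e.
Qed.

(** The density describes the normal law of sets; simple functions and
    monotone convergence carry this over to integrals. *)
Lemma integral_normal_density (f : measurableTypeR R -> \bar R) :
  measurable_fun setT f -> (forall x, 0 <= f x)%E ->
  (\int[nu]_x f x = \int[mu]_x (f x * (phi x)%:E))%E.
Proof.
move=> mf f0.
pose f_ := nnsfun_approx measurableT mf.
transitivity (lim (\int[nu]_x (f_ n x)%:E @[n --> \oo])%E).
  rewrite -monotone_convergence//=.
  - apply: eq_integral => ? /[!inE] xD; apply/esym/cvg_lim => //=.
    exact: cvg_nnsfun_approx.
  - by move=> n; exact/measurable_EFinP/measurable_funTS.
  - by move=> n ? _; rewrite lee_fin.
  - by move=> ? _ ? ? mn; rewrite lee_fin; exact/lefP/nd_nnsfun_approx.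
rewrite [RHS](_ : _ = lim
    (\int[mu]_x ((f_ n x)%:E * (phi x)%:E) @[n --> \oo])%E).
  by apply: congr_lim; apply/funext => n /=; exact: integral_nnsfun_density.
rewrite -monotone_convergence//=.
- apply: eq_integral => ? /[!inE] xD; apply/esym/cvg_lim => //.
  by apply: cvgeZr; [by []|exact: cvg_nnsfun_approx].
- move=> n; apply: emeasurable_funM; first by apply/measurable_EFinP.
  by apply/measurable_EFinP; exact: measurable_phi.
- by move=> n ? _; rewrite mule_ge0// lee_fin// normal_pdf_ge0.
- move=> x _ ? ? ?; rewrite lee_wpmul2r ?lee_fin ?normal_pdf_ge0//.
  exact/lefP/nd_nnsfun_approx.
Qed.

Lemma ge0_integral_affine (G : R -> R) (a b : R) : 0 < a ->
  continuous G -> (forall x, 0 <= G x) ->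
  (\int[mu]_x (G x)%:E = \int[mu]_x (G (a * x + b) * a)%:E)%E.
Proof.
move=> a0 cG G0; pose F (x : R) : R := a * x + b.
have dF (x : R) : is_derive x 1 F a.
  apply: (is_derive_eq (is_deriveD (is_deriveZ a (is_derive_id x 1))
    (is_derive_cst b x 1))).
  by rewrite addr0 [_ *: _]mulr1.
have F'E : F^`()%classic = cst a.
  by apply/funext => x; rewrite derive1E; apply: derive_val.
rewrite (@increasing_ge0_integration_by_substitutionT _ F G)//.
- by apply: eq_integral => x _; rewrite F'E.
- by move=> x y xy; rewrite /F ltrD2r ltr_pM2l.
- by rewrite F'E => x; exact: cvg_cst.
- by rewrite F'E; exact: is_cvg_cst.
- by rewrite F'E; exact: is_cvg_cst.
- rewrite /F; apply: (cvg_comp (fun x : R => a * x) (fun x => x + b)).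
    exact: gt0_cvgMrNy a0 cvg_id.
  exact: cvg_addrr_Ny.
- rewrite /F; apply: (cvg_comp (fun x : R => a * x) (fun x => x + b)).
    exact: gt0_cvgMry a0 cvg_id.
  exact: cvg_addrr.
Qed.

End GaussianDensity.

(** * Gaussian expectation of functions of exponential growth *)

Section GaussianExpectation.
Context {R : realType}.
Local Notation mR := (measurableTypeR R).
Local Notation mu := (@lebesgue_measure R).
Local Notation nu := (normal_prob (0 : R) 1).
Local Notation phi := (normal_pdf (0 : R) 1).
Implicit Types (f g : mR -> R) (x q s t : R).

Lemma phiE x : phi x = normal_peak 1 * expR (- x ^+ 2 / 2).
Proof.
rewrite normal_pdfE ?oner_eq0// /normal_fun subr0 expr1n mulr2n.
by congr (_ * expR (_ / _)).
Qed.

Lemma ge0_integral_normal_opp (f : mR -> \bar R) :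
  measurable_fun setT f -> (forall x, 0 <= f x)%E ->
  (\int[nu]_x f (- x)%R = \int[nu]_x f x)%E.
Proof.
move=> mf f0.
have mopp : measurable_fun [set: mR] (-%R : mR -> mR) by exact: oppr_measurable.
rewrite !integral_normal_density//; last exact: measurableT_comp.
pose g x := (f x * (phi x)%:E)%E.
have -> : (\int[mu]_x (f (- x)%R * (phi x)%:E) = \int[mu]_x ((g \o -%R) x))%E.
  by apply: eq_integral => x _; rewrite /g /= !phiE sqrrN.
rewrite -[in LHS](preimage_setT (-%R : mR -> mR)) -ge0_integral_pushforward//=.
- by apply: eq_measure_integral => //= A mA _; exact/lebesgue_measureN.
- by apply: emeasurable_funM => //; apply/measurable_EFinP; exact: measurable_phi.
- by move=> x _; rewrite mule_ge0// lee_fin normal_pdf_ge0.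
Qed.

(** Tilting the Gaussian density by an exponential translates it, as
    completing the square shows. *)
Lemma integral_normal_expR q :
  (\int[nu]_x (expR (q * x))%:E = (expR (q ^+ 2 / 2))%:E)%E.
Proof.
rewrite integral_normal_density//; last first.
  by apply/measurable_EFinP; apply: measurableT_comp => //; exact: measurable_funM.
under eq_integral => x _.
  rewrite (_ : (_ * _)%E = ((expR (q ^+ 2 / 2))%:E * (normal_pdf q 1 x)%:E)%E).
    over.
  rewrite -!EFinM phiE normal_pdfE ?oner_eq0// /normal_fun; congr (_%:E).
  rewrite mulrCA [RHS]mulrCA -!expRD; congr (_ * expR _).
  by rewrite expr1n mulr2n; field.
rewrite ge0_integralZl//.
- by rewrite integral_normal_pdf mule1.
- by apply/measurable_EFinP; exact: measurable_normal_pdf.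
- by move=> x _; rewrite lee_fin normal_pdf_ge0.
Qed.

(** A class of integrable functions that is stable under translations and
    Gaussian averages. *)
Definition growing f : Prop :=
  measurable_fun setT f /\
  exists C q : R, [/\ 0 <= C, 0 <= q & forall x, `|f x| <= C * expR (q * `|x|)].

(** An even majorant of [expR (q * `|x|)] which Gaussian steps and coin
    tosses merely multiply by a constant. *)
Definition coshw q x : R := expR (q * x) + expR (- q * x).

Lemma coshw_ge0 q x : 0 <= coshw q x.
Proof. by rewrite addr_ge0 ?expR_ge0. Qed.

Lemma coshw_abs q x : 0 <= q -> expR (q * `|x|) <= coshw q x.
Proof.
move=> q0; rewrite /coshw; have [x0|x0] := ger0P x.
  by rewrite lerDl expR_ge0.
by rewrite mulrN mulNr lerDr expR_ge0.
Qed.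

Lemma coshw_le q x : 0 <= q -> coshw q x <= 2 * expR (q * `|x|).
Proof.
move=> q0; rewrite mulr_natl mulr2n lerD// ler_expR;
  first by rewrite ler_wpM2l ?ler_norm.
by rewrite mulNr -mulrN ler_wpM2l// -normrN ler_norm.
Qed.

Lemma measurable_coshw q : measurable_fun [set: mR] (coshw q).
Proof.
by apply: measurable_funD; apply: measurableT_comp => //; exact: measurable_funM.
Qed.

Lemma growing_le f g : measurable_fun setT f -> growing g ->
  (forall x, `|f x| <= `|g x|) -> growing f.
Proof.
move=> mf [_ [C [q [C0 q0 gC]]]] fg; split => //; exists C, q; split => // x.
exact: le_trans (gC x).
Qed.

Lemma growing_coshw C q : 0 <= q -> growing (fun x => C * coshw q x).
Proof.
move=> q0; split; first by apply: measurable_funM => //; exact: measurable_coshw.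
exists (`|C| * 2), q; split; rewrite ?mulr_ge0// => x.
by rewrite normrM -mulrA ler_wpM2l// ger0_norm ?coshw_ge0// coshw_le.
Qed.

Lemma growingE f : growing f -> exists C q : R, [/\ 0 <= C, 0 <= q &
  forall x, `|f x| <= C * coshw q x].
Proof.
move=> [_ [C [q [C0 q0 fC]]]]; exists C, q; split => // x.
by rewrite (le_trans (fC x))// ler_wpM2l// coshw_abs.
Qed.

Lemma integral_normal_coshw q :
  (\int[nu]_x (coshw q x)%:E = (2 * expR (q ^+ 2 / 2))%:E)%E.
Proof.
under eq_integral do rewrite EFinD.
rewrite ge0_integralD//.
- by rewrite !integral_normal_expR sqrrN -EFinD mulr_natl mulr2n.
- by apply/measurable_EFinP; apply: measurableT_comp => //; exact: measurable_funM.
- by apply/measurable_EFinP; apply: measurableT_comp => //; exact: measurable_funM.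
Qed.

Lemma integrable_coshw C q : nu.-integrable setT (EFin \o (fun x => C * coshw q x)).
Proof.
apply: (@eq_integrable _ _ _ nu setT _ (fun x => (C%:E * (coshw q x)%:E)%E)) => //.
apply: integrableZl => //.
apply/integrableP; split; first by apply/measurable_EFinP; exact: measurable_coshw.
under eq_integral do rewrite /= ger0_norm ?coshw_ge0//.
by rewrite integral_normal_coshw ltry.
Qed.

Lemma growing_integrable f : growing f -> nu.-integrable setT (EFin \o f).
Proof.
move=> gf; have [C [q [C0 q0 fC]]] := growingE gf.
apply: le_integrable (integrable_coshw C q) => //.
  by apply/measurable_EFinP; case: gf.
by move=> x _ /=; rewrite lee_fin (le_trans (fC x))// ler_norm.
Qed.

Lemma growingD f g : growing f -> growing g -> growing (fun x => f x + g x).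
Proof.
move=> [mf [C [q [C0 q0 fC]]]] [mg [D [p [D0 p0 gD]]]].
split; first exact: measurable_funD.
exists (C + D), (q + p); split; rewrite ?addr_ge0// => x.
rewrite (le_trans (ler_normD _ _))// !mulrDl lerD//.
  by rewrite (le_trans (fC x))// ler_wpM2l// ler_expR lerDl mulr_ge0.
by rewrite (le_trans (gD x))// ler_wpM2l// ler_expR lerDr mulr_ge0.
Qed.

Lemma growingZ C f : growing f -> growing (fun x => C * f x).
Proof.
move=> [mf [D [q [D0 q0 fD]]]]; split; first exact: measurable_funM.
exists (`|C| * D), q; split; rewrite ?mulr_ge0// => x.
by rewrite normrM -mulrA ler_wpM2l.
Qed.

Lemma growingN f : growing f -> growing (fun x => - f x).
Proof.
by move=> /(growingZ (-1)); under eq_fun do rewrite mulN1r.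
Qed.

Lemma growingB f g : growing f -> growing g -> growing (fun x => f x - g x).
Proof. by move=> gf gg; apply: growingD => //; exact: growingN. Qed.

Lemma growing_affine f x s : growing f -> growing (fun z => f (x + s * z)).
Proof.
move=> [mf [C [q [C0 q0 fC]]]]; split.
  apply: measurableT_comp => //.
  by apply: measurable_funD => //; exact: measurable_funM.
exists (C * expR (q * `|x|)), (q * `|s|); split; rewrite ?mulr_ge0 ?expR_ge0// => z.
rewrite (le_trans (fC _))// -mulrA ler_wpM2l// -expRD ler_expR -mulrA -mulrDr.
by rewrite ler_wpM2l// -normrM ler_normD.
Qed.

Lemma growing_cst (c : R) : growing (fun=> c).
Proof.
split => //; exists `|c|, 0; split => // x.
by rewrite mul0r expR0 mulr1.
Qed.

Definition gauss f : R := \int[nu]_x f x.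

Lemma EFin_gauss f : growing f -> ((gauss f)%:E = \int[nu]_x (f x)%:E)%E.
Proof.
by move=> gf; rewrite fineK//; exact: integrable_fin_num (growing_integrable gf).
Qed.

Lemma gaussD f g : growing f -> growing g ->
  gauss (fun x => f x + g x) = gauss f + gauss g.
Proof. by move=> *; apply: RintegralD => //; exact: growing_integrable. Qed.

Lemma gaussB f g : growing f -> growing g ->
  gauss (fun x => f x - g x) = gauss f - gauss g.
Proof. by move=> *; apply: RintegralB => //; exact: growing_integrable. Qed.

Lemma gaussZ C f : growing f -> gauss (fun x => C * f x) = C * gauss f.
Proof. by move=> *; apply: RintegralZl => //; exact: growing_integrable. Qed.

Lemma gauss_cst (c : R) : gauss (fun=> c) = c.
Proof.
rewrite /gauss Rintegral_cst// [X in fine X](_ : _ = 1%E) ?mulr1//.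
exact: probability_setT.
Qed.

Lemma gauss_coshw C q : gauss (fun x => C * coshw q x) = C * (2 * expR (q ^+ 2 / 2)).
Proof.
rewrite /gauss RintegralZl//; last first.
  have := @integrable_coshw 1 q.
  by under eq_fun do rewrite mul1r.
by rewrite /Rintegral integral_normal_coshw.
Qed.

Lemma norm_gauss_le f g : growing f -> growing g ->
  (forall x, `|f x| <= g x) -> `|gauss f| <= gauss g.
Proof.
move=> gf gg fg; apply: le_trans (le_normr_Rintegral _ (growing_integrable gf)) _ => //.
apply: le_Rintegral => //; last exact: growing_integrable.
have := integrable_norm (growing_integrable gf).
by apply: eq_integrable.
Qed.

(** The reflection formula holds for nonnegative functions; the general case
    follows by adding an even majorant. *)
Lemma gauss_opp f : growing f -> gauss (fun x => f (- x)) = gauss f.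
Proof.
move=> gf; have [C [q [C0 q0 fC]]] := growingE gf.
have gC : growing (fun x => C * coshw q x) by exact: growing_coshw.
pose g x := f x + C * coshw q x.
have gg : growing g by exact: growingD.
have go h : growing h -> growing (fun x => h (- x)).
  move=> /(growing_affine 0 (-1)); under eq_fun do rewrite add0r mulN1r.
  exact.
have g0 x : 0 <= g x.
  by have := fC x; rewrite ler_norml /g => /andP[+ _]; lra.
have E1 : gauss (fun x => f (- x) + C * coshw q (- x))
    = gauss (fun x => f x + C * coshw q x).
  rewrite /gauss /Rintegral; congr fine.
  apply: (@ge0_integral_normal_opp (EFin \o g)).
    by apply/measurable_EFinP; case: gg.
  by move=> x; rewrite lee_fin.
have cN x : coshw q (- x) = coshw q x by rewrite /coshw !mulrN !mulNr opprK addrC.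
move: E1; rewrite gaussD//; last 2 first.
- exact: go.
- by under eq_fun do rewrite cN.
rewrite gaussD// (_ : (fun x => C * coshw q (- x)) = (fun x => C * coshw q x)).
  exact: addIr.
by apply/funext => x; rewrite cN.
Qed.

End GaussianExpectation.

(** * Stability of the Gaussian law *)

Section Stability.
Context {R : realType}.
Local Notation mR := (measurableTypeR R).
Local Notation mu := (@lebesgue_measure R).
Local Notation nu := (normal_prob (0 : R) 1).
Local Notation phi := (normal_pdf (0 : R) 1).
Implicit Types (f g : mR -> R) (x q s t : R).

Lemma continuous_affine (f : R -> R) (a b : R) :
  continuous f -> continuous (fun x : R => f (a * x + b)).
Proof.
move=> cf x; apply: (@continuous_comp R R R (fun x => a * x + b) f); last exact: cf.
by apply: cvgD; [apply: cvgM; [exact: cvg_cst|exact: cvg_id]|exact: cvg_cst].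
Qed.

Lemma continuous_phi : continuous (phi : R -> R).
Proof. by apply: continuous_normal_pdf; rewrite oner_eq0. Qed.

(** Completing the square in the product of two Gaussian densities. *)
Lemma phi_product (s t rho u w : R) : 0 < s -> 0 < rho ->
  rho ^+ 2 = s ^+ 2 + t ^+ 2 ->
  rho / s * (phi w * phi (rho / s * u - t / s * w))
  = phi u * normal_pdf (t * u / rho) (s / rho) w.
Proof.
move=> s0 r0 rE; rewrite !phiE normal_pdfE ?gt_eqF ?divr_gt0//.
have pk : @normal_peak R (s / rho) = rho / s * normal_peak 1.
  rewrite /normal_peak expr1n mul1r -mulrnAr sqrtrM ?sqr_ge0//.
  by rewrite sqrtr_sqr ger0_norm ?divr_ge0 ?ltW// invfM invf_div.
rewrite pk /normal_fun.
set A := normal_peak 1.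
suff E : expR (- (w - t * u / rho) ^+ 2 / ((s / rho) ^+ 2 *+ 2)) * expR (- u ^+ 2 / 2)
    = expR (- w ^+ 2 / 2) * expR (- (rho / s * u - t / s * w) ^+ 2 / 2).
  transitivity (rho / s * A * A *
    (expR (- w ^+ 2 / 2) * expR (- (rho / s * u - t / s * w) ^+ 2 / 2))).
    by ring.
  by rewrite -E; ring.
rewrite -!expRD; congr expR.
have s0' : s != 0 by rewrite gt_eqF.
have r0' : rho != 0 by rewrite gt_eqF.
have tE : t ^+ 2 = rho ^+ 2 - s ^+ 2 by rewrite rE; ring.
apply: (@mulfI _ (2 * s ^+ 2)); first by rewrite mulf_neq0 ?pnatr_eq0// expf_neq0.
transitivity (- (rho ^+ 2 * w ^+ 2 - 2 * rho * t * u * w + t ^+ 2 * u ^+ 2) -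
  u ^+ 2 * s ^+ 2).
  by rewrite mulr2n; field; rewrite s0' r0'.
transitivity (- (s ^+ 2 * w ^+ 2 + rho ^+ 2 * u ^+ 2 - 2 * rho * t * u * w + t
  ^+ 2 * w ^+ 2)).
  by rewrite tE; ring.
by field; rewrite s0'.
Qed.

(** The sum of two independent centered Gaussians is Gaussian: in the
    coordinates [(w, u)] with [rho * u = s * z + t * w], the joint density
    is, by [phi_product], the density of [u] times a density in [w], which
    integrates to 1. *)
Lemma ge0_integral_normal_sum (f : R -> R) (x s t rho : R) :
  0 < s -> 0 < rho -> rho ^+ 2 = s ^+ 2 + t ^+ 2 ->
  continuous f -> (forall y, 0 <= f y) ->
  (\int[nu]_w \int[nu]_z (f (x + s * z + t * w))%:E
   = \int[nu]_u (f (x + rho * u))%:E)%E.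
Proof.
move=> s0 r0 rE cf f0.
have cf' a b : continuous (fun z : R => f (a * z + b)) by exact: continuous_affine.
have mcf a b : measurable_fun [set: mR] (fun z : mR => f (a * z + b)).
  exact: continuous_measurable_fun.
have E1 w : (\int[nu]_z (f (x + s * z + t * w))%:E =
    \int[mu]_u (f (x + rho * u) * (rho / s * phi (rho / s * u - t / s * w)))%:E)%E.
  rewrite integral_normal_density//; last 2 first.
  - apply/measurable_EFinP; under eq_fun do rewrite [x + _]addrC -addrA.
    exact: mcf.
  - by move=> z; rewrite lee_fin.
  pose G (z : R) := f (x + s * z + t * w) * phi z.
  rewrite (_ : (\int[mu]_z _)%E = (\int[mu]_z (G z)%:E)%E)//.
  rewrite (@ge0_integral_affine _ G (rho / s) (- (t / s * w))).
  - apply: eq_integral => u _; congr (_%:E); rewrite /G.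
    have -> : x + s * (rho / s * u - t / s * w) + t * w = x + rho * u.
      by field; rewrite gt_eqF.
    by rewrite -mulrA [X in _ * X]mulrC.
  - by rewrite divr_gt0.
  - move=> z; apply: cvgM; last exact: continuous_phi.
    have := cf' s (x + t * w) z.
    by under eq_fun do rewrite addrCA addrA.
  - by move=> z; rewrite mulr_ge0// normal_pdf_ge0.
under eq_integral => w _ do rewrite E1.
pose H (wu : mR * mR) : \bar R :=
  (phi wu.1 * (f (x + rho * wu.2) * (rho / s * phi (rho / s * wu.2 - t / s *
    wu.1))))%:E.
have mH : measurable_fun setT H.
  apply/measurable_EFinP; apply: measurable_funM.
    by apply: measurableT_comp => //; exact: measurable_phi.
  apply: measurable_funM.
    apply: (measurableT_comp (f := fun u : mR => f (x + rho * u))) => //.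
    by under eq_fun do rewrite addrC; exact: mcf.
  apply: measurable_funM => //; apply: measurableT_comp; first exact: measurable_phi.
  by apply: measurable_funB; apply: measurable_funM.
have rs0 : 0 <= rho / s by rewrite ltW// divr_gt0.
have H0 wu : (0 <= H wu)%E.
  by rewrite lee_fin; repeat apply: mulr_ge0;
    rewrite ?normal_pdf_ge0 ?invr_ge0 ?(ltW s0) ?(ltW r0).
have mK w : measurable_fun [set: mR] (fun u : mR =>
    (f (x + rho * u) * (rho / s * phi (rho / s * u - t / s * w)))%:E).
  apply/measurable_EFinP; apply: measurable_funM.
    by under eq_fun do rewrite addrC; exact: mcf.
  apply: measurable_funM => //; apply: measurableT_comp; first exact: measurable_phi.
  by apply: measurable_funB => //; apply: measurable_funM.
have K0 (w u : mR) : (0 <= (f (x + rho * u) * (rho / s * phi (rho / s * u - t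
  / s * w)))%:E)%E.
  by rewrite lee_fin; repeat apply: mulr_ge0;
    rewrite ?normal_pdf_ge0 ?invr_ge0 ?(ltW s0) ?(ltW r0).
transitivity (\int[mu]_w \int[mu]_u H (w, u))%E.
  rewrite integral_normal_density; last 2 first.
  - have mH' : measurable_fun setT (fun wu : mR * mR =>
      (f (x + rho * wu.2) * (rho / s * phi (rho / s * wu.2 - t / s * wu.1)))%:E).
      apply/measurable_EFinP; apply: measurable_funM.
        apply: (measurableT_comp (f := fun u : mR => f (x + rho * u))) => //.
        by under eq_fun do rewrite addrC; exact: mcf.
      apply: measurable_funM => //; apply: measurableT_comp;
        first exact: measurable_phi.
      by apply: measurable_funB; apply: measurable_funM.
    by apply: (@measurable_fun_fubini_tonelli_F _ _ _ _ _ mu _ mH') => // wu; exact: K0.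
  - by move=> w; apply: integral_ge0 => u _; exact: K0.
  apply: eq_integral => w _.
  rewrite muleC -ge0_integralZl//; last by rewrite lee_fin normal_pdf_ge0.
rewrite fubini_tonelli//.
transitivity (\int[mu]_u ((f (x + rho * u))%:E * (phi u)%:E))%E; last first.
  rewrite integral_normal_density//; last by move=> z; rewrite lee_fin.
  by apply/measurable_EFinP; under eq_fun do rewrite addrC; exact: mcf.
apply: eq_integral => u _.
transitivity (\int[mu]_w ((f (x + rho * u) * phi u)%:E *
   (normal_pdf (t * u / rho) (s / rho) w)%:E))%E.
  apply: eq_integral => w _; rewrite /H/= -EFinM; congr (_%:E).
  rewrite -[RHS]mulrA -(phi_product u w s0 r0 rE); ring.
rewrite ge0_integralZl//.
- by rewrite integral_normal_pdf mule1 EFinM.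
- by apply/measurable_EFinP; exact: measurable_normal_pdf.
- by move=> w _; rewrite lee_fin normal_pdf_ge0.
- by rewrite lee_fin mulr_ge0// normal_pdf_ge0.
Qed.

End Stability.

(** * Taylor expansion of symmetric differences *)

Section Taylor.
Context {R : realType}.

(** The form of Taylor's theorem used for remainders: [u j] is the derivative
    of order [j], and the bound on the last one is integrated [n] times from
    0. *)
Lemma taylor_zero n (u : nat -> R -> R) (Y B : R) : 0 <= Y ->
  (forall j y, (j < n)%N -> 0 <= y <= Y -> is_derive y 1 (u j) (u j.+1 y)) ->
  (forall j, (j < n)%N -> u j 0 = 0) ->
  (forall y, 0 <= y <= Y -> `|u n y| <= B) ->
  forall y, 0 <= y <= Y -> `|u 0%N y| <= B * y ^+ n.
Proof.
move=> Y0; elim: n u => [|n IH] u du u0 uB y yY.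
  by rewrite expr0 mulr1; exact: uB.
have /andP[y0 yY'] := yY.
have B0 : 0 <= B by rewrite (le_trans _ (uB 0 _))// lexx.
have IHu z : 0 <= z <= Y -> `|u 1%N z| <= B * z ^+ n.
  apply: (IH (fun j => u j.+1)) => // [j w jn|j jn]; first exact: du.
  exact: u0.
have -> : u 0%N y = u 0%N y - u 0%N 0 by rewrite u0 ?subr0.
apply: (@le_trans _ _ (B * y ^+ n * (y - 0))); last by rewrite subr0 exprSr mulrA.
apply: (@mvt_bound _ (u 0%N) (u 1%N)) => // z; rewrite in_itv/= => /andP[z0 zy].
  by apply: du => //; rewrite z0 (le_trans zy).
apply: le_trans (IHu z _) _; first by rewrite z0 (le_trans zy).
by rewrite ler_wpM2l// lerXn2r ?nnegrE.
Qed.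

Lemma is_derive_shiftl (f : R -> R) (df x y : R) :
  is_derive (x + y) 1 f df -> is_derive y 1 (fun z => f (x + z)) df.
Proof.
move=> fd; rewrite -[df]mulr1.
apply: (@is_derive1_comp _ f (fun z => x + z) y df 1) => //.
apply: (is_derive_eq (is_deriveD (is_derive_cst x y 1) (is_derive_id y 1))).
by rewrite add0r.
Qed.

Lemma is_derive_reflect (f : R -> R) (df x y : R) :
  is_derive (x - y) 1 f df -> is_derive y 1 (fun z => f (x - z)) (- df).
Proof.
move=> fd; rewrite -mulrN1.
apply: (@is_derive1_comp _ f (fun z => x - z) y df (-1)) => //.
apply: (is_derive_eq (is_deriveB (is_derive_cst x y 1) (is_derive_id y 1))).
by rewrite sub0r.
Qed.

(** The odd orders cancel in a symmetric second difference. *)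
Lemma symmetric_taylor (f : nat -> R -> R) (C q x y : R) : 0 <= C -> 0 <= q ->
  (forall j (z : R), (j < 4)%N -> is_derive z 1 (f j) (f j.+1 z)) ->
  (forall z, `|f 4%N z| <= C * expR (q * `|z|)) ->
  `|2^-1 * (f 0%N (x + y) + f 0%N (x - y)) - f 0%N x - y ^+ 2 / 2 * f 2%N x|
    <= C * expR (q * `|x|) * (y ^+ 4 * expR (q * `|y|)).
Proof.
move=> C0 q0 df fB.
wlog y0 : y / 0 <= y.
  move=> H; have [|/ltW y0] := leP 0 y; first exact: H.
  have := H (- y); rewrite opprK oppr_ge0 => /(_ y0).
  have e4 : (- y) ^+ 4 = y ^+ 4 by ring.
  by rewrite normrN sqrrN e4 [f 0%N (x - y) + _]addrC.
(* The remainder as a function of the increment, with its derivatives. *)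
pose u (j : nat) (z : R) : R := match j with
  | 0 => 2^-1 * (f 0%N (x + z) + f 0%N (x - z)) - f 0%N x - z ^+ 2 / 2 * f 2%N x
  | 1 => 2^-1 * (f 1%N (x + z) - f 1%N (x - z)) - z * f 2%N x
  | 2 => 2^-1 * (f 2%N (x + z) + f 2%N (x - z)) - f 2%N x
  | 3 => 2^-1 * (f 3%N (x + z) - f 3%N (x - z))
  | _ => 2^-1 * (f 4%N (x + z) + f 4%N (x - z)) end.
have P j (z : R) : (j < 4)%N -> is_derive z 1 (fun w => f j (x + w)) (f j.+1 (x + z)).
  by move=> j4; apply: is_derive_shiftl; exact: df.
have N j (z : R) : (j < 4)%N -> is_derive z 1 (fun w => f j (x - w)) (- f j.+1 (x - z)).
  by move=> j4; apply: is_derive_reflect; exact: df.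
have D2 (z : R) : is_derive z 1 (fun w : R => w ^+ 2 / 2 * f 2%N x) (z * f 2%N x).
  rewrite (_ : (fun w => _) = (fun w : R => f 2%N x / 2 * w ^+ 2)).
    by apply: (is_derive_eq (is_derive_scale _ (is_derive_sqr z))); field.
  by apply/funext => w; field.
have D1 (z : R) : is_derive z 1 (fun w : R => w * f 2%N x) (f 2%N x).
  by have := is_derive_affine 0 (f 2%N x) z; under eq_fun do rewrite add0r.
have du j (z : R) : (j < 4)%N -> 0 <= z <= y -> is_derive z 1 (u j) (u j.+1 z).
  move=> + _; case: j => [_|[_|[_|[_|//]]]]; rewrite /u.
  - apply: is_derive_eq (is_derive_sub (is_derive_sub (is_derive_scale 2^-1
      (is_derive_add (P 0%N z isT) (N 0%N z isT))) (is_derive_cst (f 0%N x) z 1))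
      (D2 z)) _.
    by rewrite subr0.
  - apply: is_derive_eq (is_derive_sub (is_derive_scale 2^-1
      (is_derive_sub (P 1%N z isT) (N 1%N z isT))) (D1 z)) _.
    by rewrite opprK.
  - apply: is_derive_eq (is_derive_sub (is_derive_scale 2^-1
      (is_derive_add (P 2%N z isT) (N 2%N z isT))) (is_derive_cst (f 2%N x) z 1)) _.
    by rewrite subr0.
  - apply: is_derive_eq
      (is_derive_scale 2^-1 (is_derive_sub (P 3%N z isT) (N 3%N z isT))) _.
    by rewrite opprK.
have u0 j : (j < 4)%N -> u j 0 = 0.
  by case: j => [|[|[|[|//]]]] _; rewrite /u/= ?addr0 ?subr0 ?subrr; field.
have uB z : 0 <= z <= y -> `|u 4%N z| <= C * expR (q * `|x|) * expR (q * `|y|).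
  move=> /andP[z0 zy].
  have b w : `|w| <= `|x| + `|y| -> `|f 4%N w| <= C * expR (q * `|x|) * expR (q * `|y|).
    move=> wxy; rewrite (le_trans (fB w))// -mulrA ler_wpM2l//.
    by rewrite -expRD ler_expR -mulrDr ler_wpM2l.
  have zy' : `|z| <= `|y| by rewrite !ger0_norm// (le_trans z0).
  rewrite /u normrM ger0_norm ?invr_ge0// ler_pdivrMl// mulr_natl mulr2n.
  rewrite (le_trans (ler_normD _ _))// lerD// b//.
    by rewrite (le_trans (ler_normD _ _))// lerD2l.
  by rewrite (le_trans (ler_normB _ _))// lerD2l.
rewrite [y ^+ 4 * _]mulrC mulrA.
by apply: (taylor_zero y0 du u0 uB); rewrite y0 lexx.
Qed.

Lemma expr4_le (x : R) : x ^+ 4 <= 256 * expR `|x|.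
Proof.
have -> : x ^+ 4 = `|x| ^+ 4 by rewrite -normrX ger0_norm// exprn_even_ge0.
have h : `|x| / 4 <= expR (`|x| / 4).
  by rewrite (le_trans _ (expR_ge1Dx _))// lerDr.
have -> : expR `|x| = expR (`|x| / 4) ^+ 4.
  by rewrite -expRM_natl; congr expR; field.
have -> : `|x| ^+ 4 = 256 * (`|x| / 4) ^+ 4 by field.
by rewrite ler_wpM2l// lerXn2r ?nnegrE ?expR_ge0 ?divr_ge0.
Qed.

End Taylor.

(** * Gaussian and coin steps on the line *)

Section Heat.
Context {R : realType}.
Local Notation mR := (measurableTypeR R).
Local Notation nu := (normal_prob (0 : R) 1).
Implicit Types (f g : mR -> R) (x q s t a C : R).

Definition heat s f x : R := gauss (fun z => f (x + s * z)).

Definition coin s f x : R := 2^-1 * (f (x + s) + f (x - s)).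

Lemma growing_expR a : growing (fun z => expR (a * z)).
Proof.
split; first by apply: measurableT_comp => //; exact: measurable_funM.
exists 1, `|a|; split => // z; rewrite mul1r ger0_norm ?expR_ge0// ler_expR.
by rewrite -normrM ler_norm.
Qed.

Lemma gauss_expR a C : gauss (fun z => C * expR (a * z)) = C * expR (a ^+ 2 / 2).
Proof.
rewrite gaussZ; last exact: growing_expR.
congr (_ * _); apply: (@EFin_inj R).
by rewrite EFin_gauss ?integral_normal_expR//; exact: growing_expR.
Qed.

Lemma heat_coshw s q C x :
  heat s (fun y => C * coshw q y) x = C * expR ((q * s) ^+ 2 / 2) * coshw q x.
Proof.
have ge (a D : R) : growing (fun z => D * expR (a * z)).
  by apply: growingZ; exact: growing_expR.
rewrite /heat (_ : (fun z => _) = (fun z => C * expR (q * x) * expR (q * s * z)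
    + C * expR (- q * x) * expR (- q * s * z))).
  rewrite gaussD// !gauss_expR (_ : (- q * s) ^+ 2 = (q * s) ^+ 2); last by ring.
  by rewrite /coshw; ring.
by apply/funext => z; rewrite /coshw -!mulrA -!expRD mulrDr;
  congr (C * expR _ + C * expR _); ring.
Qed.

Lemma norm_heat_le s f q C x : growing f -> 0 <= C -> 0 <= q ->
  (forall y, `|f y| <= C * coshw q y) ->
  `|heat s f x| <= C * expR ((q * s) ^+ 2 / 2) * coshw q x.
Proof.
move=> gf C0 q0 fC; rewrite -heat_coshw; apply: norm_gauss_le.
- exact: growing_affine.
- by apply: (@growing_affine _ (fun y => C * coshw q y)); exact: growing_coshw.
- by move=> z; exact: fC.
Qed.

Lemma heatD s f g x : growing f -> growing g ->
  heat s (fun y => f y + g y) x = heat s f x + heat s g x.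
Proof. by move=> gf gg; apply: gaussD; exact: growing_affine. Qed.

Lemma heatB s f g x : growing f -> growing g ->
  heat s (fun y => f y - g y) x = heat s f x - heat s g x.
Proof. by move=> gf gg; apply: gaussB; exact: growing_affine. Qed.

(** Adding an even majorant makes the function nonnegative, and thus within
    the reach of Tonelli's theorem, while the smoothed majorant is known. *)
Let shift_up (f : mR -> R) : growing f -> exists C q : R,
  [/\ 0 <= C, 0 <= q, growing (fun x => C * coshw q x),
      forall x, `|f x| <= C * coshw q x &
      forall x, 0 <= f x + C * coshw q x].
Proof.
move=> gf; have [C [q [C0 q0 fC]]] := growingE gf.
exists C, q; split => // [|x]; first exact: growing_coshw.
by have := fC x; rewrite ler_norml => /andP[+ _]; lra.
Qed.

Let measurable_heat_ge0 s f : growing f -> (forall x, 0 <= f x) ->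
  measurable_fun setT (heat s f : mR -> R).
Proof.
move=> gf f0; have [mf _] := gf.
have mF : measurable_fun setT (fun xz : mR * mR => (f (xz.1 + s * xz.2))%:E).
  apply/measurable_EFinP; apply: measurableT_comp => //.
  by apply: measurable_funD => //; exact: measurable_funM.
have F0 (xz : mR * mR) : (0 <= (f (xz.1 + s * xz.2))%:E)%E by rewrite lee_fin.
have := @measurable_fun_fubini_tonelli_F _ _ mR mR R nu _ mF F0.
move=> mh; apply: (measurableT_comp (f := fine)) => //.
Qed.

Lemma growing_heat s f : growing f -> growing (heat s f).
Proof.
move=> gf; have [C [q [C0 q0 gC fC f0]]] := shift_up gf.
have gfC : growing (fun x => f x + C * coshw q x) by exact: growingD.
split.
  have -> : heat s f = fun x => heat s (fun y => f y + C * coshw q y) x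
                               - heat s (fun y => C * coshw q y) x.
    by apply/funext => x; rewrite heatD// addrK.
  apply: measurable_funB; apply: measurable_heat_ge0 => // x.
  by rewrite mulr_ge0// coshw_ge0.
exists (C * expR ((q * s) ^+ 2 / 2) * 2), q; split => //.
  by rewrite !mulr_ge0// expR_ge0.
move=> x; apply: le_trans (norm_heat_le s x gf C0 q0 fC) _.
by rewrite -[leRHS]mulrA ler_wpM2l ?coshw_le// mulr_ge0// expR_ge0.
Qed.

Let heat_heat_ge0 s t rho f x : 0 < s -> 0 < rho ->
  rho ^+ 2 = s ^+ 2 + t ^+ 2 -> growing f -> continuous (f : R -> R) ->
  (forall y, 0 <= f y) -> heat t (heat s f) x = heat rho f x.
Proof.
move=> s0 r0 rE gf cf f0; apply: (@EFin_inj R).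
rewrite !EFin_gauss; last 2 first.
- exact: growing_affine.
- by apply: growing_affine; exact: growing_heat.
rewrite -(ge0_integral_normal_sum x s0 r0 rE cf f0).
apply: eq_integral => w _; rewrite /heat EFin_gauss; last exact: growing_affine.
by apply: eq_integral => z _; rewrite addrAC.
Qed.

Lemma continuous_coshw (C q : R) : continuous (fun x : R => C * coshw q x).
Proof.
have ce (a : R) : continuous (fun x : R => expR (a * x)).
  move=> x; apply: (@continuous_comp R R R (fun x => a * x) expR).
    by apply: cvgM; [exact: cvg_cst|exact: cvg_id].
  exact: continuous_expR.
move=> x; apply: cvgM; first exact: cvg_cst.
by apply: cvgD; exact: ce.
Qed.

(** Variances add, by the stability of the Gaussian law. *)
Lemma heat_heat s t rho f x : 0 < s -> 0 < rho ->
  rho ^+ 2 = s ^+ 2 + t ^+ 2 -> growing f -> continuous (f : R -> R) ->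
  heat t (heat s f) x = heat rho f x.
Proof.
move=> s0 r0 rE gf cf; have [C [q [C0 q0 gC fC f0]]] := shift_up gf.
have cC : continuous (fun x : R => C * coshw q x) by exact: continuous_coshw.
have gfC : growing (fun x => f x + C * coshw q x) by exact: growingD.
have K0 y : 0 <= C * coshw q y by rewrite mulr_ge0// coshw_ge0.
have E1 := heat_heat_ge0 x s0 r0 rE gC cC K0.
have cfC : continuous (fun x : R => f x + C * coshw q x).
  by move=> y; apply: cvgD; [exact: cf|exact: cC].
have := heat_heat_ge0 x s0 r0 rE gfC cfC f0.
rewrite (_ : heat s (fun y => f y + C * coshw q y) =
  (fun y => heat s f y + heat s (fun y => C * coshw q y) y)).
  rewrite heatD; [|exact: growing_heat|exact: growing_heat].
  by rewrite E1 heatD//; exact: addIr.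
by apply/funext => y; rewrite heatD.
Qed.

Lemma heat0 f x : heat 0 f x = f x.
Proof.
rewrite /heat (_ : (fun z => _) = fun=> f x) ?gauss_cst//.
by apply/funext => z; rewrite mul0r addr0.
Qed.

(** [n] variances [step n ^+ 2] add up to 1. *)
Lemma iter_heat n f : growing f -> continuous (f : R -> R) -> (0 < n)%N ->
  iter n (heat (step n)) f 0 = gauss f.
Proof.
move=> gf cf n0; have e0 := @step_gt0 R n n0.
suff H m x : iter m (heat (step n)) f x = heat (Num.sqrt m%:R * step n) f x.
  rewrite H /step divff ?gt_eqF ?sqrtr_gt0 ?ltr0n//.
  by rewrite /heat; congr gauss; apply/funext => z; rewrite add0r mul1r.
elim: m x => [|m IH] x; first by rewrite sqrtr0 mul0r heat0.
rewrite /= (_ : iter m _ f = heat (Num.sqrt m%:R * step n) f); last first.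
  by apply/funext => y; rewrite IH.
have r0 : 0 < Num.sqrt (m.+1%:R : R) * step n.
  by apply: mulr_gt0 => //; rewrite sqrtr_gt0 ltr0n.
have [->|m0] := posnP m.
  rewrite sqrtr0 mul0r sqrtr1 mul1r; congr heat.
  by apply/funext => y; rewrite heat0.
apply: heat_heat => //; first by apply: mulr_gt0 => //; rewrite sqrtr_gt0 ltr0n.
by rewrite !exprMn !sqr_sqrtr// -natr1; ring.
Qed.

Definition second_moment : R := gauss (fun z => z ^+ 2).

Lemma growing_expr n : growing (fun z : mR => z ^+ n).
Proof.
split; first exact: measurable_funX.
exists n`!%:R, 1; split => // x; rewrite mul1r normrX.
case: n => [|n]; first by rewrite expr0 fact0 mul1r -expR0 ler_expR.
have := expR_ge1Dxn n (normr_ge0 x).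
rewrite -ler_pdivrMl ?ltr0n ?fact_gt0// mulrC.
by apply: le_trans; rewrite lerDr.
Qed.

Let half_sum f x s : mR -> R := fun z => 2^-1 * (f (x + s * z) + f (x - s * z)).

Let growing_half_sum f x s : growing f -> growing (half_sum f x s).
Proof.
move=> gf; apply: growingZ; apply: growingD; first exact: growing_affine.
by have := growing_affine x (- s) gf; under eq_fun do rewrite mulNr.
Qed.

Let heat_sym s f x : growing f -> heat s f x = gauss (half_sum f x s).
Proof.
move=> gf; have g1 := growing_affine x s gf; have g2 := growing_affine x (- s) gf.
have E : gauss (fun z => f (x - s * z)) = heat s f x.
  rewrite /heat -(gauss_opp g1); congr gauss; apply/funext => z; by rewrite mulrN.
have g3 : growing (fun z => f (x - s * z)).
  by move: g2; under eq_fun do rewrite mulNr.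
rewrite gaussZ; last exact: growingD.
by rewrite gaussD// E -/(heat s f x); field.
Qed.

(** The symmetry of the Gaussian law replaces the increment of [f] by its
    symmetric difference, which is then expanded under the integral. *)
Lemma heat_expansion (f : nat -> R -> R) C q : 0 <= C -> 0 <= q ->
  growing (f 0%N) ->
  (forall j (z : R), (j < 4)%N -> is_derive z 1 (f j) (f j.+1 z)) ->
  (forall z, `|f 4%N z| <= C * expR (q * `|z|)) ->
  forall s x, 0 <= s <= 1 ->
  `|heat s (f 0%N) x - f 0%N x - s ^+ 2 / 2 * f 2%N x * second_moment|
    <= s ^+ 4 * (C * expR (q * `|x|)) * (256 * (2 * expR ((1 + q) ^+ 2 / 2))).
Proof.
move=> C0 q0 gf df fB s x /andP[s0 s1].
have -> : heat s (f 0%N) x - f 0%N x - s ^+ 2 / 2 * f 2%N x * second_moment =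
   gauss (fun z => half_sum (f 0%N) x s z - f 0%N x - (s ^+ 2 / 2 * f 2%N x) * z ^+ 2).
  rewrite gaussB; last 2 first.
  - by apply: growingB; [exact: growing_half_sum|exact: growing_cst].
  - by apply: growingZ; exact: growing_expr.
  rewrite gaussB; [|exact: growing_half_sum|exact: growing_cst].
  by rewrite gauss_cst gaussZ -?heat_sym//; exact: growing_expr.
rewrite -[leRHS]mulrA; have -> : s ^+ 4 * (C * expR (q * `|x|) * (256 * (2 *
  expR ((1 + q) ^+ 2 / 2)))) = s ^+ 4 * (C * expR (q * `|x|)) * 256 * (2 *
    expR ((1 + q) ^+ 2 / 2)) by ring.
rewrite -gauss_coshw; apply: norm_gauss_le.
- apply: growingB; last by apply: growingZ; exact: growing_expr.
  by apply: growingB; [exact: growing_half_sum|exact: growing_cst].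
- by apply: growing_coshw; rewrite addr_ge0.
move=> z.
have := symmetric_taylor x (s * z) C0 q0 df fB.
have -> : (s * z) ^+ 2 / 2 * f 2%N x = s ^+ 2 / 2 * f 2%N x * z ^+ 2 by ring.
move=> /le_trans; apply.
have -> : s ^+ 4 * (C * expR (q * `|x|)) * 256 * coshw (1 + q) z =
  C * expR (q * `|x|) * (s ^+ 4 * (256 * coshw (1 + q) z)) by ring.
rewrite ler_wpM2l ?mulr_ge0 ?expR_ge0// exprMn -mulrA ler_wpM2l ?exprn_ge0//.
apply: (@le_trans _ _ (256 * expR `|z| * expR (q * `|z|))).
  rewrite ler_pM ?expr4_le ?expR_ge0 ?exprn_even_ge0// ler_expR ler_wpM2l//.
  by rewrite normrM ger0_norm// ler_piMl.
rewrite -mulrA ler_wpM2l// -expRD -{1}[`|z|]mul1r -mulrDl.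
by rewrite coshw_abs// addr_ge0.
Qed.

(** The Gaussian average of the exponential is known in closed form, and
    comparing its expansion in [s] with [heat_expansion] identifies the
    second moment. *)
Lemma second_moment1 : second_moment = 1.
Proof.
have gx : growing (expR : mR -> R).
  by have := growing_expR 1; under eq_fun do rewrite mul1r.
pose K : R := 256 * (2 * expR ((1 + 1) ^+ 2 / 2)) + 4^-1 * expR 1.
have K0 : 0 <= K by rewrite addr_ge0 ?mulr_ge0 ?expR_ge0.
have key s : 0 < s <= 1 -> `|1 - second_moment| <= 2 * K * s ^+ 2.
  move=> /andP[s0 s1].
  have h1 := @heat_expansion (fun=> expR) 1 1 ler01 ler01 gx
    (fun _ z _ => is_derive_expR z) _ s 0.
  have {h1} := h1 (fun z => _) _; rewrite !normr0 !mulr0 !expR0 !mulr1.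
  have -> : heat s expR 0 = expR (s ^+ 2 / 2).
    rewrite /heat -[RHS]mul1r -gauss_expR; congr gauss; apply/funext => z.
    by rewrite add0r mul1r.
  rewrite (ltW s0) s1 => /(_ _ isT) h1.
  have {}h1 : `|expR (s ^+ 2 / 2) - 1 - s ^+ 2 / 2 * second_moment| <=
      s ^+ 4 * (256 * (2 * expR ((1 + 1) ^+ 2 / 2))).
    apply: h1 => z.
    by rewrite !mul1r ger0_norm ?expR_ge0// ler_expR ler_norm.
  have h2 : `|expR (s ^+ 2 / 2) - 1 - s ^+ 2 / 2| <= s ^+ 4 * (4^-1 * expR 1).
    have a := expR_ge1Dx (s ^+ 2 / 2); have b := expR_taylor1 (s ^+ 2 / 2).
    rewrite ger0_norm; last by lra.
    have s20 : 0 <= s ^+ 2 / 2 by rewrite divr_ge0 ?sqr_ge0.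
    have c : expR `|s ^+ 2 / 2| <= expR 1.
      rewrite ler_expR ger0_norm// ler_pdivrMr// mul1r (@le_trans _ _ 1)//.
      by rewrite expr_le1// ltW.
      by rewrite ler1n.
    have d : (s ^+ 2 / 2) ^+ 2 * expR `|s ^+ 2 / 2| <= (s ^+ 2 / 2) ^+ 2 * expR 1.
      by rewrite ler_wpM2l ?sqr_ge0.
    have -> : s ^+ 4 * (4^-1 * expR 1) = (s ^+ 2 / 2) ^+ 2 * expR 1 by field.
    lra.
  have s2 : 0 < s ^+ 2 by rewrite exprn_gt0.
  rewrite -(ler_pM2l s2).
  have -> : s ^+ 2 * `|1 - second_moment| = 2 * `|s ^+ 2 / 2 - s ^+ 2 / 2 *
    second_moment|.
    rewrite -{1}[s ^+ 2 / 2]mulr1 -mulrBr normrM [`|s ^+ 2 / 2|]ger0_norm.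
      by field.
    by rewrite divr_ge0 ?sqr_ge0.
  have -> : s ^+ 2 * (2 * K * s ^+ 2) = 2 * (s ^+ 4 * K) by ring.
  rewrite ler_pM2l// /K mulrDr.
  apply: le_trans (lerD h1 h2); apply: le_trans (ler_normB _ _).
  by rewrite le_eqVlt; apply/orP; left; apply/eqP; congr `| _ |; ring.
apply/eqP; rewrite eq_sym -subr_eq0 -normr_le0; apply/ler_addgt0Pr => e e0.
rewrite add0r; pose s := Num.min 1 (e / (2 * K + 1)).
have K1 : 0 < 2 * K + 1 by rewrite ltr_wpDl// mulr_ge0.
have s0 : 0 < s by rewrite lt_min ltr01 divr_gt0.
have s1 : s <= 1 by rewrite ge_min lexx.
apply: (@le_trans _ _ (2 * K * s ^+ 2)); first by apply: key; rewrite s0.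
apply: (@le_trans _ _ ((2 * K + 1) * s)).
  rewrite expr2 mulrA ler_pM2r//.
  have : 2 * K * s <= 2 * K by rewrite ler_piMr// mulr_ge0.
  by lra.
by rewrite mulrC -ler_pdivlMr// ge_min lexx orbT.
Qed.

Lemma coin_expansion (f : nat -> R -> R) C q : 0 <= C -> 0 <= q ->
  (forall j (z : R), (j < 4)%N -> is_derive z 1 (f j) (f j.+1 z)) ->
  (forall z, `|f 4%N z| <= C * expR (q * `|z|)) ->
  forall s x, 0 <= s <= 1 ->
  `|coin s (f 0%N) x - f 0%N x - s ^+ 2 / 2 * f 2%N x|
    <= s ^+ 4 * (C * expR (q * `|x|)) * expR q.
Proof.
move=> C0 q0 df fB s x /andP[s0 s1].
apply: le_trans (symmetric_taylor x s C0 q0 df fB) _.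
rewrite mulrA [_ * s ^+ 4]mulrC ler_wpM2l ?mulr_ge0 ?expR_ge0 ?exprn_ge0//.
by rewrite ler_expR ger0_norm// ler_piMr.
Qed.

End Heat.

(** * From the coin walk to the Gaussian law *)

Section CoinWalk.
Context {R : realType}.
Local Notation mR := (measurableTypeR R).
Local Notation nu := (normal_prob (0 : R) 1).
Implicit Types (f g : mR -> R) (x q s t a C c : R).

Lemma growing_shift f a : growing f -> growing (fun x => f (x + a)).
Proof.
by move=> /(growing_affine a 1); under eq_fun do rewrite mul1r addrC.
Qed.

Lemma growing_coin s f : growing f -> growing (coin s f).
Proof. by move=> gf; apply: growingZ; apply: growingD; exact: growing_shift. Qed.

Lemma coinB s f g x :
  coin s (fun y => f y - g y) x = coin s f x - coin s g x.
Proof. by rewrite /coin; ring. Qed.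

Lemma coin_heat s t f x : growing f -> coin s (heat t f) x = heat t (coin s f) x.
Proof.
move=> gf; rewrite /coin /heat gaussZ; last first.
  by apply: growingD; have := growing_affine x t (growing_shift _ gf); exact.
rewrite gaussD; last 2 first.
- by have := growing_affine x t (growing_shift s gf); exact.
- by have := growing_affine x t (growing_shift (- s) gf); exact.
by congr (_ * (gauss _ + gauss _)); apply/funext => z; rewrite addrAC.
Qed.

Lemma norm_coin_le s f C x : 0 <= s <= 1 -> 0 <= C ->
  (forall y, `|f y| <= C * coshw 1 y) ->
  `|coin s f x| <= C * expR (expR 1 * s ^+ 2) * coshw 1 x.
Proof.
move=> /andP[s0 s1] C0 fC; rewrite /coin normrM ger0_norm ?invr_ge0//.
apply: (@le_trans _ _ (2^-1 * (C * coshw 1 (x + s) + C * coshw 1 (x - s)))).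
  by rewrite ler_wpM2l ?invr_ge0// (le_trans (ler_normD _ _))// lerD.
have -> : 2^-1 * (C * coshw 1 (x + s) + C * coshw 1 (x - s)) =
  C * (2^-1 * (expR s + expR (- s))) * coshw 1 x.
  rewrite /coshw !mulNr !mul1r !opprD opprK !expRD; ring.
rewrite ler_wpM2r ?coshw_ge0// ler_wpM2l//.
apply: le_trans (expR_ge1Dx _).
have a := expR_taylor1 s; have b := expR_taylor1 (- s).
have d : s ^+ 2 * expR `|s| <= s ^+ 2 * expR 1.
  by rewrite ler_wpM2l ?sqr_ge0// ler_expR ger0_norm.
move: b; rewrite sqrrN normrN => b.
by rewrite ler_pdivrMl//; lra.
Qed.

(** A coin toss and a Gaussian step of the same size have the same expansion
    up to the third order, so [n] exchanges cost [n * step n ^+ 4]; the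
    Gaussian walk has exactly the law of its limit. *)
Lemma coin_walk (f : nat -> R -> R) C : 0 <= C ->
  growing (f 0%N) ->
  (forall j (z : R), (j < 4)%N -> is_derive z 1 (f j) (f j.+1 z)) ->
  (forall z, `|f 4%N z| <= C * expR `|z|) ->
  forall n, (0 < n)%N ->
  `|iter n (coin (step n)) (f 0%N) 0 - gauss (f 0%N)| <=
    C * (256 * (2 * expR ((1 + 1) ^+ 2 / 2)) + expR 1)
    * (expR (expR 1) * 2) / n%:R.
Proof.
move=> C0 gf df fB n n0.
have fB' z : `|f 4%N z| <= C * expR (1 * `|z|) by rewrite mul1r.
have e01 := @step_ge0_in R n n0; have /andP[e0 e1] := e01.
have cf : continuous (f 0%N).
  move=> x; apply: differentiable_continuous; apply/derivable1_diffP.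
  by have := df 0%N x isT; case.
rewrite -(iter_heat gf cf n0).
set M := 256 * _ + _; have M0 : 0 <= M.
  by rewrite addr_ge0 ?mulr_ge0 ?expR_ge0.
pose d : R := step n ^+ 4 * C * M.
have d0 : 0 <= d by rewrite mulr_ge0// mulr_ge0// exprn_ge0.
have h : `|iter n (coin (step n)) (f 0%N) 0 - iter n (heat (step n)) (f 0%N) 0|
    <= n%:R * d * expR (expR 1 * step n ^+ 2) ^+ n * coshw 1 (0 : R).
  apply: (@telescoping R mR (coshw 1) (expR (expR 1 * step n ^+ 2))
    (coin (step n)) (heat (step n)) growing) => //.
  - by move=> x; exact: coshw_ge0.
  - by rewrite -expR0 ler_expR mulr_ge0 ?expR_ge0 ?sqr_ge0.
  - by move=> g; exact: growing_coin.
  - by move=> g; exact: growing_heat.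
  - by move=> g g' *; exact: growingB.
  - by move=> g g' gg gg'; apply/funext => x; exact: coinB.
  - by move=> g g' gg gg'; apply/funext => x; exact: heatB.
  - by move=> g gg; apply/funext => x; exact: coin_heat.
  - by move=> g D gg D0 gD x; exact: norm_coin_le.
  - move=> g D gg D0 gD x; apply: le_trans (norm_heat_le (step n) x gg D0 ler01 gD) _.
    rewrite ler_wpM2r ?coshw_ge0// ler_wpM2l// ler_expR mul1r mulrC ler_wpM2r
      ?sqr_ge0//.
    apply: (@le_trans _ _ 1); first by rewrite invf_le1// ler1n.
    by rewrite -expR0 ler_expR.
  - move=> x.
    have h1 := heat_expansion C0 ler01 gf df fB' x e01.
    have h2 := coin_expansion C0 ler01 df fB' x e01.
    move: h1; rewrite second_moment1 mulr1 => h1.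
    have -> : coin (step n) (f 0%N) x - heat (step n) (f 0%N) x =
      (coin (step n) (f 0%N) x - f 0%N x - step n ^+ 2 / 2 * f 2%N x)
      - (heat (step n) (f 0%N) x - f 0%N x - step n ^+ 2 / 2 * f 2%N x) by ring.
    apply: le_trans (ler_normB _ _) _; apply: le_trans (lerD h2 h1) _.
    rewrite -mulrDr addrC -/M /d mulrA -[leRHS]mulrA [M * _]mulrC mulrA ler_wpM2r//.
    by rewrite ler_wpM2l ?coshw_abs// mulr_ge0// exprn_ge0.
apply: le_trans h _; rewrite expR_step// /coshw !mulr0 expR0 -sqr_step /d.
rewrite le_eqVlt; apply/orP; left; apply/eqP.
have -> : n%:R * (step n ^+ 4 * C * M) = step n ^+ 2 * C * M * (n%:R * step n
  ^+ 2) by ring.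
by rewrite mul_sqr_step//; ring.
Qed.

(** The derivatives of order [j <= 4] of [H 0 (c + x ^+ 2)] in [x]. *)
Definition parabola (H : nat -> R -> R) c (j : nat) x : R :=
  match j with
  | 0%N => H 0%N (c + x ^+ 2)
  | 1%N => 2 * x * H 1%N (c + x ^+ 2)
  | 2%N => 2 * H 1%N (c + x ^+ 2) + 4 * x ^+ 2 * H 2%N (c + x ^+ 2)
  | 3%N => 12 * x * H 2%N (c + x ^+ 2) + 8 * x ^+ 3 * H 3%N (c + x ^+ 2)
  | _ => 12 * H 2%N (c + x ^+ 2) + 48 * x ^+ 2 * H 3%N (c + x ^+ 2)
         + 16 * x ^+ 4 * H 4%N (c + x ^+ 2)
  end.

(** The fourth derivative along the parabola is at most quartic in [x],
    uniformly in [H] and in [c], hence dominated by the exponential. *)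
Lemma coin_walk_tame : exists2 C : R, 0 <= C & forall (H : nat -> R -> R) c n,
  tame H -> 0 <= c -> (0 < n)%N ->
  `|iter n (coin (step n)) (fun x => H 0%N (c + x ^+ 2)) 0
    - gauss (fun x => H 0%N (c + x ^+ 2))| <= C / n%:R.
Proof.
(* The fourth derivative is at most 12 + 48 x^2 + 16 x^4 <= 60 + 64 x^4, and
   x^4 <= 256 e^|x|. *)
pose C : R := 60 + 64 * 256; have C0 : 0 <= C by rewrite addr_ge0.
exists (C * (256 * (2 * expR ((1 + 1) ^+ 2 / 2)) + expR 1) * (expR (expR 1) * 2)).
  by rewrite mulr_ge0// ?mulr_ge0// ?expR_ge0// addr_ge0 ?expR_ge0// !mulr_ge0
    ?expR_ge0.
move=> H c n tH c0 n0; have [H0 dH bH] := tH.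
have cx (x : R) : 0 <= c + x ^+ 2 by rewrite addr_ge0 ?sqr_ge0.
have dc j (x : R) : (j < 6)%N ->
    is_derive x 1 (fun y => H j (c + y ^+ 2)) (H j.+1 (c + x ^+ 2) * (2 * x)).
  move=> j6; apply: (@is_derive1_comp _ (H j) (fun y => c + y ^+ 2)).
    exact: dH.
  apply: (is_derive_eq (is_derive_add (is_derive_cst c x 1) (is_derive_sqr x))).
  by rewrite add0r.
apply: (@coin_walk (parabola H c)) => //.
- split.
    apply: continuous_measurable_fun => x.
    apply: differentiable_continuous; apply/derivable1_diffP.
    by have := dc 0%N x isT; case.
  exists (c + 2), 1; split; rewrite ?addr_ge0// => x; rewrite mul1r /parabola.
  apply: le_trans (tame_derive0_bound tH (cx x)) _.
  have e2 := expR_ge1Dxn 1 (normr_ge0 x).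
  rewrite real_normK ?num_real// in e2.
  have e1 : 1 <= expR `|x| by rewrite -expR0 ler_expR.
  rewrite mulrDl lerD//; first by rewrite ler_peMr.
  by rewrite mulrC -ler_pdivrMr//; move: e2; rewrite /factorial/=; lra.
- move=> [|[|[|[|//]]]] x _; rewrite /parabola.
  + by apply: (is_derive_eq (dc 0%N x isT)); ring.
  + have d := is_derive_mul (is_derive_scale 2 (is_derive_id x 1)) (dc 1%N x isT).
    by apply: (is_derive_eq d); ring.
  + have d := is_derive_add (is_derive_scale 2 (dc 1%N x isT))
      (is_derive_mul (is_derive_scale 4 (is_derive_sqr x)) (dc 2%N x isT)).
    by apply: (is_derive_eq d); ring.
  + have d := is_derive_add (is_derive_mul (is_derive_scale 12 (is_derive_id x
      1)) (dc 2%N x isT))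
      (is_derive_mul (is_derive_scale 8 (is_derive_cube x)) (dc 3%N x isT)).
    by apply: (is_derive_eq d); ring.
- move=> x; rewrite /parabola.
  have b j : (0 < j <= 6)%N -> `|H j (c + x ^+ 2)| <= 1 by move=> j6; exact: bH.
  have x2 : 0 <= x ^+ 2 by exact: sqr_ge0.
  have x4 : 0 <= x ^+ 4 by rewrite exprn_even_ge0.
  have e1 : 1 <= expR `|x| by rewrite -expR0 ler_expR.
  apply: (@le_trans _ _ (12 + 48 * x ^+ 2 + 16 * x ^+ 4)).
    have nb (a h : R) : 0 <= a -> `|h| <= 1 -> `|a * h| <= a.
      by move=> a0 h1; rewrite normrM ger0_norm// ler_piMr.
    rewrite (le_trans (ler_normD _ _))// lerD//; last first.
      by apply: nb; rewrite ?b// mulr_ge0.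
    rewrite (le_trans (ler_normD _ _))// lerD// nb ?b// mulr_ge0//.
  have := expr4_le x; have : x ^+ 2 <= 1 + x ^+ 4.
    have -> : x ^+ 4 = (x ^+ 2) ^+ 2 by ring.
    by have := sqr_ge0 (x ^+ 2 - 1); nra.
  by rewrite /C; lra.
Qed.

End CoinWalk.

(** * Integrals against the chi-square law *)

Section ChiSquareLaw.
Context {R : realType}.
Local Notation mR := (measurableTypeR R).
Local Notation nu := (normal_prob (0 : R) 1).
Local Notation chi := (@chi_square R).
Implicit Types (f g : mR -> R) (x y z q s t a C c : R).

Lemma chi_square_neg m : chi m `]-oo, 0[%classic = 0%E.
Proof.
elim: m => [|m IH] /=.
  by rewrite /dirac indicE memNset// /= in_itv/= ltxx.
rewrite /distribution /pushforward/=.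
have mN : measurable (`]-oo, (0 : R)[%classic : set mR) by exact: measurable_itv.
apply/eqP; rewrite eq_le measure_ge0 andbT.
apply: (@le_trans _ _ ((nu \x chi m)%E (setT `*` `]-oo, 0[%classic))).
  apply: le_measure; rewrite ?inE.
  - by rewrite -[X in measurable X]setTI; exact: measurable_sqr_add.
  - exact: measurableX.
  - move=> [z y] /=; rewrite /sqr_add !in_itv/= => h; split => //.
    by apply: le_lt_trans h; rewrite lerDr sqr_ge0.
by rewrite product_measure1E//= (_ : chi_square _ _ = 0%E) ?mule0.
Qed.

Lemma chi_square_restrict m (f : mR -> \bar R) :
  (chi m).-integrable setT f ->
  (\int[chi m]_y f y = \int[chi m]_(y in `[0%R, +oo[) f y)%E.
Proof.
move=> intf; have mN : measurable (`]-oo, (0 : R)[%classic : set mR) by exact: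
  measurable_itv.
rewrite (@negligible_integral _ _ _ _ _ _ _ mN measurableT intf (chi_square_neg m)).
by congr integral; rewrite setTD setCitvl.
Qed.

Lemma integral_chi_square_succ m (f : mR -> \bar R) :
  measurable_fun setT f -> (forall x, (0 <= f x)%E) ->
  (\int[chi m.+1]_x f x = \int[nu]_z \int[chi m]_y f (z ^+ 2 + y)%R)%E.
Proof.
move=> mf f0 /=; rewrite ge0_integral_distribution//.
rewrite (@fubini_tonelli1 _ _ _ _ _ nu (chi m))//; last by move=> x; exact: f0.
by apply: measurableT_comp => //; exact: measurable_sqr_add.
Qed.

Lemma chi_square_moment m : (\int[chi m]_y `|y|%:E < +oo)%E.
Proof.
have mabs : measurable_fun [set: mR] (fun y : mR => `|y|%:E).
  by apply/measurable_EFinP; exact: normr_measurable.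
elim: m => [|m IH].
  by rewrite /= integral_dirac// normr0 diracT mul1e ltry.
rewrite integral_chi_square_succ//.
have h z : (\int[chi m]_y `|z ^+ 2 + y|%:E <= (z ^+ 2)%:E + \int[chi m]_y `|y|%:E)%E.
  apply: (@le_trans _ _ (\int[chi m]_y ((z ^+ 2)%:E + `|y|%:E))%E).
    apply: ge0_le_integral => //.
    - apply/measurable_EFinP; apply: measurableT_comp => //; exact: measurable_funD.
    - by apply/measurable_EFinP; apply: measurable_funD => //; exact: measurableT_comp.
    - move=> y _; rewrite -EFinD lee_fin (le_trans (ler_normD _ _))//.
      by rewrite ger0_norm ?sqr_ge0.
  rewrite ge0_integralD//; last by move=> y _; rewrite lee_fin sqr_ge0.
  by rewrite integral_cst//= probability_setT mule1.
have m2 : measurable_fun [set: mR] (fun z : mR => (z ^+ 2)%:E).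
  by apply/measurable_EFinP; exact: measurable_funX.
apply: (@le_lt_trans _ _ (\int[nu]_z ((z ^+ 2)%:E + \int[chi m]_y `|y|%:E))%E).
  apply: ge0_le_integral => //.
  - by move=> z _; apply: integral_ge0.
  - have mF : measurable_fun setT (fun zy : mR * mR => `|zy.1 ^+ 2 + zy.2|%:E).
      by apply/measurable_EFinP; apply: measurableT_comp => //;
        exact: measurable_sqr_add.
    by apply: (@measurable_fun_fubini_tonelli_F _ _ mR mR R (chi m) _ mF).
  - by apply: emeasurable_funD => //; exact: measurable_cst.
rewrite ge0_integralD//; last 2 first.
- by move=> z _; rewrite lee_fin sqr_ge0.
- by move=> z _; apply: integral_ge0.
rewrite integral_cst//= probability_setT mule1 lte_add_pinfty//.
by rewrite -(EFin_gauss (growing_expr 2)) ltry.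
Qed.

Definition linear_growth f : Prop :=
  measurable_fun setT f /\ exists C : R, forall y, `|f y| <= C + `|y|.

Lemma chi_square_integrable m f : linear_growth f ->
  (chi m).-integrable setT (EFin \o f).
Proof.
move=> [mf [C fC]].
have mabs : measurable_fun [set: mR] (fun y : mR => `|y|%:E).
  by apply/measurable_EFinP; exact: normr_measurable.
have intg : (chi m).-integrable setT (fun y : mR => (`|C|%:E + `|y|%:E)%E).
  apply: integrableD => //.
    apply/integrableP; split => //=; rewrite integral_cst//= probability_setT.
    by rewrite mule1 ltry.
  apply/integrableP; split => //.
  under eq_integral do rewrite /= normr_id.
  exact: chi_square_moment.
apply: le_integrable intg => //; first exact/measurable_EFinP.
move=> y _ /=; rewrite lee_fin (le_trans (fC y))// [leRHS]ger0_norm ?addr_ge0//.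
by rewrite lerD2r ler_norm.
Qed.

Lemma linear_growth_shift f c : linear_growth f ->
  linear_growth (fun y => f (c + y)).
Proof.
move=> [mf [C fC]]; split.
  by apply: measurableT_comp => //; exact: measurable_funD.
exists (C + `|c|) => y; apply: le_trans (fC _) _.
by rewrite -addrA lerD2l ler_normD.
Qed.

Lemma growing_linear_growth f c : linear_growth f ->
  growing (fun z => f (c + z ^+ 2)).
Proof.
move=> [mf [C fC]].
apply: (@growing_le _ _ (fun z => (`|C| + `|c|) + z ^+ 2)).
- by apply: measurableT_comp => //; apply: measurable_funD => //;
    exact: measurable_funX.
- by apply: growingD; [exact: growing_cst|exact: growing_expr].
- move=> z; rewrite (le_trans (fC _))// [leRHS]ger0_norm ?addr_ge0 ?sqr_ge0//.
  rewrite -addrA lerD ?ler_norm// (le_trans (ler_normD _ _))//.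
  by rewrite [`|z ^+ 2|]ger0_norm ?sqr_ge0.
Qed.

(** The shift [c] stands for the squares of the coordinates that are not part
    of the chi-square variable. *)
Definition chi_mean m f c : R := \int[chi m]_y f (c + y).

Let integrable_prod m f c : linear_growth f ->
  (nu \x chi m)%E.-integrable setT
    (fun zy : mR * mR => (f (c + (zy.1 ^+ 2 + zy.2)))%:E).
Proof.
move=> lf; have lfc := linear_growth_shift c lf; have [mf _] := lfc.
have [mi fin] := integrableP _ _ _ (chi_square_integrable m.+1 lfc).
apply/integrableP; split.
  apply: (measurableT_comp (f := fun x : mR => (f (c + x))%:E)) => //.
  exact: measurable_sqr_add.
move: fin; rewrite /= ge0_integral_distribution//.
by apply/measurable_EFinP; exact: measurableT_comp.
Qed.

Let fubini_gauss f c y : linear_growth f ->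
  fubini_G nu (fun zy : mR * mR => (f (c + (zy.1 ^+ 2 + zy.2)))%:E) y
  = (gauss (fun z => f (c + y + z ^+ 2)))%:E.
Proof.
move=> lf; rewrite /fubini_G EFin_gauss; last exact: growing_linear_growth.
apply: eq_integral => z _; rewrite /=; congr ((f _)%:E).
by rewrite -[RHS]addrA [y + _]addrC.
Qed.

Lemma integrable_gauss_sqr m f c : linear_growth f ->
  (chi m).-integrable setT (EFin \o (fun y => gauss (fun z => f (c + y + z ^+ 2)))).
Proof.
move=> lf; have [mf _] := linear_growth_shift c lf.
have ip := integrable_prod m c lf.
have iF : (chi m \x nu)%E.-integrable setT
    (fun yz : mR * mR => (f (c + (yz.2 ^+ 2 + yz.1)))%:E).
  apply/integrable12ltyP.
    apply/measurable_EFinP.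
    apply: (measurableT_comp (f := fun x : mR => f (c + x))) => //.
    by apply: measurable_funD => //; exact: measurable_funX.
  have mi := measurable_int _ ip.
  exact: (iffLR (integrable21ltyP _ _ mi) ip).
apply: eq_integrable (integrable_fubini_F iF) => // y _.
by rewrite /= -(fubini_gauss c y lf).
Qed.

(** Fubini, in the order that integrates the new Gaussian coordinate first. *)
Lemma chi_mean_succ m f c : linear_growth f ->
  chi_mean m.+1 f c = \int[chi m]_y gauss (fun z => f (c + y + z ^+ 2)).
Proof.
move=> lf; have [mf _] := linear_growth_shift c lf.
rewrite /chi_mean /Rintegral /=.
rewrite (integral_distribution (X := @sqr_add R)) //.
- rewrite (_ : (\int[_]_x _)%E = \int[nu \x chi m]_zy
    (f (c + (zy.1 ^+ 2 + zy.2)))%:E)%E//.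
  rewrite -(integral21_prod_meas1 (integrable_prod m c lf)); congr fine.
  by apply: eq_integral => y _; rewrite fubini_gauss.
- exact/measurable_EFinP.
- exact: integrable_prod.
Qed.

End ChiSquareLaw.

(** * From coin walks to the chi-square law *)

Section AxesToChiSquare.
Context {R : realType}.
Local Notation mR := (measurableTypeR R).
Local Notation chi := (@chi_square R).
Implicit Types (f g : mR -> R) (x y z s t a C c : R).

Lemma iter_coin_integral m (F : R -> mR -> R) e n x :
  (forall x, (chi m).-integrable setT (EFin \o F x)) ->
  iter n (coin e) (fun x => \int[chi m]_y F x y) x
    = \int[chi m]_y iter n (coin e) (F^~ y) x
  /\ (chi m).-integrable setT (EFin \o (fun y => iter n (coin e) (F^~ y) x)).
Proof.
move=> iF; elim: n x => [|n IH] x; first by split=> //; exact: iF.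
have [E1 i1] := IH (x + e); have [E2 i2] := IH (x - e).
have i12 : (chi m).-integrable setT (EFin \o (fun y =>
    iter n (coin e) (F^~ y) (x + e) + iter n (coin e) (F^~ y) (x - e))).
  by apply: (@eq_integrable _ _ _ (chi m) setT _ _ _ _ (integrableD _ i1 i2)).
split; last first.
  have := integrableZl measurableT 2^-1 i12.
  by apply: eq_integrable => // y _; rewrite -EFinM.
rewrite iterS {1}/coin E1 E2 -RintegralD// -RintegralZl//.
Qed.

(** The argument is clamped to the half-line, where [h] is controlled, so
    that the function is measurable on the whole line. *)
Definition half_line (h : R -> R) : mR -> R := fun x => h (Num.max x 0).

Lemma linear_growth_tame (H : nat -> R -> R) : tame H ->
  linear_growth (half_line (H 0%N)).
Proof.
move=> tH; have [_ dH _] := tH; split.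
  apply: continuous_measurable_fun => x.
  apply: (@continuous_comp R R R (fun x => Num.max x 0) (H 0%N)).
    by apply: continuous_max; [exact: cvg_id|exact: cvg_cst].
  apply: differentiable_continuous; apply/derivable1_diffP.
  have h0 : 0 <= Num.max x 0 by rewrite le_max lexx orbT.
  by have := dH 0%N _ isT h0; case.
exists 0 => x; rewrite add0r /half_line.
have h0 : 0 <= Num.max x 0 by rewrite le_max lexx orbT.
apply: le_trans (tame_derive0_bound tH h0) _.
by rewrite ge_max normr_ge0 ler_norm.
Qed.

Lemma half_lineE (h : R -> R) x : 0 <= x -> half_line h x = h x.
Proof. by move=> x0; rewrite /half_line max_l. Qed.

Lemma eq_iter_coin e n (f g : R -> R) : f =1 g ->
  iter n (coin e) f =1 iter n (coin e) g.
Proof. by move=> fg; elim: n => //= n IH x; rewrite /coin !IH. Qed.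

(** The walk along one more axis is averaged over the chi-square variable of
    the other coordinates; the one-dimensional rate is uniform in the value
    of that variable, so it survives the averaging. *)
Lemma coin_walk_chi_mean : exists2 C : R, 0 <= C & forall (H : nat -> R -> R) m c n,
  tame H -> 0 <= c -> (0 < n)%N ->
  `|iter n (coin (step n)) (fun x => chi_mean m (half_line (H 0%N)) (c + x ^+ 2)) 0
    - chi_mean m.+1 (half_line (H 0%N)) c| <= C / n%:R.
Proof.
have [C C0 HC] := @coin_walk_tame R; exists C => // H m c n tH c0 n0.
have lf := linear_growth_tame tH; set f := half_line _ in lf *.
have iF x : (chi m).-integrable setT (EFin \o (fun y => f (c + x ^+ 2 + y))).
  exact/chi_square_integrable/linear_growth_shift.
rewrite chi_mean_succ// /chi_mean.
have [E iE] := iter_coin_integral (step n) n 0 iF; rewrite E.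
have ig := integrable_gauss_sqr m c lf.
rewrite -RintegralB//.
set D := (fun y : mR => _ - _).
have iD : (chi m).-integrable setT (EFin \o D).
  by have := integrableB measurableT iE ig; apply: eq_integrable.
rewrite /Rintegral chi_square_restrict// -/(Rintegral _ _ _).
have mI : measurable (`[(0 : R), +oo[%classic : set mR) by exact: measurable_itv.
have iD' : (chi m).-integrable (`[0, +oo[%classic : set mR) (EFin \o D).
  exact: integrableS iD.
apply: le_trans (le_normr_Rintegral mI iD') _.
have Cn : 0 <= C / n%:R by rewrite divr_ge0.
apply: (@le_trans _ _ (\int[chi m]_(y in (`[0, +oo[%classic : set mR)) (C / n%:R))).
  apply: le_Rintegral => //.
  - by have := integrable_norm iD'; apply: eq_integrable.
  - apply: (integrableS measurableT mI (@subsetT _ _)).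
    exact: finite_measure_integrable_cst.
  move=> y; rewrite /= in_itv/= andbT => y0; rewrite /D.
  have cy : 0 <= c + y by rewrite addr_ge0.
  have hE x : f (c + y + x ^+ 2) = H 0%N (c + y + x ^+ 2).
    by rewrite /f half_lineE// addr_ge0// sqr_ge0.
  rewrite (eq_iter_coin _ _ (g := fun x => H 0%N (c + y + x ^+ 2))); last first.
    by move=> x; rewrite addrAC hE.
  rewrite (_ : (fun z => f (c + y + z ^+ 2)) = fun x => H 0%N (c + y + x ^+ 2)).
    exact: HC.
  by apply/funext => z; exact: hE.
rewrite Rintegral_cst// ler_piMr//.
rewrite -lee_fin fineK ?fin_num_measure//; exact: probability_le1.
Qed.

Section Vectors.
Context {k : nat}.
Local Notation V := 'rV[R]_k.

Lemma sqnorm_axis (v : V) j x : v 0 j = 0 ->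
  sqnorm (v + x *: delta_mx 0 j) = sqnorm v + x ^+ 2.
Proof.
move=> vj; rewrite /sqnorm (bigD1 j)//= [in RHS](bigD1 j)//= !mxE !eqxx/= vj.
rewrite expr0n/= !add0r mulr1 addrC; congr (_ + _); apply: eq_bigr => i ij.
by rewrite !mxE eqxx/= (negbTE ij) mulr0 addr0.
Qed.

Lemma iter_axis_coin (phi : R -> R) (v : V) j e n x : v 0 j = 0 ->
  iter n (axis_step j e) (fun w => phi (sqnorm w)) (v + x *: delta_mx 0 j)
  = iter n (coin e) (fun y => phi (sqnorm v + y ^+ 2)) x.
Proof.
move=> vj; elim: n x => [|n IH] x /=; first by rewrite sqnorm_axis.
by rewrite /axis_step /coin -!IH -!addrA -scalerDl -scalerBl.
Qed.

Lemma iter_axis_le j e n (S : V -> Prop) (F G : V -> R) (d : R) :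
  (forall w x, S w -> S (w + x *: delta_mx 0 j)) ->
  (forall w, S w -> `|F w - G w| <= d) ->
  forall w, S w -> `|iter n (axis_step j e) F w - iter n (axis_step j e) G w| <= d.
Proof.
move=> SS FG; elim: n => //= n IH w Sw.
rewrite /axis_step.
set a := iter n _ F _; set b := iter n _ F _.
set a' := iter n _ G _; set b' := iter n _ G _.
have -> : 2^-1 * (a + b) - 2^-1 * (a' + b') = 2^-1 * ((a - a') + (b - b')) by ring.
rewrite normrM ger0_norm ?invr_ge0// ler_pdivrMl// mulr_natl mulr2n.
rewrite (le_trans (ler_normD _ _))// lerD//; apply: IH; first exact: SS.
by rewrite -scaleNr; exact: SS.
Qed.

(** Steps along different axes commute, so the walks along the axes can be
    performed one after the other. *)
Lemma iter_axes_step (s : seq 'I_k) e n (f : V -> R) :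
  iter n (axes_step s e) f = foldr (fun j => iter n (axis_step j e)) f s.
Proof.
elim: s f => [|j s IH] f /=; first by elim: n => //= n ->.
have [_ AC _] := axes_step_properties s e.
rewrite -{}IH; elim: n => //= n IHn.
have comm m (g : V -> R) : axes_step s e (iter m (axis_step j e) g)
    = iter m (axis_step j e) (axes_step s e g).
  by elim: m => //= m <-; rewrite axis_step_convolve AC.
by rewrite [axes_step (j :: s) e]/axes_step /= -/(axes_step s e _) IHn comm.
Qed.

(** Induction on the set of axes: the coordinates already replaced by
    Gaussians enter only through their squared norm, a chi-square variable,
    and the other coordinates are those of the starting point. *)
Lemma axes_walk_chi_square : exists2 C : R, 0 <= C &
  forall (H : nat -> R -> R) n, tame H -> (0 < n)%N ->
  `|iter n (axes_step (enum 'I_k) (step n)) (fun v : V => H 0%N (sqnorm v)) 0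
    - chi_mean k (half_line (H 0%N)) 0| <= C / n%:R.
Proof.
have [C C0 HC] := coin_walk_chi_mean.
exists (k%:R * C) => [|H n tH n0]; first by rewrite mulr_ge0.
set f := half_line _.
suff key (s : seq 'I_k) (v : V) : uniq s -> (forall j, j \in s -> v 0 j = 0) ->
    `|foldr (fun j => iter n (axis_step j (step n))) (fun v : V => H 0%N (sqnorm v)) s v
      - chi_mean (size s) f (sqnorm v)| <= (size s)%:R * (C / n%:R).
  have := key (enum 'I_k) 0 (enum_uniq _) (fun j _ => mxE _ _ _ _).
  rewrite iter_axes_step size_enum_ord mulrA.
  suff -> : sqnorm (0 : V) = 0 by [].
  by rewrite /sqnorm big1// => j _; rewrite mxE expr0n.
elim: s v => [|j s IH] v /=.
  rewrite mul0r /chi_mean /= /Rintegral integral_dirac//; last first.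
    apply/measurable_EFinP; apply: measurableT_comp; last exact: measurable_funD.
    by case: (linear_growth_tame tH).
  by rewrite diracT mul1e /= addr0 /f half_lineE ?sqnorm_ge0// subrr normr0.
move=> /andP[js us] vs.
pose S (w : V) := forall i, i \in s -> w 0 i = 0.
have SS w x : S w -> S (w + x *: delta_mx 0 j).
  move=> Sw i si; rewrite !mxE eqxx/= Sw// add0r.
  by have [ij|] := eqVneq i j; rewrite ?mulr0//; move: js; rewrite -ij si.
have Sv : S v by move=> i si; rewrite vs// inE si orbT.
have h1 := iter_axis_le (step n) n SS (fun w => IH w us) Sv.
have vj : v 0 j = 0 by rewrite vs// inE eqxx.
have h2 := HC H (size s) (sqnorm v) n tH (sqnorm_ge0 v) n0.
rewrite -/f -(iter_axis_coin _ _ _ _ vj) scale0r addr0 in h2.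
rewrite -(subrKA (iter n (axis_step j (step n)) (fun w => chi_mean (size s) f
  (sqnorm w)) v)).
rewrite (le_trans (ler_normD _ _))// -natr1 mulrDl mul1r lerD//.
Qed.

End Vectors.
End AxesToChiSquare.

(** * Taylor expansion of real powers *)

Section PowerExpansion.
Context {R : realType}.
Implicit Types (a b x y z K : R).

(** Young's inequality between [z] and 1, with exponents [a] and its
    conjugate. *)
Lemma powR_bernoulli a z : 1 < a -> 0 <= z -> 1 + a * (z - 1) <= z `^ a.
Proof.
move=> a1 z0; have a0 : 0 < a by rewrite (lt_trans _ a1).
have a10 : 0 < a - 1 by rewrite subr_gt0.
have q0 : 0 < a / (a - 1) by rewrite divr_gt0.
have := @conjugate_powR R z 1 a (a / (a - 1)) z0 ler01 a0 q0.
have -> : a^-1 + (a / (a - 1))^-1 = 1 by field; rewrite !gt_eqF.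
move=> /(_ erefl); rewrite mulr1 powR1 => h.
have : a * z <= a * (z `^ a / a + 1 / (a / (a - 1))) by rewrite ler_pM2l.
have -> : a * (z `^ a / a + 1 / (a / (a - 1))) = z `^ a + (a - 1).
  by field; rewrite !gt_eqF.
lra.
Qed.

Lemma powR_bounded b K z : 0 <= K -> 2^-1 <= z <= 1 + K ->
  z `^ b <= expR (`|b| * (ln 2 + ln (1 + K))).
Proof.
move=> K0 /andP[z1 z2]; have z0 : 0 < z by rewrite (lt_le_trans _ z1)// invr_gt0.
rewrite /powR gt_eqF// ler_expR (le_trans (ler_norm _))// normrM ler_wpM2l//.
have l2 : 0 <= ln (2 : R) by rewrite ln_ge0// ler1n.
have lK : 0 <= ln (1 + K) by rewrite ln_ge0// lerDl.
have h1 : ln z <= ln (1 + K) by rewrite ler_ln ?posrE// (lt_le_trans z0).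
have h2 : - ln 2 <= ln z by rewrite -lnV ?posrE// ler_ln ?posrE ?invr_gt0.
by rewrite ler_norml; apply/andP; split; lra.
Qed.

Definition falling3 a : R := a * (a - 1) * (a - 2).

Definition powR_remainder a x : R :=
  (1 + x) `^ a - 1 - a * x - a * (a - 1) / 2 * x ^+ 2 - falling3 a / 6 * x ^+ 3.

(** Taylor's formula on both sides of 1, away from the singularity at 0; [sg]
    is the sign of the increment. *)
Lemma powR_taylor_away a K sg : 0 <= K -> sg ^+ 2 = 1 ->
  exists2 C : R, 0 <= C & forall Y, 0 <= Y ->
   (forall y, 0 <= y <= Y -> 2^-1 <= 1 + sg * y <= 1 + K) ->
    `|powR_remainder a (sg * Y)| <= C * Y ^+ 4.
Proof.
move=> K0 sg2.
pose C : R := `|falling3 a * (a - 3)| * expR (`|a - 4| * (ln 2 + ln (1 + K))).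
exists C => [|Y Y0 inK]; first by rewrite mulr_ge0// expR_ge0.
have dp b y : 0 <= y <= Y -> is_derive y 1 (fun z => (1 + sg * z) `^ b)
    (b * (1 + sg * y) `^ (b - 1) * sg).
  move=> /inK/andP[h _].
  apply: (@is_derive1_comp _ (fun z => z `^ b) (fun z => 1 + sg * z)).
    by apply: is_derive1_powR; rewrite (lt_le_trans _ h)// invr_gt0.
  by have := is_derive_affine 1 sg y; under eq_fun do rewrite mulrC.
pose u (j : nat) y : R := match j with
  | 0%N => (1 + sg * y) `^ a - 1 - (a * sg) * y - (a * (a - 1) / 2) * y ^+ 2
         - (falling3 a / 6 * sg) * y ^+ 3
  | 1%N => (a * sg) * (1 + sg * y) `^ (a - 1) - a * sg - (a * (a - 1)) * y
         - (falling3 a / 2 * sg) * y ^+ 2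
  | 2%N => (a * (a - 1)) * (1 + sg * y) `^ (a - 2) - a * (a - 1) - (falling3 a * sg) * y
  | 3%N => (falling3 a * sg) * (1 + sg * y) `^ (a - 3) - falling3 a * sg
  | _ => (falling3 a * (a - 3)) * (1 + sg * y) `^ (a - 4) end.
have sub1 (m : R) : a - m - 1 = a - (m + 1) by rewrite opprD addrA.
have e23 : (1 : R) + 1 = 2 by [].
have e3 : (2 : R) + 1 = 3 by ring.
have e4 : (3 : R) + 1 = 4 by ring.
have D := is_derive_sub; have Z := is_derive_scale;
  have Id (y : R) : is_derive y 1 (fun z : R => z) 1 := is_derive_id y 1.
have Cs (c y : R) : is_derive y 1 (fun=> c) 0 := is_derive_cst c y 1.
have E : powR_remainder a (sg * Y) = u 0%N Y.
  rewrite /powR_remainder /u exprMn sg2 exprMn.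
  have -> : sg ^+ 3 = sg by rewrite exprS sg2 mulr1.
  by ring.
rewrite E; apply: (@taylor_zero _ 4 u Y C Y0) => //; last by rewrite Y0 lexx.
- move=> [|[|[|[|//]]]] y _ yY; rewrite /u.
  + apply: (is_derive_eq (D _ _ _ _ _ _ (D _ _ _ _ _ _ (D _ _ _ _ _ _ (D _ _ _
      _ _ _ (dp a y yY) (Cs 1 y))
      (Z _ _ _ _ _ (Id y))) (Z _ _ _ _ _ (is_derive_sqr y))) (Z _ _ _ _ _
        (is_derive_cube y)))).
    by field.
  + apply: (is_derive_eq (D _ _ _ _ _ _ (D _ _ _ _ _ _ (D _ _ _ _ _ _ (Z _ _ _
      _ _ (dp (a - 1) y yY)) (Cs (a * sg) y))
      (Z _ _ _ _ _ (Id y))) (Z _ _ _ _ _ (is_derive_sqr y)))).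
    rewrite sub1 e23.
    transitivity (a * (a - 1) * (1 + sg * y) `^ (a - 2) * sg ^+ 2 - a * (a -
      1) - falling3 a * sg * y).
      by field.
    by rewrite sg2 mulr1.
  + apply: (is_derive_eq (D _ _ _ _ _ _ (D _ _ _ _ _ _ (Z _ _ _ _ _ (dp (a -
      2) y yY)) (Cs (a * (a - 1)) y))
      (Z _ _ _ _ _ (Id y)))).
    by rewrite sub1 e3 /falling3; ring.
  + apply: (is_derive_eq (D _ _ _ _ _ _ (Z _ _ _ _ _ (dp (a - 3) y yY)) (Cs
      (falling3 a * sg) y))).
    rewrite sub1 e4 subr0.
    transitivity (falling3 a * (a - 3) * (1 + sg * y) `^ (a - 4) * sg ^+ 2);
      first by ring.
    by rewrite sg2 mulr1.
- by move=> [|[|[|[|//]]]] _; rewrite /u !(mulr0, addr0, powR1, expr0n)/=; ring.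
- move=> y yY; rewrite /u normrM ler_wpM2l// ger0_norm ?powR_ge0//.
  by apply: powR_bounded => //; exact: inK.
Qed.

(** The powers need not be smooth at the end point [x = -1]; but below [- 2^-1]
    the factor [x ^+ 4] is bounded away from 0, and a crude bound is enough. *)
Lemma powR_taylor a K : 0 < a -> 0 <= K -> exists2 C : R, 0 <= C &
  forall x, -1 <= x <= K -> `|powR_remainder a x| <= C * x ^+ 4.
Proof.
move=> a0 K0.
have [C1 C10 H1] := @powR_taylor_away a K 1 K0 (expr1n _ _).
have [C2 C20 H2] := @powR_taylor_away a K (-1) K0 (etrans (sqrrN 1) (expr1n _ 2)).
pose D : R := 1 + 1 + a + `|a * (a - 1) / 2| + `|falling3 a / 6|.
have D0 : 0 <= D by rewrite !addr_ge0// ltW.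
have D16 : 0 <= 16 * D by rewrite mulr_ge0.
exists (C1 + C2 + 16 * D) => [|x /andP[x1 xK]]; first by rewrite !addr_ge0// mulr_ge0.
have x4 : 0 <= x ^+ 4 by rewrite exprn_even_ge0.
have [x0|x0] := leP 0 x.
  rewrite !mulrDl; apply: (@le_trans _ _ (C1 * x ^+ 4)).
    rewrite -[x in powR_remainder _ x]mul1r; apply: H1 => // y /andP[y0 yx].
    rewrite mul1r lerD2l (le_trans yx xK) andbT.
    by lra.
  have := mulr_ge0 C20 x4; have := mulr_ge0 D16 x4; lra.
have [xh|xh] := leP (- 2^-1) x.
  rewrite !mulrDl; apply: (@le_trans _ _ (C2 * x ^+ 4)).
    have -> : x ^+ 4 = (- x) ^+ 4 by ring.
    rewrite -[x in powR_remainder _ x]opprK -[- - x]mulN1r.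
    apply: H2 => [|y /andP[y0 yx]]; first by rewrite oppr_ge0 ltW.
    by apply/andP; split; lra.
  have := mulr_ge0 C10 x4; have := mulr_ge0 D16 x4; lra.
have x416 : 1 <= 16 * x ^+ 4.
  have h : 2^-1 <= - x by lra.
  have : (2^-1 : R) ^+ 4 <= (- x) ^+ 4 by rewrite lerXn2r ?nnegrE//
    ?invr_ge0// oppr_ge0 ltW.
  have -> : (- x) ^+ 4 = x ^+ 4 by ring.
  have -> : (2^-1 : R) ^+ 4 = 16^-1 by field.
  by lra.
apply: (@le_trans _ _ D).
  have nx : `|x| <= 1 by rewrite ler_norml; apply/andP; split; lra.
  have p1 : `|(1 + x) `^ a| <= 1.
    rewrite ger0_norm ?powR_ge0//.
    have := @ge0_ler_powR R a (ltW a0) (1 + x) 1.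
    by rewrite !nnegrE powR1; apply; lra.
  rewrite /powR_remainder /D.
  have n n' c : `|c * x ^+ n'| <= `|c|.
    by rewrite normrM normrX ler_piMr// exprn_ile1.
  apply: le_trans (ler_normB _ _) (lerD _ (n 3%N _)).
  apply: le_trans (ler_normB _ _) (lerD _ (n 2%N _)).
  apply: le_trans (ler_normB _ _) (lerD _ _); last first.
    by have := n 1%N a; rewrite expr1 [`|a|]ger0_norm// ltW.
  by apply: le_trans (ler_normB _ _) (lerD _ _); rewrite ?normr1.
apply: (@le_trans _ _ (16 * D * x ^+ 4)).
  by rewrite mulrAC ler_peMl.
by rewrite ler_wpM2r// lerDr addr_ge0.
Qed.

End PowerExpansion.

(** * Quadratic and cubic terms of the divergence *)

Section PointwiseExpansion.
Context {R : realType}.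
Implicit Types (x y z K : R).

Lemma tame_taylor2 (H : nat -> R -> R) x y : tame H -> 0 <= x -> 0 <= y ->
  `|H 0%N y - H 0%N x - H 1%N x * (y - x)| <= (y - x) ^+ 2.
Proof.
move=> [H0 dH bH] x0 y0; set D := y - x.
have pos (t : R) : 0 <= t <= 1 -> 0 <= x + t * D.
  move=> /andP[t0 t1]; have -> : x + t * D = (1 - t) * x + t * y by rewrite /D; ring.
  by rewrite addr_ge0// mulr_ge0// subr_ge0.
have dc j (t : R) : (j < 6)%N -> 0 <= t <= 1 ->
    is_derive t 1 (fun s => H j (x + s * D)) (H j.+1 (x + t * D) * D).
  move=> j6 t01; apply: (@is_derive1_comp _ (H j) (fun s => x + s * D)).
    by apply: dH => //; exact: pos.
  exact: is_derive_affine.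
pose u (j : nat) t : R := match j with
  | 0%N => H 0%N (x + t * D) - H 0%N x - (D * H 1%N x) * t
  | 1%N => D * H 1%N (x + t * D) - D * H 1%N x
  | _ => D ^+ 2 * H 2%N (x + t * D) end.
have Cs (c t : R) : is_derive t 1 (fun=> c) 0 := is_derive_cst c t 1.
have Id (t : R) : is_derive t 1 (fun z : R => z) 1 := is_derive_id t 1.
have du j (t : R) : (j < 2)%N -> 0 <= t <= 1 -> is_derive t 1 (u j) (u j.+1 t).
  move: j => [|[|//]] _ t01; rewrite /u.
    by apply: (is_derive_eq (is_derive_sub (is_derive_sub (dc 0%N t isT t01)
      (Cs (H 0%N x) t)) (is_derive_scale (D * H 1%N x) (Id t)))); ring.
  by apply: (is_derive_eq (is_derive_sub (is_derive_scale D (dc 1%N t isT t01))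
    (Cs (D * H 1%N x) t))); ring.
have u0 j : (j < 2)%N -> u j 0 = 0.
  by move: j => [|[|//]] _; rewrite /u !(mul0r, mulr0, addr0); ring.
have uB (t : R) : 0 <= t <= 1 -> `|u 2%N t| <= D ^+ 2.
  move=> t01; rewrite /u normrM ger0_norm ?sqr_ge0// ler_piMr ?sqr_ge0//.
  by apply: bH => //; exact: pos.
have := taylor_zero ler01 du u0 uB (y := 1); rewrite ler01 lexx => /(_ isT).
rewrite expr1n mulr1; congr (`| _ | <= _).
by rewrite /u mul1r mulr1 /D (_ : x + (y - x) = y) ?[_ * H 1%N x]mulrC//; ring.
Qed.

Variables (r : nat) (p : 'I_r -> R) (lambda : R).
Hypotheses (p0 : forall j, 0 < p j) (p1 : \sum_j p j = 1) (l0 : 0 < lambda).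

Definition sum_pow (m : nat) (w : 'I_r -> R) : R := \sum_j w j ^+ m.

Definition cubic (w : 'I_r -> R) : R :=
  (lambda - 1) / 3 * \sum_j (Num.sqrt (p j))^-1 * w j ^+ 3.

Section AtSampleSize.
Variables (n : nat) (w : 'I_r -> R).
Hypotheses (n0 : (0 < n)%N) (w0 : \sum_j Num.sqrt (p j) * w j = 0).

Let T := power_divergence lambda n p w.
Let x_ j := w j / Num.sqrt (n%:R * p j).

Let nR : 0 < n%:R :> R. Proof. by rewrite ltr0n. Qed.
Let np0 j : 0 < n%:R * p j. Proof. by rewrite mulr_gt0. Qed.
Let sp0 j : 0 < Num.sqrt (p j). Proof. by rewrite sqrtr_gt0. Qed.
Let s0 : 0 < Num.sqrt (n%:R : R). Proof. by rewrite sqrtr_gt0. Qed.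
Let sqE j : Num.sqrt (n%:R * p j) = Num.sqrt n%:R * Num.sqrt (p j).
Proof. by rewrite sqrtrM. Qed.
Let npE j : n%:R * p j = (Num.sqrt n%:R * Num.sqrt (p j)) ^+ 2.
Proof. by rewrite -sqE sqr_sqrtr// ltW. Qed.

Let sum_np : \sum_j n%:R * p j = n%:R.
Proof. by rewrite -mulr_sumr p1 mulr1. Qed.

Let sum_lin : \sum_j n%:R * p j * x_ j = 0.
Proof.
transitivity (Num.sqrt n%:R * \sum_j Num.sqrt (p j) * w j); last by rewrite w0 mulr0.
rewrite mulr_sumr; apply: eq_bigr => j _.
by rewrite /x_ sqE npE; field; rewrite !gt_eqF.
Qed.

(** Convexity: each power lies above its tangent at 1, and the linear terms
    add up to 0 because [w] is orthogonal to the square roots of the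
    probabilities. *)
Lemma power_divergence_ge0 : (forall j, -1 <= x_ j) -> 0 <= T.
Proof.
move=> xm; apply: mulr_ge0.
  by rewrite divr_ge0// mulr_ge0 ?addr_ge0 ?(ltW l0).
have a1 : 1 < lambda + 1 by rewrite ltrDr.
rewrite subr_ge0; apply: (@le_trans _ _ (\sum_j n%:R * p j * (1 + (lambda + 1)
  * x_ j))).
  under eq_bigr do rewrite mulrDr mulr1 mulrCA.
  by rewrite big_split/= sum_np -mulr_sumr sum_lin mulr0 addr0.
apply: ler_sum => j _; rewrite ler_wpM2l ?(ltW (np0 j))//.
have := @powR_bernoulli R (lambda + 1) (1 + x_ j) a1.
have -> : 1 + x_ j - 1 = x_ j by ring.
by apply; rewrite -lerBlDl sub0r.
Qed.

(** Expanding the powers at 1 to the third order: the constant terms add up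
    to [n], the linear ones to 0, the quadratic ones are normalized to the
    sum of squares, and [1 / sqrt n] remains in front of the cubic ones. *)
Lemma power_divergence_expansion K C : 0 <= C ->
  (forall x, -1 <= x <= K -> `|powR_remainder (lambda + 1) x| <= C * x ^+ 4) ->
  (forall j, -1 <= x_ j <= K) ->
  `|T - sum_pow 2 w - step n * cubic w|
    <= 2 / (lambda * (lambda + 1)) * C * (\sum_j (p j)^-1) / n%:R * sum_pow 4 w.
Proof.
move=> C0 HC xK; set a := lambda + 1 in HC *.
have a0 : 0 < a by rewrite addr_gt0.
have l2 : 0 < 2 / (lambda * a) by rewrite divr_gt0// mulr_gt0.
have E : T - sum_pow 2 w - step n * cubic w =
    2 / (lambda * a) * \sum_j n%:R * p j * powR_remainder a (x_ j).
  have E1 : \sum_j n%:R * p j * (1 + x_ j) `^ a =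
      n%:R + a * (a - 1) / 2 * sum_pow 2 w
      + falling3 a / 6 * (step n * \sum_j (Num.sqrt (p j))^-1 * w j ^+ 3)
      + \sum_j n%:R * p j * powR_remainder a (x_ j).
    have Ej j : n%:R * p j * (1 + x_ j) `^ a = n%:R * p j + a * (n%:R * p j * x_ j)
        + a * (a - 1) / 2 * w j ^+ 2
        + falling3 a / 6 * (step n * ((Num.sqrt (p j))^-1 * w j ^+ 3))
        + n%:R * p j * powR_remainder a (x_ j).
      have h2 : n%:R * p j * x_ j ^+ 2 = w j ^+ 2.
        by rewrite /x_ sqE npE; field; rewrite !gt_eqF.
      have h3 : n%:R * p j * x_ j ^+ 3 = step n * ((Num.sqrt (p j))^-1 * w j ^+ 3).
        by rewrite /step /x_ sqE npE; field; rewrite !gt_eqF.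
      by rewrite /powR_remainder -h2 -h3; ring.
    have s1 : \sum_j a * (n%:R * p j * x_ j) = 0 by rewrite -mulr_sumr sum_lin mulr0.
    have s2 : \sum_j a * (a - 1) / 2 * w j ^+ 2 = a * (a - 1) / 2 * sum_pow 2 w.
      by rewrite -mulr_sumr.
    have s3 : \sum_j falling3 a / 6 * (step n * ((Num.sqrt (p j))^-1 * w j ^+ 3))
        = falling3 a / 6 * (step n * \sum_j (Num.sqrt (p j))^-1 * w j ^+ 3).
      by rewrite -mulr_sumr -mulr_sumr.
    by rewrite (eq_bigr _ (fun j _ => Ej j)) !big_split/= sum_np s1 s2 s3 addr0.
  rewrite /T /power_divergence -/a E1 /cubic /falling3.
  have -> : a - 1 = lambda by rewrite /a; ring.
  have -> : a - 2 = lambda - 1 by rewrite /a; ring.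
  by field; rewrite !gt_eqF.
rewrite E normrM [`|2 / _|]ger0_norm ?(ltW l2)//.
have -> : 2 / (lambda * a) * C * (\sum_j (p j)^-1) / n%:R * sum_pow 4 w =
  2 / (lambda * a) * (C * ((\sum_j (p j)^-1) * (n%:R^-1 * sum_pow 4 w))).
  by rewrite -!mulrA.
rewrite ler_wpM2l ?(ltW l2)//.
apply: le_trans (ler_norm_sum _ _ _) _; rewrite /sum_pow !mulr_sumr.
apply: ler_sum => j _; rewrite normrM ger0_norm ?(ltW (np0 j))//.
apply: (@le_trans _ _ (n%:R * p j * (C * x_ j ^+ 4))).
  by rewrite ler_wpM2l ?(ltW (np0 j))// HC.
have -> : n%:R * p j * (C * x_ j ^+ 4) = C * ((p j)^-1 * (n%:R^-1 * w j ^+ 4)).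
  have -> : (p j)^-1 * (n%:R^-1 * w j ^+ 4) = (n%:R * p j)^-1 * w j ^+ 4.
    by rewrite invfM [n%:R^-1 * (p j)^-1]mulrC mulrA.
  by rewrite /x_ sqE npE; field; rewrite !gt_eqF.
rewrite ler_wpM2l// ler_wpM2r//.
  by rewrite mulr_ge0 ?invr_ge0 ?(ltW nR)// exprn_even_ge0.
by rewrite (bigD1 j)//= lerDl sumr_ge0// => i _; rewrite invr_ge0 ltW.
Qed.

(** The difference between the statistic and its quadratic part is of order
    [step n], so its square is of order [n^-1], and only its linear
    contribution is kept. *)
Lemma tame_power_divergence (H : nat -> R -> R) M4 : tame H ->
  (forall j, -1 <= x_ j) ->
  `|T - sum_pow 2 w - step n * cubic w| <= M4 / n%:R ->
  `|H 0%N T - H 0%N (sum_pow 2 w) - step n * (H 1%N (sum_pow 2 w) * cubic w)|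
    <= (M4 + (`|cubic w| + M4) ^+ 2) / n%:R.
Proof.
move=> tH xm hT; have S0 : 0 <= sum_pow 2 w by apply: sumr_ge0 => j _; exact: sqr_ge0.
have M40 : 0 <= M4.
  have := le_trans (normr_ge0 _) hT.
  by rewrite pmulr_lge0// invr_gt0.
have T0 := power_divergence_ge0 xm; set S := sum_pow 2 w in S0 hT *.
have /andP[e0 e1] := @step_ge0_in R n n0.
have D1 : `|T - S| <= step n * (`|cubic w| + M4).
  have -> : T - S = (T - S - step n * cubic w) + step n * cubic w by ring.
  apply: le_trans (ler_normD _ _) _; rewrite addrC mulrDr lerD//.
    by rewrite normrM ger0_norm.
  apply: le_trans hT _; rewrite -sqr_step mulrC expr2 -mulrA ler_wpM2l//.
  by rewrite ler_piMl.
have -> : H 0%N T - H 0%N S - step n * (H 1%N S * cubic w) =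
   (H 0%N T - H 0%N S - H 1%N S * (T - S)) + H 1%N S * (T - S - step n * cubic
     w) by ring.
apply: le_trans (ler_normD _ _) _; rewrite addrC mulrDl lerD//.
  have [_ _ bH] := tH.
  by rewrite normrM (le_trans _ hT)// ler_piMl// bH.
apply: le_trans (tame_taylor2 tH S0 T0) _.
rewrite -[(T - S) ^+ 2]real_normK ?num_real// -sqr_step mulrC -exprMn.
by rewrite lerXn2r ?nnegrE// mulr_ge0// addr_ge0.
Qed.

End AtSampleSize.
End PointwiseExpansion.

(** * Orthonormal coordinates for the standardized counts *)

Section Householder.
Context {R : realType} {k : nat}.
Variable q : 'I_k.+1 -> R.
Hypotheses (q0 : forall l, 0 < q l) (q1 : \sum_l q l ^+ 2 = 1).

Let v c : R := q c + (c == ord0)%:R.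
Let hh l c : R := (l == c)%:R - v l * v c / (1 + q ord0).

Let d0 : 0 < 1 + q ord0. Proof. by rewrite addr_gt0. Qed.

Let hhC l c : hh l c = hh c l.
Proof. by rewrite /hh eq_sym [v l * _]mulrC. Qed.

Let sum_delta (l : 'I_k.+1) (F : 'I_k.+1 -> R) : \sum_c (l == c)%:R * F c = F l.
Proof.
rewrite (bigD1 l)//= eqxx mul1r big1 ?addr0// => c cl.
by rewrite eq_sym (negbTE cl) mul0r.
Qed.

Let sum_vv : \sum_c v c * v c = 2 * (1 + q ord0).
Proof.
transitivity (\sum_c (q c ^+ 2 + 2 * ((ord0 == c)%:R * q c) + (ord0 == c)%:R * 1)).
  apply: eq_bigr => c _; rewrite /v [c == _]eq_sym.
  by case: (ord0 == c); rewrite /=; ring.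
by rewrite !big_split/= -mulr_sumr !sum_delta q1; ring.
Qed.

Let hh_orth l m : \sum_c hh l c * hh m c = (l == m)%:R.
Proof.
pose beta := (1 + q ord0)^-1.
transitivity (\sum_c ((l == c)%:R * (m == c)%:R
    - ((l == c)%:R * (v m * v c * beta) + (m == c)%:R * (v l * v c * beta))
    + v l * v m * beta ^+ 2 * (v c * v c))).
  by apply: eq_bigr => c _; rewrite /hh -/beta; ring.
rewrite big_split/= sumrB big_split/= !sum_delta -mulr_sumr sum_vv /beta.
by rewrite [m == l]eq_sym; field; rewrite gt_eqF.
Qed.

Let hh0 l : hh l ord0 = - q l.
Proof.
rewrite /hh /v eqxx/=; case: (l == ord0) => /=; first by field; rewrite gt_eqF.
by field; rewrite gt_eqF.
Qed.

(** The columns, other than the first, of the Householder reflection exchanging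
    [q] and the first basis vector up to sign: an orthonormal basis of the
    hyperplane orthogonal to [q]. *)
Definition hyperplane_basis (l : 'I_k.+1) (i : 'I_k) : R := hh l (lift ord0 i).

Local Notation A := hyperplane_basis.
Arguments hyperplane_basis : simpl never.

Lemma hyperplane_basis_proj l m :
  \sum_i A l i * A m i = (l == m)%:R - q l * q m.
Proof. by rewrite -hh_orth big_ord_recl !hh0; ring. Qed.

Lemma hyperplane_basis_orth i j : \sum_l A l i * A l j = (i == j)%:R.
Proof.
rewrite -(inj_eq (@lift_inj _ ord0)) -hh_orth; apply: eq_bigr => l _.
by rewrite /A ![hh l _]hhC.
Qed.

Lemma hyperplane_basis_normal i : \sum_l q l * A l i = 0.
Proof.
have h : \sum_c hh ord0 c * hh (lift ord0 i) c = 0 by rewrite hh_orth (negbTE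
  (neq_lift _ _)).
apply: oppr_inj; rewrite oppr0 -[RHS]h -sumrN; apply: eq_bigr => l _.
by rewrite [hh ord0 l]hhC hh0 mulNr [hh (lift _ _) _]hhC.
Qed.

Definition lift_hyperplane (y : 'rV[R]_k) (l : 'I_k.+1) : R :=
  \sum_i A l i * y 0 i.

Lemma lift_hyperplane_normal y : \sum_l q l * lift_hyperplane y l = 0.
Proof.
under eq_bigr do rewrite mulr_sumr.
rewrite exchange_big/= big1// => i _.
under eq_bigr do rewrite mulrA.
by rewrite -mulr_suml hyperplane_basis_normal mul0r.
Qed.

Lemma lift_hyperplane_isometry y : sum_pow 2 (lift_hyperplane y) = sqnorm y.
Proof.
transitivity (\sum_i \sum_j (\sum_l A l i * A l j) * (y 0 i * y 0 j)).
  under [RHS]eq_bigr do under eq_bigr do rewrite mulr_suml.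
  under [RHS]eq_bigr do rewrite exchange_big/=.
  rewrite [RHS]exchange_big/=; apply: eq_bigr => l _.
  rewrite expr2 /lift_hyperplane mulr_suml; apply: eq_bigr => i _.
  by rewrite mulr_sumr; apply: eq_bigr => j _; ring.
apply: eq_bigr => i _; under eq_bigr do rewrite hyperplane_basis_orth.
rewrite (bigD1 i)//= eqxx mul1r -expr2 big1 ?addr0// => j ji.
by rewrite eq_sym (negbTE ji) mul0r.
Qed.

(** The jump caused by a trial of class [l], whose probability is [q l ^+ 2]:
    dividing by [q l] makes the covariance the identity. *)
Definition hyperplane_jump (l : 'I_k.+1) : 'rV[R]_k := \row_i (A l i / q l).

Lemma hyperplane_jump_law : exists B : R,
  centered_law (fun l => q l ^+ 2) hyperplane_jump B.
Proof.
exists (\sum_l \sum_i `|hyperplane_jump l 0 i|); split => //.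
- by move=> l; exact: sqr_ge0.
- move=> i; rewrite -[RHS](hyperplane_basis_normal i); apply: eq_bigr => l _.
  by rewrite mxE; field; rewrite gt_eqF.
- move=> l i; rewrite (bigD1 l)//= (bigD1 i)//= -addrA lerDl addr_ge0//.
    exact: sumr_ge0.
  by apply: sumr_ge0 => m _; exact: sumr_ge0.
Qed.

Lemma hyperplane_jump_cov i j :
  \sum_l q l ^+ 2 * hyperplane_jump l 0 i * hyperplane_jump l 0 j = (i == j)%:R.
Proof.
rewrite -hyperplane_basis_orth; apply: eq_bigr => l _.
by rewrite !mxE; field; rewrite gt_eqF.
Qed.

(** In coordinates on the hyperplane orthogonal to [q], the vector of
    centered counts divided by the [q l] is the sum of the jumps. *)
Lemma lift_hyperplane_jumps n (x : 'I_n -> 'I_k.+1) (e : R) l :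
  lift_hyperplane (e *: \sum_t hyperplane_jump (x t)) l
  = e * (#|[set t | x t == l]%SET|%:R / q l - n%:R * q l).
Proof.
transitivity (e * \sum_t ((x t == l)%:R / q l - q l)).
  rewrite /lift_hyperplane mulr_sumr.
  under eq_bigr do rewrite mxE summxE mulrCA mulr_sumr.
  under eq_bigr do rewrite mulr_sumr.
  rewrite exchange_big/=; apply: eq_bigr => t _.
  rewrite -mulr_sumr; congr (_ * _).
  under eq_bigr do rewrite mxE mulrA.
  rewrite -mulr_suml hyperplane_basis_proj mulrBl [l == _]eq_sym.
  rewrite mulfK; last by rewrite gt_eqF.
  congr (_ - _).
  by case: eqP => [->//|_]; rewrite !mul0r.
congr (_ * _); rewrite sumrB -mulr_suml sumr_const card_ord -[q l *+ n]mulr_natl.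
congr (_ / _ - _); rewrite -natr_sum; congr (_%:R).
by rewrite -sum1_card [RHS]big_mkcond/=; apply: eq_bigr => t _; rewrite inE; case: eqP.
Qed.

End Householder.

(** * Independent trials as an iterated jump *)

Section MultinomialWalk.
Context {R : realType} {k : nat} {L : finType}.
Variables (p : L -> R) (b : L -> 'rV[R]_k) (e : R).

(** The expectation after [n] independent jumps, as a sum over their
    sequences: the iterated average treats the trials one at a time. *)
Lemma iter_convolve n (F : 'rV[R]_k -> R) v :
  iter n (convolve p b e) F v =
  \sum_(x : {ffun 'I_n -> L}) (\prod_t p (x t)) * F (v + e *: \sum_t b (x t)).
Proof.
elim: n F v => [|n IH] F v.
  rewrite (bigD1 (ffun0 (card_ord 0)))//= big_ord0 mul1r big_ord0 scaler0 addr0.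
  rewrite big1 ?addr0// => x /eqP[]; apply/ffunP => -[].
  by [].
pose cons (lx : L * {ffun 'I_n -> L}) : {ffun 'I_n.+1 -> L} :=
  [ffun i => if unlift ord0 i is Some j then lx.2 j else lx.1].
pose uncons (x : {ffun 'I_n.+1 -> L}) : L * {ffun 'I_n -> L} :=
  (x ord0, [ffun j => x (lift ord0 j)]).
have consK : cancel cons uncons.
  move=> [l x]; rewrite /uncons /cons ffunE unlift_none; congr (_, _).
  by apply/ffunP => j; rewrite !ffunE liftK.
have unconsK : cancel uncons cons.
  move=> x; apply/ffunP => i; rewrite ffunE /uncons /=.
  by case: unliftP => [j ->|->]//; rewrite ffunE.
rewrite iterSr IH (reindex cons)/=; last by exists uncons => ? _;
  [exact: consK|exact: unconsK].
rewrite -(pair_bigA _ (fun l x => (\prod_t p (cons (l, x) t)) *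
   F (v + e *: \sum_t b (cons (l, x) t))))/= exchange_big/=.
apply: eq_bigr => x _; rewrite mulr_sumr; apply: eq_bigr => l _.
rewrite !big_ord_recl ffunE unlift_none/=.
under [in RHS]eq_bigr do rewrite ffunE liftK/=.
under [X in F (v + e *: (_ + X))]eq_bigr do rewrite ffunE liftK/=.
by rewrite scalerDr [e *: b l + _]addrC addrA mulrCA mulrA.
Qed.

End MultinomialWalk.

Section Trials.
Context {R : realType} {d : measure_display} {T : measurableType d}.
Variables (P : probability T R) (n r : nat) (p : 'I_r -> R) (X : 'I_n -> T -> 'I_r).
Hypothesis itX : independent_trials P p X.

Lemma expectation_trials (Psi : {ffun 'I_n -> 'I_r} -> R) :
  ('E_P[fun t => Psi [ffun i => X i t]])%E
  = (\sum_(x : {ffun 'I_n -> 'I_r}) (\prod_i p (x i)) * Psi x)%:E.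
Proof.
have [mX pX iX] := itX.
pose D (x : {ffun 'I_n -> 'I_r}) : set T := \bigcap_i (X i @^-1` [set x i]).
have mD x : measurable (D x) by apply: fin_bigcap_measurable.
have PD x : P (D x) = (\prod_i p (x i))%:E.
  rewrite /D iX; congr (_%:E); apply: eq_bigr => i _.
  by rewrite pX.
rewrite unlock.
transitivity (\int[P]_t (\sum_(x : {ffun 'I_n -> 'I_r}) (Psi x)%:E * (\1_(D x)
  t)%:E))%E.
  apply: eq_integral => t _.
  rewrite (bigD1 [ffun i => X i t])//= big1 ?adde0 => [|x xX].
    by rewrite indicE mem_set ?mule1// => i _ /=; rewrite ffunE.
  rewrite indicE memNset ?mule0// => Dx; move/eqP: xX; apply.
  by apply/ffunP => i; rewrite ffunE; have := Dx i Logic.I.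
rewrite integral_sum//; last first.
  move=> x; apply: integrableZl => //; exact: integrable_indic.
rewrite -sumEFin; apply: eq_bigr => x _.
rewrite integralZl//; last exact: integrable_indic.
rewrite integral_indic// setIT [RHS]EFinM muleC.
by congr (_ * _)%E; exact: PD.
Qed.

End Trials.

(** * The rate for normalized test functions *)

Section TameRate.
Context {R : realType}.
Variables (k : nat) (p : 'I_k.+1 -> R) (lambda : R).
Hypotheses (p0 : forall l, 0 < p l) (p1 : \sum_l p l = 1) (l0 : 0 < lambda).

Local Notation V := 'rV[R]_k.

Let q l : R := Num.sqrt (p l).
Let q0 l : 0 < q l. Proof. by rewrite sqrtr_gt0. Qed.
Let qE l : q l ^+ 2 = p l. Proof. by rewrite sqr_sqrtr// ltW. Qed.
Let q1 : \sum_l q l ^+ 2 = 1. Proof. by under eq_bigr do rewrite qE. Qed.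
Let pE : (fun l => q l ^+ 2) = p. Proof. by apply/funext => l; exact: qE. Qed.

Let b := hyperplane_jump q.
Let w := lift_hyperplane q.
Let C3 (v : V) : R := cubic p lambda (w v).

Definition class_counts n (x : 'I_n -> 'I_k.+1) (l : 'I_k.+1) : nat :=
  #|[set t | x t == l]%SET|.

Lemma standardize_lift n (x : 'I_n -> 'I_k.+1) l : (0 < n)%N ->
  standardize n p (class_counts x) l = w (step n *: \sum_t b (x t)) l.
Proof.
move=> n0; rewrite /w /b lift_hyperplane_jumps// /standardize /class_counts.
have s0 : 0 < Num.sqrt (n%:R : R) by rewrite sqrtr_gt0 ltr0n.
rewrite sqrtrM ?ler0n// -/(q l) -qE /step.
have nE : n%:R = Num.sqrt (n%:R : R) ^+ 2 by rewrite sqr_sqrtr.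
move: (Num.sqrt n%:R) s0 nE => s s0 ->.
by field; rewrite !gt_eqF.
Qed.

Let smooth_w m l : smooth m (fun (_ : unit) v => w v l).
Proof. by apply: smooth_sum => i; apply: smoothZ; exact: smooth_coord. Qed.

Let smooth_C3 m : smooth m (fun (_ : unit) v => C3 v).
Proof.
apply: smoothZ; apply: smooth_sum => l; apply: smoothZ; apply: smoothX.
exact: smooth_w.
Qed.

Let smooth_w4 m : smooth m (fun (_ : unit) v => sum_pow 4 (w v)).
Proof. by apply: smooth_sum => l; apply: smoothX; exact: smooth_w. Qed.

Let wN v l : w (- v) l = - w v l.
Proof. by rewrite /w /lift_hyperplane -sumrN; apply: eq_bigr => i _;
  rewrite mxE mulrN. Qed.

Let C3N v : C3 (- v) = - C3 v.
Proof.
rewrite /C3 /cubic -mulrN -sumrN; congr (_ * _); apply: eq_bigr => l _.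
by rewrite wN; ring.
Qed.

Let sqnormN (v : V) : sqnorm (- v) = sqnorm v.
Proof. by apply: eq_bigr => i _; rewrite mxE sqrrN. Qed.

(** A class count lies between 0 and [n], so its relative deviation stays in
    a range that does not depend on [n], on which the powers can be expanded. *)
Let standardize_range n (x : 'I_n -> 'I_k.+1) l : (0 < n)%N ->
  -1 <= standardize n p (class_counts x) l / Num.sqrt (n%:R * p l)
     <= \sum_l (p l)^-1.
Proof.
move=> n0; rewrite /standardize.
have np : 0 < n%:R * p l by rewrite mulr_gt0// ltr0n.
rewrite -mulrA -invfM -expr2 sqr_sqrtr ?(ltW np)// mulrBl divff ?gt_eqF//.
apply/andP; split; first by rewrite lerDr divr_ge0// ltW.
apply: (@le_trans _ _ ((class_counts x l)%:R / (n%:R * p l))).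
  by rewrite gerBl.
rewrite ler_pdivrMr//; apply: (@le_trans _ _ n%:R).
  by rewrite ler_nat /class_counts -[n in X in (_ <= X)%N]card_ord max_card.
have -> : (\sum_l (p l)^-1) * (n%:R * p l) = n%:R * ((\sum_l (p l)^-1) * p l) by ring.
rewrite ler_peMr// -ler_pdivrMr// mul1r (bigD1 l)//= lerDl.
by apply: sumr_ge0 => i _; rewrite invr_ge0 ltW.
Qed.

Let standardizeE n (x : 'I_n -> 'I_k.+1) : (0 < n)%N ->
  standardize n p (class_counts x) = w (step n *: \sum_t b (x t)).
Proof. by move=> n0; apply/funext => l; rewrite standardize_lift. Qed.

Lemma class_divergence_ge0 n (x : 'I_n -> 'I_k.+1) : (0 < n)%N ->
  0 <= power_divergence lambda n p (standardize n p (class_counts x)).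
Proof.
move=> n0; apply: power_divergence_ge0 => // [|l].
  by rewrite standardizeE//; exact: lift_hyperplane_normal.
by have /andP[] := standardize_range x l n0.
Qed.

(** The expansions of the powers and of the test function leave an error that is
    polynomial in the standardized counts, hence dominated by an exponential of
    the position of the walk. *)
Let outcome_expansion : exists C a : R, [/\ 0 <= C, 0 <= a &
  forall (H : nat -> R -> R) n (x : 'I_n -> 'I_k.+1), tame H -> (0 < n)%N ->
  let y := step n *: \sum_t b (x t) in
  `|H 0%N (power_divergence lambda n p (standardize n p (class_counts x)))
    - H 0%N (sqnorm y) - step n * (H 1%N (sqnorm y) * C3 y)|
  <= C * expw a y / n%:R].
Proof.
pose K : R := \sum_l (p l)^-1.
have K0 : 0 <= K by apply: sumr_ge0 => l _; rewrite invr_ge0 ltW.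
have [C C0 HC] := powR_taylor (addr_gt0 l0 ltr01) K0.
pose c1 : R := 2 / (lambda * (lambda + 1)) * C * K.
pose M4 v := c1 * sum_pow 4 (w v).
(* 2 (C3^2 + M4^2) is a smooth majorant of (|C3| + M4)^2. *)
pose E v := M4 v + 2 * (C3 v ^+ 2 + M4 v ^+ 2).
have [D [a [D0 a0 ED]]] : uniform_growth (fun (_ : unit) v => E v).
  apply: (@smooth_growth _ _ 0); apply: smoothD.
    by apply: smoothZ; exact: smooth_w4.
  apply: smoothZ; apply: smoothD; apply: smoothX; first exact: smooth_C3.
  by apply: smoothZ; exact: smooth_w4.
exists D, a; split => // H n x tH n0; lazy zeta; set y := step n *: _.
have x1 l : -1 <= w y l / Num.sqrt (n%:R * p l) <= K.
  by rewrite -standardize_lift//; exact: standardize_range.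
rewrite standardizeE// -/y.
have wy0 : \sum_j Num.sqrt (p j) * w y j = 0 by exact: lift_hyperplane_normal.
have h := power_divergence_expansion p0 p1 l0 n0 wy0 C0 HC x1.
have h' : `|power_divergence lambda n p (w y) - sum_pow 2 (w y) - step n * C3 y|
    <= M4 y / n%:R.
  by apply: le_trans h _; rewrite /M4 /c1 mulrAC.
have x1' l : -1 <= w y l / Num.sqrt (n%:R * p l) by have /andP[] := x1 l.
have := tame_power_divergence p0 p1 l0 n0 wy0 tH x1' h'.
rewrite /w lift_hyperplane_isometry// -/w => /le_trans; apply.
rewrite ler_wpM2r ?invr_ge0//; apply: le_trans (ED tt y).
apply: le_trans (ler_norm _); rewrite lerD2l -/(C3 y).
have -> : (`|C3 y| + M4 y) ^+ 2 = `|C3 y| ^+ 2 + 2 * `|C3 y| * M4 y + M4 y ^+ 2 by ring.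
rewrite -[C3 y ^+ 2]real_normK ?num_real//.
by have := sqr_ge0 (`|C3 y| - M4 y); nra.
Qed.

(** The statistic is replaced by its quadratic and cubic parts
    ([outcome_expansion] and [walk_expw]); the cubic term is odd, so its
    expectation is of order [step n] and its factor [step n] makes the
    product of order [n^-1] ([walk_odd]); in the quadratic term, which is
    even, the jumps are symmetrized ([walk_even]), then made coin tosses
    along the axes ([walk_axes]), then Gaussian ([axes_walk_chi_square]). *)
Lemma tame_rate : exists2 C : R, 0 <= C &
  forall (H : nat -> R -> R) n, tame H -> (0 < n)%N ->
  `|\sum_(x : {ffun 'I_n -> 'I_k.+1}) (\prod_t p (x t)) *
       H 0%N (power_divergence lambda n p (standardize n p (class_counts x)))
    - chi_mean k (half_line (H 0%N)) 0| <= C / n%:R.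
Proof.
have [B] := hyperplane_jump_law q0 q1; rewrite -/b pE => pb.
have cov i j : \sum_l p l * b l 0 i * b l 0 j = (i == j)%:R.
  by rewrite -(hyperplane_jump_cov q0 q1); apply: eq_bigr => l _; rewrite qE.
have [C1 [a [C10 a0 H1]]] := outcome_expansion.
have [C2 C20 H2] := walk_expw pb a0.
pose I := {H : nat -> R -> R | tame H}.
have s0 : smooth 6 (fun (H : I) (v : V) => sval H 0%N (sqnorm v)) by exact: smooth_tame.
have s1 : smooth 3 (fun (H : I) (v : V) => sval H 1%N (sqnorm v) * C3 v).
  by apply: smoothM; [exact: smooth_tame|exact: (smooth_reindex (fun=> tt)
    (smooth_C3 3))].
have odd1 (H : I) v :
    sval H 1%N (sqnorm (- v)) * C3 (- v) = - (sval H 1%N (sqnorm v) * C3 v).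
  by rewrite sqnormN C3N mulrN.
have even0 (H : I) v : sval H 0%N (sqnorm (- v : V)) = sval H 0%N (sqnorm v).
  by rewrite sqnormN.
have [C4 C40 H4] := walk_odd pb s1 odd1.
have [C5 C50 H5] := walk_even pb s0 even0.
have [C6 C60 H6] := walk_axes pb cov (smoothW (isT : (4 <= 6)%N) s0).
have [C7 C70 H7] := @axes_walk_chi_square R k.
exists (C1 * C2 + C4 + C5 + C6 + C7) => [|H n tH n0].
  by rewrite !addr_ge0// mulr_ge0.
pose HI : I := exist _ H tH.
have pi0 (x : {ffun 'I_n -> 'I_k.+1}) : 0 <= \prod_t p (x t).
  by apply: prodr_ge0 => t _; exact: ltW.
pose F0 (v : V) := H 0%N (sqnorm v); pose F1 (v : V) := H 1%N (sqnorm v) * C3 v.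
pose S0 := \sum_(x : {ffun 'I_n -> 'I_k.+1}) (\prod_t p (x t)) *
       H 0%N (power_divergence lambda n p (standardize n p (class_counts x))).
have h1 : `|S0 - iter n (convolve p b (step n)) F0 0
            - step n * iter n (convolve p b (step n)) F1 0| <= C1 * C2 / n%:R.
  rewrite !iter_convolve mulr_sumr -!sumrB.
  apply: le_trans (ler_norm_sum _ _ _) _.
  apply: (@le_trans _ _ (\sum_(x : {ffun 'I_n -> 'I_k.+1}) (C1 / n%:R) *
      ((\prod_t p (x t)) * expw a (0 + step n *: \sum_t b (x t))))); last first.
    rewrite -mulr_sumr -iter_convolve [C1 * C2 / _]mulrAC ler_wpM2l ?H2//.
    by rewrite divr_ge0.
  apply: ler_sum => x _; rewrite add0r.
  have := H1 H n x tH n0; set y := step n *: _ => h.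
  have -> : (\prod_t p (x t)) * H 0%N (power_divergence lambda n p
    (standardize n p (class_counts x)))
     - (\prod_t p (x t)) * F0 y - step n * ((\prod_t p (x t)) * F1 y) =
    (\prod_t p (x t)) * (H 0%N (power_divergence lambda n p (standardize n p
      (class_counts x)))
     - F0 y - step n * F1 y) by ring.
  rewrite normrM ger0_norm// [leRHS]mulrCA ler_wpM2l//; apply: le_trans h _.
  by rewrite mulrAC.
have h4 : `|step n * iter n (convolve p b (step n)) F1 0| <= C4 / n%:R.
  have /andP[e0 _] := @step_ge0_in R n n0.
  rewrite normrM ger0_norm//; apply: le_trans (ler_wpM2l e0 (H4 HI n n0)) _.
  by rewrite mulrCA -expr2 sqr_step.
have h5 := H5 HI n n0; have h6 := H6 HI n n0; have h7 := H7 H n tH n0.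
rewrite !mulrDl; set X0 := iter n (convolve p b _) _ 0 in h5.
set X1 := iter n (convolve (symw p) _ _) _ 0 in h5 h6.
set X2 := iter n (axes_step _ _) _ 0 in h6 h7.
set X3 := chi_mean _ _ _ in h7 *; set X4 := step n * _ in h1 h4.
have -> : S0 - X3 = (S0 - X0 - X4) + X4 + (X0 - X1) + (X1 - X2) + (X2 - X3) by ring.
rewrite (le_trans (ler_normD _ _))// lerD// (le_trans (ler_normD _ _))// lerD//.
by rewrite (le_trans (ler_normD _ _))// lerD// (le_trans (ler_normD _ _))// lerD.
Qed.

End TameRate.

(** * Functions on the half-line and their norms *)

Section HalfLine.
Context {R : realType}.
Implicit Types (f h : R -> R) (x y : R).

(** The prolongation by the tangent at 0 turns the one-sided derivative there
    into a two-sided one. *)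
Definition extend_linear f y : R :=
  if 0 <= y then f y else f 0 + y * nneg_deriv f 0.

Lemma extend_linearE f x : 0 <= x -> extend_linear f x = f x.
Proof. by rewrite /extend_linear => ->. Qed.

Let diffq_extend f x (e : R) : 0 <= x -> nneg_derivable f x -> 0 < e ->
  exists2 dl : R, 0 < dl & forall y, `|x - y| < dl -> y != x ->
    `|nneg_deriv f x - (extend_linear f y - extend_linear f x) / (y - x)| <= e.
Proof.
move=> x0 dfx e0; set d := nneg_deriv f x; set g := extend_linear f.
have : \forall y \near x^', `[0, +oo[%classic y -> `|d - nneg_diffq f x y| <= e.
  by move: dfx => /cvgrPdist_le/(_ _ e0); rewrite near_withinE.
rewrite /dnbhs near_withinE => /nbhs_ballP[dl /= dl0 Hdl].
(* Away from 0, a neighbourhood of [x] small enough to stay in the half-line. *)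
pose dl' := if 0 < x then Num.min dl x else dl.
exists dl'; first by rewrite /dl'; case: ifPn => // xp; rewrite lt_min dl0.
move=> y xy yx.
have xydl : `|x - y| < dl.
  by apply: lt_le_trans xy _; rewrite /dl'; case: ifPn => // _; rewrite ge_min lexx.
have [y0|y0] := leP 0 y.
  rewrite /g !extend_linearE//.
  by apply: Hdl => //=; rewrite in_itv/= y0.
have x00 : x = 0.
  apply/eqP; apply: contraTT y0 => xN0; rewrite -leNgt.
  have xp : 0 < x by rewrite lt_def xN0.
  move: xy; rewrite /dl' xp lt_min => /andP[_].
  by rewrite ltr_norml => /andP[_]; rewrite ltrBlDr ltrDl => /ltW.
rewrite /g /extend_linear x00 lexx [0 <= y]leNgt y0/= subr0 [f 0 + _]addrC
  addrK [y * _]mulrC -mulrA.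
by rewrite divff ?lt_eqF// mulr1 /d x00 subrr normr0 ltW.
Qed.

Lemma is_derive_extend_linear f x : 0 <= x -> nneg_derivable f x ->
  is_derive x 1 (extend_linear f) (nneg_deriv f x).
Proof.
move=> x0 dfx.
have h : (t^-1 *: ((extend_linear f \o shift x) (t *: 1) - extend_linear f x))
    @[t --> (0 : R)^'] --> nneg_deriv f x.
  apply/cvgrPdist_le => e e0; have [dl dl0 H] := diffq_extend x0 dfx e0.
  rewrite /dnbhs near_withinE; apply/nbhs_ballP; exists dl => //= t.
  rewrite -ball_normE /= sub0r normrN => tdl t0.
  have := H (t + x); rewrite opprD addrCA subrr addr0 normrN => /(_ tdl).
  rewrite -[X in _ != X]add0r (inj_eq (addIr x)) => /(_ t0).
  by rewrite addrK [_ *: 1]mulr1 [_ *: _]mulrC.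
by split; [apply/cvg_ex; exists (nneg_deriv f x)|apply: cvg_lim].
Qed.

(** Subtracting the value at 0 from the function, but not from its
    derivatives, makes it vanish there. *)
Definition normalized h (M : R) (j : nat) x : R :=
  (extend_linear (nneg_derivn j h) x - (if j is 0%N then h 0 else 0)) / M.

Lemma tame_normalized h (M : R) : 0 < M -> Cb 6 h ->
  (forall j x, (0 < j <= 6)%N -> 0 <= x -> `|nneg_derivn j h x| <= M) ->
  tame (normalized h M).
Proof.
move=> M0 [dh _] hM; split.
- by rewrite /normalized extend_linearE// subrr mul0r.
- move=> j x j6 x0; rewrite {2}/normalized extend_linearE// subr0.
  have d := is_derive_extend_linear x0 (dh j j6 x x0).
  rewrite (_ : normalized h M j = (fun y => M^-1 *
    (extend_linear (nneg_derivn j h) y - (if j is 0%N then h 0 else 0)))); last first.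
    by apply/funext => y; rewrite mulrC.
  apply: (is_derive_eq (is_derive_scale M^-1 (is_derive_sub d
    (is_derive_cst (if j is 0%N then h 0 else 0) x 1)))).
  by rewrite subr0 mulrC.
- move=> [//|j] x j6 x0; rewrite /normalized extend_linearE// subr0.
  by rewrite normrM normfV (ger0_norm (ltW M0)) ler_pdivrMr// mul1r hM.
Qed.

Lemma normalized0 h (M : R) x : M != 0 -> 0 <= x ->
  h x = M * normalized h M 0 x + h 0.
Proof. by move=> M0 x0; rewrite /normalized extend_linearE//= mulrC divfK// subrK. Qed.

Lemma nneg_supnorm_ge f x : 0 <= x -> (`|f x|%:E <= nneg_supnorm f)%E.
Proof.
by move=> x0; apply: ereal_sup_ubound; exists x => //=; rewrite in_itv/= x0.
Qed.

Lemma nneg_supnorm_ge0 f : (0 <= nneg_supnorm f)%E.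
Proof. by apply: le_trans (nneg_supnorm_ge f (lexx 0)); rewrite lee_fin. Qed.

Local Ltac eval_nat :=
  repeat match goal with
  | |- context [binomial ?a ?b] =>
      let c := eval vm_compute in (binomial a b) in change (binomial a b) with c
  | |- context [factorial ?a] =>
      let c := eval vm_compute in (factorial a) in change (factorial a) with c
  | |- context [subn ?a ?b] =>
      let c := eval vm_compute in (subn a b) in change (subn a b) with c
  end.

Lemma stirling2_6 j : (0 < j <= 6)%N -> 1 <= @stirling2 R 6 j.
Proof.
by move: j => [|[|[|[|[|[|[|//]]]]]]] // _;
  rewrite /stirling2 !big_ord_recr big_ord0/=; eval_nat; lra.
Qed.

Lemma stirling2_3 j : (0 < j <= 3)%N -> 0 <= @stirling2 R 3 j.
Proof.
by move: j => [|[|[|[|//]]]] // _;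
  rewrite /stirling2 !big_ord_recr big_ord0/=; eval_nat; lra.
Qed.

Lemma htnorm_ge0 (h : R -> R) : (0 <= htnorm 3 h)%E.
Proof.
rewrite /htnorm big_seq_cond; apply: sume_ge0 => j.
rewrite andbT mem_index_iota => j3; apply: mule_ge0.
  by rewrite lee_fin stirling2_3.
by apply: adde_ge0 => //; [apply: mule_ge0|];
  rewrite ?nneg_supnorm_ge0// lee_fin exprn_ge0.
Qed.

Lemma hnorm_ge (h : R -> R) j : (0 < j <= 6)%N ->
  (nneg_supnorm (nneg_derivn j h) <= hnorm 6 h)%E.
Proof.
move=> j6; have s0 i : (0 < i <= 6)%N ->
    (0 <= (stirling2 6 i)%:E * nneg_supnorm (nneg_derivn i h))%E.
  move=> i6; apply: mule_ge0; last exact: nneg_supnorm_ge0.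
  by rewrite lee_fin (le_trans _ (stirling2_6 i6)).
rewrite /hnorm (bigD1_seq j) ?iota_uniq ?mem_index_iota//=.
apply: (@le_trans _ _ ((stirling2 6 j)%:E * nneg_supnorm (nneg_derivn j h))%E).
  rewrite -[leLHS]mul1e; apply: lee_wpmul2r; first exact: nneg_supnorm_ge0.
  by rewrite lee_fin stirling2_6.
rewrite leeDl// big_seq_cond; apply: sume_ge0 => i.
by rewrite mem_index_iota => /andP[i6 _]; exact: s0.
Qed.

End HalfLine.

(** * From normalized to arbitrary test functions *)

Section Rate.
Context {R : realType}.
Local Notation mR := (measurableTypeR R).

Lemma chi_square_expectation_normalized k (h : R -> R) (M : R) : 0 < M ->
  tame (normalized h M) ->
  chi_square_expectation k h
  = (M * chi_mean k (half_line (normalized h M 0)) 0 + h 0)%:E.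
Proof.
move=> M0 tH; have lf := linear_growth_tame tH.
set f := half_line _ in lf *.
have iff_ : (chi_square k).-integrable setT (EFin \o (fun y : mR => f (0 + y))).
  exact/chi_square_integrable/linear_growth_shift.
have mI : measurable (`[(0 : R), +oo[%classic : set mR) by exact: measurable_itv.
have chiI : chi_square k (`[(0 : R), +oo[%classic : set mR) = 1%E.
  have mN : measurable (`]-oo, (0 : R)[%classic : set mR) by exact: measurable_itv.
  have := probability_setC (chi_square k) mN.
  by rewrite setCitvl chi_square_neg sube0.
have iI := integrableS measurableT mI (@subsetT _ _) iff_.
have iMf : (chi_square k).-integrable (`[(0 : R), +oo[%classic : set mR)
    (fun y : mR => (M%:E * (f (0 + y))%:E)%E) by exact: integrableZl.
have ih : (chi_square k).-integrable (`[(0 : R), +oo[%classic : set mR)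
    (fun _ : mR => (h 0)%:E).
  apply: (integrableS measurableT mI (@subsetT _ _)).
  exact: finite_measure_integrable_cst.
rewrite /chi_square_expectation.
transitivity (\int[chi_square k]_(y in (`[(0%R : R), +oo[%classic : set mR))
    (M%:E * (f (0 + y)%R)%:E + (h 0%R)%:E))%E.
  apply: eq_integral => y; rewrite inE/= in_itv/= andbT => y0.
  by rewrite /f half_lineE ?add0r// -EFinM -EFinD -normalized0// gt_eqF.
rewrite integralD// integralZl// -chi_square_restrict//.
rewrite integral_cst// EFinD EFinM; congr (_ * _ + _)%E.
  by rewrite /chi_mean /Rintegral fineK//; exact: integrable_fin_num.
by rewrite -[RHS]mule1; congr (_ * _)%E.
Qed.

Definition rate_bound (lambda : R) (r : nat) (p : r.-tuple R) (C : R) : Prop :=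
  forall (n : nat) (d : measure_display) (T : measurableType d)
    (P : probability T R) (X : 'I_n -> T -> 'I_r),
    (0 < n)%N ->
    independent_trials P (tnth p) X ->
  forall h : R -> R, Cb 6 h ->
    (`| 'E_P[fun t => h (power_divergence lambda n (tnth p)
                           (standardize n (tnth p) (counts X t)))]
        - chi_square_expectation r.-1 h |
     <= (C * r%:R ^+ 7 * n%:R^-1)%:E
        * (hnorm 6 h + htnorm 3 h))%E.

(** The rate for normalized test functions, multiplied by any [M] that
    dominates the derivatives of [h]. All the Stirling numbers in [hnorm 6 h]
    are at least 1, so every [M] larger than this norm is allowed, and [M]
    can be made to decrease to it. *)
Lemma rate_bound_exists (lambda : R) (r : nat) (p : r.-tuple R) :
  0 < lambda -> (2 <= r)%N -> (forall j, 0 < tnth p j) ->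
  \sum_j tnth p j = 1 -> exists C, rate_bound lambda p C.
Proof.
case: r p => [//|k] p l0 k2 p0 p1.
have [C0 C00 HC] := tame_rate p0 p1 l0.
(* A positive constant, so that the bound is infinite when a norm is. *)
exists (C0 + 1) => n d T P X n0 itX h Cbh.
have nR : 0 < n%:R :> R by rewrite ltr0n.
have r7 : 1 <= k.+1%:R ^+ 7 :> R by rewrite exprn_ege1// ler1n.
pose C1 : R := (C0 + 1) * k.+1%:R ^+ 7 * n%:R^-1.
have C10 : 0 < C1.
  by rewrite !mulr_gt0 ?invr_gt0// ?(lt_le_trans _ r7)// ltr_wpDl.
have C01 : C0 / n%:R <= C1.
  rewrite /C1 ler_wpM2r ?invr_ge0 ?(ltW nR)//.
  apply: (@le_trans _ _ (C0 + 1)); first by rewrite lerDl.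
  by rewrite ler_peMr// addr_ge0.
have hn0 : (0 <= hnorm 6 h)%E.
  exact: le_trans (nneg_supnorm_ge0 _) (hnorm_ge h (isT : (0 < 1 <= 6)%N)).
have [hoo|hfin] := eqVneq (hnorm 6 h) +oo%E.
  rewrite hoo addye ?gt0_muley ?lte_fin ?leey//.
  by rewrite -ltNye (lt_le_trans _ (htnorm_ge0 h)).
have hreal : hnorm 6 h \is a fin_num by rewrite ge0_fin_numE// lt_neqAle hfin leey.
set A := fine (hnorm 6 h).
have AE : hnorm 6 h = A%:E by rewrite fineK.
have A0 : 0 <= A by rewrite fine_ge0.
apply: (@le_trans _ _ (C1 * A)%:E); last first.
  rewrite EFinM -AE; apply: lee_wpmul2l; first by rewrite lee_fin ltW.
  by rewrite leeDl// htnorm_ge0.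
pose stat (x : 'I_n -> 'I_k.+1) : R :=
  power_divergence lambda n (tnth p) (standardize n (tnth p) (class_counts x)).
pose Psi (x : {ffun 'I_n -> 'I_k.+1}) : R := h (stat x).
have -> : (fun t => h (power_divergence lambda n (tnth p)
    (standardize n (tnth p) (counts X t)))) = (fun t => Psi [ffun i => X i t]).
  apply/funext => t; rewrite /Psi /stat; congr (h (power_divergence _ _ _ _)).
  apply/funext => j; rewrite /standardize /counts /class_counts.
  congr ((_%:R - _) / _); apply: eq_card => i; by rewrite !inE ffunE.
rewrite (expectation_trials itX).
have sum_pi : \sum_(x : {ffun 'I_n -> 'I_k.+1}) \prod_t tnth p (x t) = 1.
  rewrite -(bigA_distr_bigA (fun (_ : 'I_n) j => tnth p j)).
  by rewrite big1// => i _; exact: p1.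
have key M : A < M -> (`|(\sum_(x : {ffun 'I_n -> 'I_k.+1}) (\prod_t tnth p (x
  t)) * Psi x)%:E
    - chi_square_expectation k h| <= (M * C1)%:E)%E.
  move=> AM; have M0 : 0 < M by exact: le_lt_trans AM.
  have tH : tame (normalized h M).
    apply: tame_normalized => // j x j6 x0.
    rewrite -lee_fin (le_trans (nneg_supnorm_ge _ x0))//.
    by rewrite (le_trans (hnorm_ge h j6))// AE lee_fin ltW.
  rewrite (chi_square_expectation_normalized k M0 tH) -EFinB lee_fin.
  have -> : \sum_(x : {ffun 'I_n -> 'I_k.+1}) (\prod_t tnth p (x t)) * Psi x =
    M * (\sum_(x : {ffun 'I_n -> 'I_k.+1}) (\prod_t tnth p (x t)) *
           normalized h M 0 (stat x)) + h 0.
    rewrite -[X in _ + X]mul1r -[X in X * h 0]sum_pi mulr_suml mulr_sumr -big_split/=.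
    apply: eq_bigr => x _; rewrite /Psi (normalized0 h (M := M)) ?gt_eqF//.
      by ring.
    exact: class_divergence_ge0.
  rewrite opprD addrACA subrr addr0 -mulrBr normrM gtr0_norm// ler_pM2l//.
  by apply: le_trans (HC _ n tH n0) C01.
apply/lee_addgt0Pr => e e0; rewrite -EFinD.
have d0 : 0 < e / C1 by rewrite divr_gt0.
apply: le_trans (key (A + e / C1) _) _; first by rewrite ltrDl.
by rewrite lee_fin mulrDl divfK ?gt_eqF// mulrC.
Qed.

End Rate.

Theorem theorem3p3 (R : realType) :
  exists C : R -> seq R -> R,
  forall (r : nat) (p : r.-tuple R) (lambda : R),
    (2 <= r)%N ->
    (forall j : 'I_r, 0 < tnth p j) ->
    \sum_(j < r) tnth p j = 1 ->
    (exists2 m : nat, (0 < m)%N & lambda = m%:R) \/ 5 < lambda ->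
  forall (n : nat) (d : measure_display) (T : measurableType d)
    (P : probability T R) (X : 'I_n -> T -> 'I_r),
    (0 < n)%N ->
    independent_trials P (tnth p) X ->
  forall h : R -> R, Cb 6 h ->
    (`| 'E_P[fun t => h (power_divergence lambda n (tnth p)
                           (standardize n (tnth p) (counts X t)))]
        - chi_square_expectation r.-1 h |
     <= (C lambda p * r%:R ^+ 7 * n%:R^-1)%:E
        * (hnorm 6 h + htnorm 3 h))%E.
Proof.
pose good (lambda : R) (s : seq R) := [/\ 0 < lambda, (2 <= size s)%N,
  forall j, 0 < tnth (in_tuple s) j & \sum_j tnth (in_tuple s) j = 1].
(* The constant is a function of the parameters alone, with an arbitrary
   value where they are not those of a divergence. *)
have /choice[C HC] : forall ls : R * seq R, exists C,
    good ls.1 ls.2 -> rate_bound ls.1 (in_tuple ls.2) C.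
  move=> [lambda s]; have [[l0 s2 p0 p1]|ng] := pselect (good lambda s).
    by have [C HC] := rate_bound_exists l0 s2 p0 p1; exists C.
  by exists 0 => /ng.
exists (fun lambda s => C (lambda, s)) => r p lambda r2 p0 p1 hl.
have l0 : 0 < lambda.
  by case: hl => [[m m0 ->]|l5]; [rewrite ltr0n|exact: lt_trans l5].
case: p p0 p1 => s /= sr; have /eqP rE := sr; case: r / rE r2 sr => r2 sr.
have -> : Tuple sr = in_tuple s by exact: val_inj.
by move=> p0 p1; exact: (HC (lambda, s)).
Qed.
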